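(* Let $K \subseteq \mathbb{R}^d$ be an isotropic convex body with isotropic constant $L_K$. For $b>0$ let $Y_b$ be the random variable with density \[ f_{Y_b}(t) = \frac{e^{-|t|}}{2(1-e^{-b})}\,\mathbf{1}_{[-b,b]}(t), \] and let $\sigma_{Y_b}$ be its standard deviation. (a) For every $t_0 \in [0,\sqrt{3}]$ and every hyperplane $H$ at distance $t_0 L_K$ from the origin, \[ \mathrm{vol}_{d-1}(K\cap H) \ \geq\ L_K^{-1}\, \inf_{b>0}\ \sigma_{Y_b}\, f_{Y_b}(t_0 \sigma_{Y_b}). \] (b) For every $t_0 \in [\tfrac{1}{\sqrt2},\sqrt3]$ and every hyperplane $H$ at distance $t_0 L_K$ from the origin, \[ \mathrm{vol}_{d-1}(K\cap H) \ \geq\ L_K^{-1}\,\frac{1}{\sqrt2}\, e^{-t_0\sqrt2}. \] (c) Let \[ c_0 = \inf_{b>0}\ \frac{1}{\sigma(b)} \log\left(\frac{\sqrt3\,\sigma(b)}{1-e^{-b}}\right), \qquad \text{where } \sigma(b)>0,\ \ \sigma(b)^2 = 2 - \frac{e^{-b}b(b+2)}{1-e^{-b}} \] (numerically $c_0 \approx 0.63217$). For every $t_0\in[0,c_0]$ and every hyperplane $H$ at distance $t_0 L_K$ from the origin, \[ \mathrm{vol}_{d-1}(K\cap H) \ \geq\ L_K^{-1}\,\frac{1}{2\sqrt3}. \]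
   Context: A convex body in $\mathbb{R}^d$ is a compact convex set with non-empty interior. A convex body $K$ is symmetric if $K=-K$. A symmetric convex body $K$ is called isotropic if it has volume $1$ and $\int_K x\otimes x\,dx = L_K^2\, I_{d\times d}$ for some constant $L_K>0$, called the isotropic constant of $K$; thus ''isotropic convex body'' always means a symmetric one. $\mathrm{vol}_{d-1}$ denotes the $(d-1)$-dimensional Lebesgue measure. $\mathbf{1}_E$ denotes the indicator function of a set $E$. *)

(* Defs.v *)
From HB Require Import structures.
From mathcomp Require Import all_boot all_order all_algebra.
From mathcomp Require Import all_classical all_reals all_analysis.

Set Implicit Arguments.
Unset Strict Implicit.
Unset Printing Implicit Defensive.

Import Order.TTheory GRing.Theory Num.Theory.
Import numFieldNormedType.Exports.

Local Open Scope classical_set_scope.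
Local Open Scope ring_scope.

Section tuple_of_pair.
Context {R : realType} (n : nat).

Definition tuple_of_pair (z : R * n.-tuple R) : n.+1.-tuple R :=
  [tuple of z.1 :: z.2].

Lemma measurable_tuple_of_pair : measurable_fun setT tuple_of_pair.
Proof. exact: measurable_cons. Qed.

End tuple_of_pair.

Section lebesgue_cons.
Context {R : realType} (n : nat).
Variable mu : {sigma_finite_measure set (n.-tuple R) -> \bar R}.

Definition lebesgue_cons : set (n.+1.-tuple R) -> \bar R :=
  pushforward (@lebesgue_measure R \x mu)%E (@tuple_of_pair R n).

Let lebesgue_cons0 : lebesgue_cons set0 = 0%E.
Proof. have ? := @measurable_tuple_of_pair R n; exact: measure0. Qed.

Let lebesgue_cons_ge0 A : (0 <= lebesgue_cons A)%E.
Proof. have ? := @measurable_tuple_of_pair R n; exact: measure_ge0. Qed.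

Let lebesgue_cons_sigma_additive : semi_sigma_additive lebesgue_cons.
Proof. have ? := @measurable_tuple_of_pair R n; exact: measure_semi_sigma_additive. Qed.

HB.instance Definition _ := isMeasure.Build _ _ _ lebesgue_cons
  lebesgue_cons0 lebesgue_cons_ge0 lebesgue_cons_sigma_additive.

Let lebesgue_cons_sigma_finite : sigma_finite setT lebesgue_cons.
Proof.
have /sigma_finiteP[F [TF ndF Foo]] := sigma_finiteT (@lebesgue_measure R).
have /sigma_finiteP[G [TG ndG Goo]] := sigma_finiteT mu.
pose g (t : n.+1.-tuple R) : R * n.-tuple R := (thead t, [tuple of behead t]).
have mg : measurable_fun setT g.
  apply/measurable_fun_pairP; split; last exact: measurable_behead.
  exact: measurable_tnth.
have gK z : g (tuple_of_pair z) = z.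
  by case: z => x t; congr pair => //; exact/val_inj.
exists (fun k => g @^-1` (F k `*` G k)) => [|k].
  rewrite -preimage_bigcup; apply/esym/seteqP; split => // t _ /=.
  have [i _ Fi] : (\bigcup_i F i) (g t).1 by rewrite -TF.
  have [j _ Gj] : (\bigcup_j G j) (g t).2 by rewrite -TG.
  exists (maxn i j) => //; split.
  - by move: Fi; exact/subsetPset/ndF/leq_maxl.
  - by move: Gj; exact/subsetPset/ndG/leq_maxr.
have [mF Fk] := Foo k; have [mG Gk] := Goo k.
have mFG := measurableX mF mG.
split; first by rewrite -[X in measurable X]setTI; exact: mg.
rewrite /lebesgue_cons /pushforward.
have -> : @tuple_of_pair R n @^-1` (g @^-1` (F k `*` G k)) = F k `*` G k.
  by rewrite -comp_preimage (_ : g \o _ = id)//; apply/funext => z; exact: gK.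
by rewrite product_measure1E// lte_mul_pinfty// ge0_fin_numE.
Qed.

HB.instance Definition _ := Measure_isSigmaFinite.Build _ _ _ lebesgue_cons
  lebesgue_cons_sigma_finite.

End lebesgue_cons.

(* [n.-tuple R] carries the product sigma-algebra, i.e. the Borel sets of R^n;
   for n = 0 this is the counting measure on a point. *)
Fixpoint lebesgue_tuple {R : realType} (n : nat) :
    {sigma_finite_measure set (n.-tuple R) -> \bar R} :=
  if n is m.+1 then lebesgue_cons (lebesgue_tuple m)
  else \d_([tuple] : 0.-tuple R).

Definition rV_of_tuple {R : realType} n (t : n.-tuple R) : 'rV[R]_n :=
  \row_i tnth t i.

Definition vol {R : realType} n (A : set 'rV[R]_n) : \bar R :=
  lebesgue_tuple n (rV_of_tuple (n := n) @^-1` A).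

Definition vol_integral {R : realType} n (A : set 'rV[R]_n)
    (f : 'rV[R]_n -> R) : \bar R :=
  \int[lebesgue_tuple n]_(t in rV_of_tuple (n := n) @^-1` A)
    (f (rV_of_tuple t))%:E.

Definition convex_body {R : realType} d (K : set 'rV[R]_d) :=
  [/\ compact K, convex_set K & K° !=set0].

(* [isotropic K L]: K is an isotropic convex body and L is its isotropic
   constant. *)
Definition isotropic {R : realType} d (K : set 'rV[R]_d) (L : R) :=
  [/\ convex_body K,
      K = [set - x | x in K],
      vol K = 1%E,
      0 < L &
      forall i j, vol_integral K (fun x => x 0 i * x 0 j) =
                  ((L ^+ 2)%:M i j)%:E].

(* The norm that the library puts on ['rV[R]_d] is the sup norm, hence the
   explicit Euclidean structure. *)
Definition dot {R : realType} d (x y : 'rV[R]_d) : R := \sum_i x 0 i * y 0 i.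

Definition enorm {R : realType} d (x : 'rV[R]_d) : R := Num.sqrt (dot x x).

Definition hyperplane {R : realType} d (H : set 'rV[R]_d) :=
  exists u c, u != 0 /\ H = [set x | dot x u = c].

(* The Euclidean distance from the origin to H, for nonempty H. *)
Definition dist0 {R : realType} d (H : set 'rV[R]_d) : R := inf (@enorm R d @` H).

(* [frame H f]: y |-> f.1 + y *m f.2 is an affine isometry of R^(d-1) onto H
   (the rows of f.2 are an orthonormal basis of the direction of H). *)
Definition frame {R : realType} d (H : set 'rV[R]_d)
    (f : 'rV[R]_d * 'M[R]_(d.-1, d)) :=
  f.2 *m f.2^T = 1%:M /\ range (fun y => f.1 + y *m f.2) = H.

(* (d-1)-dimensional Lebesgue measure on the hyperplane H, transported from
   R^(d-1) by an affine isometry; it does not depend on the chosen isometry,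
   as Lebesgue measure is invariant under isometries. A frame exists for every
   hyperplane; for other sets H the value is irrelevant. *)
Definition hyperplane_vol {R : realType} d (H A : set 'rV[R]_d) : \bar R :=
  let f := xget (0, 0) (frame H) in
  vol [set y : 'rV[R]_d.-1 | A (f.1 + y *m f.2)].

(* Density of the exponential law symmetrized and truncated to [-b, b]. *)
Definition f_Y {R : realType} (b t : R) : R :=
  expR (- `|t|) / (2 * (1 - expR (- b))) * \1_(`[- b, b] : set R) t.

Definition has_density {R : realType} dT (T : measurableType dT)
    (P : probability T R) (X : {RV P >-> R}) (f : R -> R) :=
  forall A : set R, measurable A ->
    distribution P X A = (\int[lebesgue_measure]_(t in A) (f t)%:E)%E.

Definition std_dev {R : realType} dT (T : measurableType dT)
    (P : probability T R) (X : {RV P >-> R}) : R :=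
  Num.sqrt (fine 'V_P[X]).

Arguments has_density {R dT T} P X f.
Arguments std_dev {R dT T} P X.

(* Closed form of the standard deviation of the density [f_Y b], for b > 0. *)
Definition sigma {R : realType} (b : R) : R :=
  Num.sqrt (2 - expR (- b) * b * (b + 2) / (1 - expR (- b))).

(* The infimum is taken in the extended reals, so that no junk value arises
   from unboundedness; for b > 0 the radicand in [sigma b] is positive. *)
Definition c0 {R : realType} : \bar R :=
  ereal_inf [set ((sigma b)^-1 *
                  ln (Num.sqrt 3 * sigma b / (1 - expR (- b))))%:E
            | b in [set b : R | 0 < b]].

(* Main.v *)
(* Let g(t) be the volume of the section of K at signed height t in the direction
   normal to H. By Fubini and the rotation invariance of Lebesgue measure, g is an
   even probability density with second moment L_K^2, and the Prekopa-Leindler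
   inequality makes it log-concave. Put T = t0 L_K and let -s be the slope of a
   supporting line of ln g at T, so that g(t) <= g(T) e^(-s(t-T)) for t >= 0.
   A density that lies above g up to some point and below g beyond it has the
   smaller second moment. If s L_K < sqrt 2, comparing g with the truncated
   exponential density of rate s whose second moment is that of g gives
   L_K g(T) >= sigma_b f_b(t0 sigma_b) for the b with sigma_b = s L_K; s = 0 is
   the uniform case, the limit b -> 0. If s L_K >= sqrt 2, comparing g with a
   plateau followed by exponential decay of rate s gives the bound by the Laplace
   density, the limit b -> oo. At t0 = sqrt 3, where g(T) might vanish, the bound
   follows from t0 < sqrt 3 by the upper semicontinuity of g. Parts (b) and (c)
   reduce to (a) through elementary estimates of sigma_b f_b(t0 sigma_b). *)
Require Import Defs.
From HB Require Import structures.
From mathcomp Require Import all_boot all_order all_algebra.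
From mathcomp Require Import all_classical all_reals all_analysis.
From mathcomp Require Import measurable_realfun ring lra.

Import Order.TTheory GRing.Theory Num.Theory.
Import numFieldNormedType.Exports.

Set Implicit Arguments.
Unset Strict Implicit.
Unset Printing Implicit Defensive.

Local Open Scope classical_set_scope.
Local Open Scope ring_scope.

(** * Translations and dilations of the line *)

Section lebesgue_line.
Context {R : realType}.
Notation lam := (@lebesgue_measure R).

(** The measure on tuples is an iterated product, so its properties are lifted from the line:
    translation invariance one coordinate at a time, orthogonal invariance by averaging over a ball
    instead of through determinants, Prekopa-Leindler by induction on the dimension. The comparison
    takes place on [[0, +oo[] with mass 1/2. If f - phi changes sign from plus to minus at r, then
    (r^2 - t^2) (f - phi) is nonnegative; for equal masses its integral is the difference of the
    second moments. The threshold sqrt 2 is forced: a truncated exponential of rate s has second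
    moment below 2 / s^2, so a steeper supporting line has no truncated competitor. The line then
    bounds a mass of at least 1/2, and flattening the exponential near 0 removes the excess. What
    remains is an inequality in the length of the plateau, whose worst case is t0 = sqrt 3. The
    range of t0 in (a) keeps t0 sigma_b in the support, because sigma_b <= b / sqrt 3. In (b), the
    worst t0 of the reduced inequality is 1 / sqrt 2. In (c), c0 <= sqrt 3 is not assumed and has to
    be derived. *)

Lemma lebesgue_measure_shift (a : R) (A : set R) : measurable A ->
  lam ((fun x => x + a) @^-1` A) = lam A.
Proof.
move=> mA.
have mf : measurable_fun setT ((fun x => x + a) : R -> measurableTypeR R).
  by apply: measurable_funD.
rewrite -[LHS]/(pushforward lam ((fun x => x + a) : R -> measurableTypeR R) A).
apply/esym/lebesgue_measure_unique => //= _ [[c b]] _ <-.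
rewrite /pushforward.
have -> : (fun x => x + a) @^-1` `]c, b] = `]c - a, b - a]%classic.
  by apply/seteqP; split => x /=; rewrite !in_itv/= ltrBlDr lerBrDr.
rewrite !lebesgue_measure_itv/= !lte_fin ltrD2r; case: ifP => // _.
by rewrite -!EFinB; congr (_%:E); lra.
Qed.

Lemma lebesgue_measure_scale (k : R) (A : set R) : 0 < k -> measurable A ->
  lam ((fun x => k * x) @^-1` A) = (k^-1%:E * lam A)%E.
Proof.
move=> k0 mA.
have mf : measurable_fun setT ((fun x => k * x) : R -> measurableTypeR R).
  exact: measurable_funM.
pose nu := mscale (NngNum (ltW k0)) (pushforward lam
  ((fun x => k * x) : R -> measurableTypeR R)).
suff -> : lam A = nu mf A.
  by rewrite /nu /mscale/= muleA -EFinM mulVf ?gt_eqF// mul1e.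
apply: (lebesgue_measure_unique (mu := nu mf)) => //= _ [[c b]] _ <-.
rewrite /nu /mscale/= /pushforward.
have -> : (fun x => k * x) @^-1` `]c, b] = `]k^-1 * c, k^-1 * b]%classic.
  by apply/seteqP; split => x /=; rewrite !in_itv/= ltr_pdivrMl// ler_pdivlMl.
rewrite !lebesgue_measure_itv/= !lte_fin ltr_pM2l ?invr_gt0//.
case: ifP => _; last by rewrite mule0.
by rewrite -!EFinB -EFinM -mulrBr mulrA divff ?mul1r// gt_eqF.
Qed.

Lemma ge0_integral_shift (a : R) (f : R -> \bar R) :
  measurable_fun setT f -> (forall x, (0 <= f x)%E) ->
  (\int[lam]_x f (x + a)%R = \int[lam]_x f x)%E.
Proof.
move=> mf f0.
have mphi : measurable_fun setT ((fun x => x + a) : R -> measurableTypeR R).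
  by apply: measurable_funD.
transitivity (\int[pushforward lam
    ((fun x => x + a)%R : R -> measurableTypeR R)]_x f x)%E.
  by rewrite ge0_integral_pushforward.
by apply: eq_measure_integral => A mA _; exact: lebesgue_measure_shift.
Qed.

End lebesgue_line.

(** * Tuples as row vectors, and integration over tuples by Tonelli *)

Definition tuple_of_rV {R : realType} n (x : 'rV[R]_n) : n.-tuple R :=
  [tuple x 0 i | i < n].

Lemma tuple_of_rVK {R : realType} n :
  cancel (@tuple_of_rV R n) (@rV_of_tuple R n).
Proof. by move=> x; apply/rowP => i; rewrite mxE tnth_mktuple. Qed.

Lemma rV_of_tupleK {R : realType} n :
  cancel (@rV_of_tuple R n) (@tuple_of_rV R n).
Proof.
by move=> x; apply: eq_from_tnth => i; rewrite tnth_mktuple mxE.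
Qed.

Section lebesgue_tuple_theory.
Context {R : realType}.
Notation lam := (@lebesgue_measure R).
Notation mu := (@lebesgue_tuple R).

Lemma ge0_integral_lebesgue_tupleS n (f : n.+1.-tuple R -> \bar R) :
  measurable_fun setT f -> (forall t, (0 <= f t)%E) ->
  (\int[mu n.+1]_t f t =
   \int[lam]_s \int[mu n]_t f (tuple_of_pair (s, t)))%E.
Proof.
move=> mf f0.
have mp := @measurable_tuple_of_pair R n.
rewrite [LHS](_ : _ = \int[(lam \x mu n)%E]_z (f \o (@tuple_of_pair R n)) z)%E.
  rewrite fubini_tonelli1//.
  - exact: (measurableT_comp mf mp).
  - by move=> z /=.
by rewrite -[LHS]/(\int[pushforward (lam \x mu n) (@tuple_of_pair R n)]_t f t)%E
  ge0_integral_pushforward.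
Qed.

Lemma measurable_fun_section n (f : n.+1.-tuple R -> \bar R) :
  measurable_fun setT f -> (forall t, (0 <= f t)%E) ->
  measurable_fun setT (fun s => \int[mu n]_t f (tuple_of_pair (s, t)))%E.
Proof.
move=> mf f0.
have mp := @measurable_tuple_of_pair R n.
apply: (measurable_fun_fubini_tonelli_F (f \o (@tuple_of_pair R n))).
- exact: (measurableT_comp mf mp).
- by move=> z /=.
Qed.

Lemma measurable_tuple_of_pair1 n (s : R) :
  measurable_fun setT (fun t : n.-tuple R => tuple_of_pair (s, t)).
Proof. exact: (@measurable_cons _ _ _ _ (cst s) _ id). Qed.

Lemma lebesgue_tupleS n (A : set (n.+1.-tuple R)) : measurable A ->
  mu n.+1 A = (\int[lam]_s mu n [set t | A (tuple_of_pair (s, t))])%E.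
Proof.
move=> mA.
have -> : mu n.+1 A = (\int[mu n.+1]_t (\1_A t)%:E)%E.
  by rewrite integral_indic// setIT.
rewrite ge0_integral_lebesgue_tupleS//; last exact/measurable_EFinP/measurable_indic.
apply: eq_integral => s _.
rewrite -[X in (_ = mu n X)%E]setIT -integral_indic//.
by rewrite -[X in measurable X]setTI; apply: measurable_tuple_of_pair1.
Qed.

End lebesgue_tuple_theory.

(** * Translation invariance in R^n; boxes and the Euclidean ball *)

Section lebesgue_tuple_invariance.
Context {R : realType}.
Notation lam := (@lebesgue_measure R).
Notation mu := (@lebesgue_tuple R).

Lemma measurable_tuple_of_rV d (T : measurableType d) n (f : T -> 'rV[R]_n) :
  (forall i, measurable_fun setT (fun t => f t 0 i)) ->
  measurable_fun setT (fun t => tuple_of_rV (f t)).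
Proof.
move=> mf; apply/measurable_fun_tnthP => i.
by apply: eq_measurable_fun (mf i) => t _ /=; rewrite tnth_mktuple.
Qed.

Lemma measurable_rV_of_tuple n (i : 'I_n) :
  measurable_fun setT (fun t : n.-tuple R => rV_of_tuple t 0 i).
Proof.
apply: eq_measurable_fun (@measurable_tnth _ _ n i) => t _.
by rewrite mxE.
Qed.

Lemma measurable_tuple_mulmx n m (M : 'M[R]_(n, m)) :
  measurable_fun setT (fun t => tuple_of_rV (rV_of_tuple t *m M)).
Proof.
apply: measurable_tuple_of_rV => i.
under eq_fun do rewrite mxE.
apply: measurable_sum => j; apply: measurable_funM => //.
exact: measurable_rV_of_tuple.
Qed.

Lemma measurable_tuple_shift n (a : 'rV[R]_n) :
  measurable_fun setT (fun t => tuple_of_rV (rV_of_tuple t + a)).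
Proof.
apply: measurable_tuple_of_rV => i; under eq_fun do rewrite mxE.
by apply: measurable_funD => //; exact: measurable_rV_of_tuple.
Qed.

Lemma tnth_tuple_of_pair0 n (z : R * n.-tuple R) :
  tnth (tuple_of_pair z) ord0 = z.1.
Proof. by []. Qed.

Lemma tnth_tuple_of_pairS n (z : R * n.-tuple R) i :
  tnth (tuple_of_pair z) (lift ord0 i) = tnth z.2 i.
Proof. by rewrite /tuple_of_pair tnthS. Qed.

Lemma tuple_of_pair_shift n (a : 'rV[R]_n.+1) s (t : n.-tuple R) :
  tuple_of_rV (rV_of_tuple (tuple_of_pair (s, t)) + a) =
  tuple_of_pair (s + a 0 0,
    tuple_of_rV (rV_of_tuple t + \row_i a 0 (lift ord0 i))).
Proof.
apply: eq_from_tnth => i; case: (unliftP ord0 i) => [j ->|->].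
  by rewrite tnth_tuple_of_pairS/= !tnth_mktuple !mxE tnth_tuple_of_pairS.
by rewrite tnth_tuple_of_pair0/= tnth_mktuple !mxE.
Qed.

Lemma ge0_integral_tuple_shift n (a : 'rV[R]_n) (f : n.-tuple R -> \bar R) :
  measurable_fun setT f -> (forall t, (0 <= f t)%E) ->
  (\int[mu n]_t f (tuple_of_rV (rV_of_tuple t + a)) = \int[mu n]_t f t)%E.
Proof.
elim: n a f => [|n IHn] a f mf f0.
  by apply: eq_integral => t _; congr (f _); rewrite tuple0 [RHS]tuple0.
rewrite !ge0_integral_lebesgue_tupleS//; last first.
  exact: (measurableT_comp mf (measurable_tuple_shift a)).
under eq_integral => s _.
  under eq_integral do rewrite tuple_of_pair_shift.
  rewrite (IHn (\row_i a 0 (lift ord0 i))%R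
    (fun t => f (tuple_of_pair (s + a 0 0, t)%R)))//; last first.
    exact: (measurableT_comp mf (measurable_tuple_of_pair1 _)).
  over.
rewrite (ge0_integral_shift (a 0 0)%R
  (f := fun s => \int[mu n]_t f (tuple_of_pair (s, t)))%E)//.
  exact: measurable_fun_section.
by move=> x; apply: integral_ge0.
Qed.

Definition tuple_box n (r : R) : set (n.-tuple R) :=
  [set t | forall i, `|tnth t i| <= r].

Lemma measurable_tuple_box n r : measurable (@tuple_box n r).
Proof.
rewrite (_ : tuple_box _ = \bigcap_(i in [set: 'I_n])
    ((fun t : n.-tuple R => tnth t i) @^-1` `[- r, r])); last first.
  apply/seteqP; split=> t /= H i.
    by move=> _ /=; rewrite in_itv/= -ler_norml.
  by have := H i I; rewrite /= in_itv/= -ler_norml.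
apply: fin_bigcap_measurable; first exact: finite_finset.
move=> i _; rewrite -[X in measurable X]setTI.
by apply: measurable_tnth.
Qed.

Lemma lebesgue_tuple_box n r : 0 <= r -> mu n (@tuple_box n r) = ((2 * r) ^+ n)%:E.
Proof.
move=> r0; elim: n => [|n IHn].
  rewrite /= diracE mem_set ?expr0// => i; by case: i.
rewrite lebesgue_tupleS; last exact: measurable_tuple_box.
rewrite [LHS](_ : _ = \int[lam]_(s in `[(- r)%R, r]) ((2 * r) ^+ n)%:E)%E.
  rewrite integral_cst//= lebesgue_measure_itv/= lte_fin.
  case: ltP => h; last first.
    have -> : r = 0 by lra.
    by rewrite mulr0 exprS mul0r mule0.
  by rewrite -EFinB -EFinM exprS mulrC; congr (_%:E); lra.
rewrite [RHS]integral_mkcond; apply: eq_integral => s _; rewrite patchE.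
case: ifPn => [/set_mem /=|/negP sr].
  rewrite in_itv/= -ler_norml => sr; rewrite -IHn; congr (mu n _).
  apply/seteqP; split => t /= H i; first by rewrite -(tnth_tuple_of_pairS (s, t)).
  by case: (unliftP ord0 i) => [j ->|->//]; rewrite tnth_tuple_of_pairS.
rewrite (_ : [set t | _] = set0) ?measure0//.
rewrite -subset0 => t /= /(_ ord0); rewrite tnth_tuple_of_pair0/= => H.
by apply: sr; rewrite inE/= in_itv/= -ler_norml.
Qed.

(** The test set for orthogonal invariance: it is preserved by orthogonal maps, and it has positive
    finite measure because it lies between two boxes. *)
Definition tuple_ball n : set (n.-tuple R) :=
  [set t | dot (rV_of_tuple t) (rV_of_tuple t) <= 1].

Lemma measurable_dot d (T : measurableType d) n (f g : T -> 'rV[R]_n) :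
  (forall i, measurable_fun setT (fun t => f t 0 i)) ->
  (forall i, measurable_fun setT (fun t => g t 0 i)) ->
  measurable_fun setT (fun t => dot (f t) (g t)).
Proof.
move=> mf mg; rewrite /dot.
by apply: measurable_sum => j; apply: measurable_funM.
Qed.

Lemma measurable_tuple_ball n : measurable (@tuple_ball n).
Proof.
rewrite (_ : @tuple_ball n = (fun t => dot (rV_of_tuple t) (rV_of_tuple t)) @^-1`
   `]-oo, 1]); last by apply/seteqP; split => t /=; rewrite in_itv.
rewrite -[X in measurable X]setTI; apply: measurable_dot => //;
  exact: measurable_rV_of_tuple.
Qed.

Lemma tuple_ball_sub_box n : @tuple_ball n `<=` tuple_box 1.
Proof.
move=> t /= H i; rewrite -(@expr_le1 _ 2)//= real_normK ?num_real//.
apply: le_trans H; rewrite /dot (bigD1 i)//= !mxE -expr2 lerDl.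
by apply: sumr_ge0 => j _; rewrite -expr2 sqr_ge0.
Qed.

(** Each of the n squares is at most 1 / (n+1), so their sum is below 1; taking n+1 instead of n
    covers n = 0 as well. *)
Lemma box_sub_tuple_ball n : @tuple_box n n.+1%:R^-1 `<=` @tuple_ball n.
Proof.
move=> t /= H; rewrite /tuple_ball/= /dot.
have h0 : 0 < n.+1%:R :> R by [].
apply: (@le_trans _ _ (\sum_(i < n) n.+1%:R^-1)).
  apply: ler_sum => i _; rewrite mxE -expr2 -real_normK ?num_real//.
  rewrite expr2; apply: (@le_trans _ _ (n.+1%:R^-1 * 1)); last by rewrite mulr1.
  apply: ler_pM => //; apply: le_trans (H i) _.
  by rewrite invf_le1// ler1n.
rewrite sumr_const card_ord -[_ *+ n]mulr_natr mulrC ler_pdivrMr// mul1r ler_nat.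
exact: leqnSn.
Qed.

Lemma lebesgue_tuple_ball_fin n : (mu n (@tuple_ball n) < +oo)%E.
Proof.
apply: (@le_lt_trans _ _ (mu n (@tuple_box n 1))).
  apply: le_measure; rewrite ?inE.
  - exact: measurable_tuple_ball.
  - exact: measurable_tuple_box.
  - exact: tuple_ball_sub_box.
by rewrite lebesgue_tuple_box// ltry.
Qed.

Lemma lebesgue_tuple_ball_gt0 n : (0 < mu n (@tuple_ball n))%E.
Proof.
apply: (@lt_le_trans _ _ (mu n (@tuple_box n n.+1%:R^-1))).
  by rewrite lebesgue_tuple_box// lte_fin exprn_gt0// mulr_gt0.
apply: le_measure; rewrite ?inE.
- exact: measurable_tuple_box.
- exact: measurable_tuple_ball.
- exact: box_sub_tuple_ball.
Qed.

End lebesgue_tuple_invariance.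

(** * Invariance under orthogonal matrices *)

Section orthogonal_invariance.
Context {R : realType}.
Notation mu := (@lebesgue_tuple R).

Lemma dotC n (x y : 'rV[R]_n) : dot x y = dot y x.
Proof. by rewrite /dot; apply: eq_bigr => i _; rewrite mulrC. Qed.

Lemma dotE n (x y : 'rV[R]_n) : dot x y = (x *m y^T) 0 0.
Proof. by rewrite mxE; apply: eq_bigr => i _; rewrite mxE. Qed.

Lemma dot_orthogonal n (O : 'M[R]_n) (x y : 'rV[R]_n) : O *m O^T = 1%:M ->
  dot (x *m O) (y *m O) = dot x y.
Proof. by move=> OO; rewrite !dotE trmx_mul mulmxA -(mulmxA x) OO mulmx1. Qed.

Lemma dotNN n (x y : 'rV[R]_n) : dot (- x) (- y) = dot x y.
Proof. by rewrite /dot; apply: eq_bigr => i _; rewrite !mxE mulrNN. Qed.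

Let ball_ind n (t : n.-tuple R) : \bar R := (\1_(@tuple_ball R n) t)%:E.

Let measurable_ball_ind n : measurable_fun setT (@ball_ind n).
Proof.
apply/measurable_EFinP; apply: measurable_indic; exact: measurable_tuple_ball.
Qed.

Let ball_ind_ge0 n (t : n.-tuple R) : (0 <= ball_ind t)%E.
Proof. by rewrite lee_fin. Qed.

Let ball_ind_eq n (t u : n.-tuple R) :
  dot (rV_of_tuple t) (rV_of_tuple t) = dot (rV_of_tuple u) (rV_of_tuple u) ->
  ball_ind t = ball_ind u.
Proof.
move=> tu; rewrite /ball_ind !indicE.
suff -> : (t \in @tuple_ball R n) = (u \in @tuple_ball R n) by [].
by apply/idP/idP; rewrite !inE /tuple_ball/= tu.
Qed.

(* Uniqueness of translation-invariant measures, in the special case needed: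
   compute the double integral of [1_B(x) f(y O + x)] over [(x, y)] in both
   orders, where [B] is the Euclidean unit ball, which is symmetric and
   invariant under [O]. *)
Lemma ge0_integral_tuple_orthogonal n (O : 'M[R]_n) (f : n.-tuple R -> \bar R) :
  O *m O^T = 1%:M -> measurable_fun setT f -> (forall t, (0 <= f t)%E) ->
  (\int[mu n]_t f (tuple_of_rV (rV_of_tuple t *m O)) = \int[mu n]_t f t)%E.
Proof.
move=> OO mf f0.
have OO' : O^T *m O = 1%:M by exact: mulmx1C.
pose T t := tuple_of_rV (rV_of_tuple t *m O) : n.-tuple R.
have mT : measurable_fun setT T by exact: measurable_tuple_mulmx.
pose sh (a : 'rV[R]_n) t := tuple_of_rV (rV_of_tuple t + a).
have msh a : measurable_fun setT (sh a) by exact: measurable_tuple_shift.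
pose mass := (\int[mu n]_t (ball_ind t))%E.
have massE : mass = mu n (@tuple_ball R n).
  by rewrite /mass integral_indic ?setIT//; exact: measurable_tuple_ball.
pose F (z : n.-tuple R * n.-tuple R) :=
  (ball_ind z.1 * f (sh (rV_of_tuple z.1) (T z.2)))%E.
have msum : measurable_fun setT
    (fun z : n.-tuple R * n.-tuple R => sh (rV_of_tuple z.1) (T z.2)).
  apply: measurable_tuple_of_rV => i; under eq_fun do rewrite mxE.
  apply: measurable_funD.
    by apply: (measurableT_comp (measurable_rV_of_tuple i)); exact: measurableT_comp.
  by apply: (measurableT_comp (measurable_rV_of_tuple i)).
have mF : measurable_fun setT F.
  apply: emeasurable_funM.
    exact: (measurableT_comp (@measurable_ball_ind n) measurable_fst).
  exact: (measurableT_comp mf msum).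
have F0 z : (0 <= F z)%E by rewrite mule_ge0.
have lhs : (\int[mu n]_x \int[mu n]_y F (x, y) = mass * \int[mu n]_y f (T y))%E.
  under eq_integral => x _.
    rewrite /F/= ge0_integralZl//; last first.
      exact: (measurableT_comp (measurableT_comp mf (msh _)) mT).
    (* Translating y by x O^T turns y O into y O + x, so the inner integral does not depend on x. *)
    have -> : (\int[mu n]_y f (sh (rV_of_tuple x) (T y)) =
               \int[mu n]_y f (T y))%E.
      rewrite -[RHS](ge0_integral_tuple_shift (rV_of_tuple x *m O^T))//; last first.
        exact: (measurableT_comp mf mT).
      apply: eq_integral => y _; congr (f _).
      by rewrite /sh /T !tuple_of_rVK mulmxDl -mulmxA OO' mulmx1.
    over.
  rewrite ge0_integralZr//.
  - exact: measurable_ball_ind.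
  - by apply: integral_ge0 => y _; exact: f0.
have rhs : (\int[mu n]_y \int[mu n]_x F (x, y) = mass * \int[mu n]_x f x)%E.
  (* [G] is [F] after substituting x - y O for x, which frees the argument of [f] from y. *)
  pose G (z : n.-tuple R * n.-tuple R) :=
    (ball_ind (sh (- rV_of_tuple (T z.1))%R z.2) * f z.2)%E.
  have mTi i : measurable_fun setT (fun t : n.-tuple R => tnth (T t) i).
    exact: (measurableT_comp (@measurable_tnth _ _ n i) mT).
  have msub : measurable_fun setT (fun z : n.-tuple R * n.-tuple R =>
      sh (- rV_of_tuple (T z.1))%R z.2).
    apply: measurable_tuple_of_rV => i; under eq_fun do rewrite !mxE.
    apply: measurable_funB.
      exact: (measurableT_comp (@measurable_tnth _ _ n i) measurable_snd).
    exact: (measurableT_comp (mTi i) measurable_fst).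
  have mG : measurable_fun setT G.
    apply: emeasurable_funM; last exact: (measurableT_comp mf measurable_snd).
    exact: (measurableT_comp (@measurable_ball_ind n) msub).
  have G0 z : (0 <= G z)%E by rewrite mule_ge0.
  under eq_integral => y _.
    have -> : (\int[mu n]_x F (x, y) = \int[mu n]_x G (y, x))%E.
      rewrite -[RHS](ge0_integral_tuple_shift (rV_of_tuple (T y)))//; last first.
        exact: (measurableT_comp mG (measurable_pair1 _)).
      apply: eq_integral => x _; rewrite /F /G/=; congr (ball_ind _ * f _)%E.
        by rewrite /sh tuple_of_rVK addrK rV_of_tupleK.
      by rewrite /sh addrC.
    over.
  rewrite (fubini_tonelli G)//.
  under eq_integral => x _.
    rewrite /G/= ge0_integralZr//; last first.
      exact: (measurableT_comp (@measurable_ball_ind n)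
        (measurableT_comp msub (measurable_pair2 x))).
    (* Since (y - x O^T) O = y O - x, the vectors x - y O and y - x O^T have the same norm, and the
       ball only sees the norm. *)
    have -> : (\int[mu n]_y ball_ind (sh (- rV_of_tuple (T y))%R x) = mass)%E.
      transitivity (\int[mu n]_y ball_ind
          (tuple_of_rV (rV_of_tuple y + - (rV_of_tuple x *m O^T))%R))%E; last first.
        by apply: ge0_integral_tuple_shift; [exact: measurable_ball_ind|exact:
          ball_ind_ge0].
      apply: eq_integral => y _; apply: ball_ind_eq.
      rewrite /sh /T !tuple_of_rVK -[RHS](@dot_orthogonal _ O)// -dotNN.
      by rewrite opprB mulmxBl -mulmxA OO' mulmx1.
    over.
  rewrite ge0_integralZl//.
  by apply: integral_ge0 => y _; exact: ball_ind_ge0.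
have massfin : mass \is a fin_num.
  by rewrite massE ge0_fin_numE// lebesgue_tuple_ball_fin.
have mass0 : (0 < mass)%E by rewrite massE lebesgue_tuple_ball_gt0.
have mass1 : 0 < fine mass by rewrite fine_gt0// mass0 ltey_eq massfin.
have E : (mass * \int[mu n]_y f (T y) = mass * \int[mu n]_x f x)%E.
  by rewrite -lhs -rhs (fubini_tonelli F).
have := congr1 (fun x => (fine mass)^-1%:E * x)%E E.
rewrite !muleA -[X in ((_^-1)%:E * X)%E](fineK massfin) -EFinM mulVf ?gt_eqF//.
by rewrite !mul1e.
Qed.

End orthogonal_invariance.

(** * Brunn-Minkowski on the line, layer cake and weighted means *)

Section brunn_minkowski_line.
Context {R : realType}.
Notation lam := (@lebesgue_measure R).
Implicit Types (A B C : set R) (l r : R).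

(** The set is k A + s, written as a preimage so that measurability is immediate. *)
Lemma lebesgue_measure_homothety (k s : R) A : 0 < k -> measurable A ->
  lam [set z | A (k^-1 * (z - s))] = (k%:E * lam A)%E.
Proof.
move=> k0 mA.
have mkA : measurable ((fun x => k^-1 * x) @^-1` A).
  by rewrite -[X in measurable X]setTI; exact: measurable_funM.
rewrite -[k in RHS]invrK -lebesgue_measure_scale ?invr_gt0//.
exact: (lebesgue_measure_shift (- s) mkA).
Qed.

Lemma measurable_homothety (k s : R) A : measurable A ->
  measurable [set z | A (k^-1 * (z - s))].
Proof.
move=> mA; rewrite -[X in measurable X]setTI.
have : measurable_fun setT (fun z : R => k^-1 * (z - s)).
  by apply: measurable_funM => //; exact: measurable_funB.
by move=> /(_ measurableT A mA).
Qed.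

(** Take a in A close to sup A and b in B close to inf B. Up to small pieces of A above a and of B
    below b, the sets (1-l) A + l b and (1-l) a + l B lie in C on opposite sides of (1-l) a + l b,
    so their lengths add. A measurable C containing the combinations is given because the Minkowski
    sum itself need not be measurable. *)
Lemma brunn_minkowski_line l r A B C : 0 < l < 1 ->
  measurable A -> measurable B -> measurable C -> A !=set0 -> B !=set0 ->
  A `<=` `[- r, r] -> B `<=` `[- r, r] ->
  (forall x y, A x -> B y -> C ((1 - l) * x + l * y)) ->
  ((1 - l)%:E * lam A + l%:E * lam B <= lam C)%E.
Proof.
move=> /andP[l0 l1] mA mB mC A0 B0 Ar Br ABC.
have l1' : 0 < 1 - l by rewrite subr_gt0.
have supA : has_sup A.
  by split => //; exists r => x /Ar; rewrite /= in_itv/= => /andP[].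
have infB : has_inf B.
  by split => //; exists (- r) => x /Br; rewrite /= in_itv/= => /andP[].
apply/lee_addgt0Pr => e e0.
have [a Aa ae] := sup_adherent e0 supA.
have [b Bb be] := inf_adherent e0 infB.
pose A1 := A `&` `]-oo, a[; pose B1 := B `&` `]b, +oo[.
have mA1 : measurable A1 by exact: measurableI.
have mB1 : measurable B1 by exact: measurableI.
have lA : (lam A <= lam A1 + e%:E)%E.
  apply: (@le_trans _ _ (lam (A1 `|` `[a, sup A]))).
    apply: le_measure; rewrite ?inE//; first exact: measurableU.
    move=> x Ax; case: (ltP x a) => xa; [left|right]; first by split.
    by rewrite /= in_itv/= xa/=; exact: ub_le_sup supA.2 _ Ax.
  have U : (lam (A1 `|` `[a, sup A]) <= lam A1 + lam `[a,
    sup A]%classic)%E by exact: measureU2.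
  apply: le_trans U _; apply: leeD => //.
  rewrite lebesgue_measure_itv/= lte_fin; case: ifP => _; last by rewrite lee_fin ltW.
  by rewrite -EFinB lee_fin; lra.
have lB : (lam B <= lam B1 + e%:E)%E.
  apply: (@le_trans _ _ (lam (B1 `|` `[inf B, b]))).
    apply: le_measure; rewrite ?inE//; first exact: measurableU.
    move=> x Bx; case: (ltP b x) => xb; [left|right].
      by split => //=; rewrite in_itv/= xb.
    by rewrite /= in_itv/= xb andbT; exact: ge_inf infB.2 _ Bx.
  have U : (lam (B1 `|` `[inf B, b]) <= lam B1 + lam `[inf B,
    b]%classic)%E by exact: measureU2.
  apply: le_trans U _; apply: leeD => //.
  rewrite lebesgue_measure_itv/= lte_fin; case: ifP => _; last by rewrite lee_fin ltW.
  by rewrite -EFinB lee_fin; lra.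
pose C1 := [set z | A1 ((1 - l)^-1 * (z - l * b))].
pose C2 := [set z | B1 (l^-1 * (z - (1 - l) * a))].
have C12 : C1 `&` C2 = set0.
  rewrite -subset0 => z [[_ /=]] /[swap] -[_ /=].
  rewrite !in_itv/= andbT ltr_pdivrMl// ltr_pdivlMl// => h1 h2.
  by have := ltrD h1 h2; lra.
have C1C : C1 `<=` C.
  move=> z [Az _]; have := ABC _ _ Az Bb; congr C.
  by rewrite mulrA divff ?gt_eqF// mul1r subrK.
have C2C : C2 `<=` C.
  move=> z [Bz _]; have := ABC _ _ Aa Bz; congr C.
  by rewrite mulrA divff ?gt_eqF// mul1r addrC subrK.
have mC1 : measurable C1 by exact: measurable_homothety.
have mC2 : measurable C2 by exact: measurable_homothety.
have : (lam (C1 `|` C2) <= lam C)%E.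
  apply: le_measure; rewrite ?inE//; first exact: measurableU.
  by rewrite subUset.
have -> : (lam (C1 `|` C2) = (1 - l)%:E * lam A1 + l%:E * lam B1)%E.
  rewrite -(lebesgue_measure_homothety (l * b) l1')//.
  rewrite -(lebesgue_measure_homothety ((1 - l) * a) l0)//.
  exact: measureU.
move=> HC.
apply: (@le_trans _ _
  ((1 - l)%:E * (lam A1 + e%:E) + l%:E * (lam B1 + e%:E))%E).
  by apply: leeD; apply: lee_pmul => //; rewrite lee_fin ltW.
rewrite !ge0_muleDr ?lee_fin ?(ltW e0)//.
rewrite addeACA -!EFinM -EFinD.
have -> : (1 - l) * e + l * e = e by lra.
exact: leeD.
Qed.

(** Tonelli for the indicator of the region 0 < c < u x under the graph of [u]. *)
Lemma ge0_layer_cake d (T : measurableType d)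
    (m : {sigma_finite_measure set T -> \bar R}) (u : T -> R) :
  measurable_fun setT u -> (forall x, 0 <= u x) ->
  (\int[m]_x (u x)%:E = \int[lam]_(c in `]0%R, +oo[) m [set x | (c < u x)%R])%E.
Proof.
move=> mu u0.
pose GR := measurableTypeR R.
pose f (z : T * GR) := (\1_[set z : T * GR | 0 < (z.2 : R) < u z.1] z : R)%:E.
have mS : measurable [set z : T * GR | 0 < (z.2 : R) < u z.1].
  rewrite (_ : [set _ | _] = [set z | 0 < (z.2 : R)] `&` [set z | (z.2 : R) < u z.1]);
    last first.
    by apply/seteqP; split => z /= => [/andP[]|[-> ->]].
  apply: measurableI; rewrite -[X in measurable X]setTI.
    have : measurable_fun setT (fun z : T * GR => 0 < (z.2 : R)).
      by apply: measurable_fun_ltr => //; exact: measurable_snd.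
    by move=> /(_ measurableT [set true]); exact.
  have : measurable_fun setT (fun z : T * GR => (z.2 : R) < u z.1).
    apply: measurable_fun_ltr; first exact: measurable_snd.
    exact: (measurableT_comp mu measurable_fst).
  by move=> /(_ measurableT [set true]); exact.
have mf : measurable_fun setT f by exact/measurable_EFinP/measurable_indic.
have f0 z : (0 <= f z)%E by rewrite lee_fin.
transitivity (\int[m]_x \int[lam]_c f (x, c))%E.
  apply: eq_integral => x _.
  transitivity (lam `]0, u x[%classic).
    rewrite lebesgue_measure_itv/= lte_fin; case: ltP => [_|h].
      by rewrite oppr0 adde0.
    by congr (_%:E); apply/eqP; rewrite eq_le h u0.
  rewrite -[X in lam X]setIT -integral_indic//.
rewrite (fubini_tonelli f)// [RHS]integral_mkcond; apply: eq_integral => c _.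
have cE : (c \in `]0, +oo[%classic) = (0 < (c : R)).
  by apply/idP/idP; rewrite inE/= in_itv/= andbT.
rewrite patchE cE; case: ifPn => c0.
  transitivity (\int[m]_x (\1_[set x | (c < u x)%R] x)%:E)%E.
    apply: eq_integral => x _; rewrite /f !indicE.
    suff -> : ((x, c) \in [set z : T * GR | 0 < (z.2 : R) < u z.1]) =
      (x \in [set x | (c < u x)]) by [].
    by apply/idP/idP; rewrite !inE/= c0.
  rewrite integral_indic ?setIT//.
  rewrite -[X in measurable X]setTI.
  have : measurable_fun setT (fun x => (c : R) < u x) by exact: measurable_fun_ltr.
  by move=> /(_ measurableT [set true]); exact.
apply: integral0_eq => x _; rewrite /f indicE memNset//= => /andP[h _].
by rewrite h in c0.
Qed.

(** Young's inequality for the conjugate exponents 1/(1-l) and 1/l. *)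
Lemma weighted_AGM (l x y : R) : 0 < l < 1 -> 0 <= x -> 0 <= y ->
  x `^ (1 - l) * y `^ l <= (1 - l) * x + l * y.
Proof.
move=> /andP[l0 l1] x0 y0.
have l1' : 0 < 1 - l by rewrite subr_gt0.
have := @conjugate_powR R (x `^ (1 - l)) (y `^ l) (1 - l)^-1 l^-1.
rewrite -!powRrM !divff ?gt_eqF// !powRr1// !invrK => H.
rewrite (mulrC _ x) (mulrC _ y); apply: H; rewrite ?powR_ge0 ?invr_gt0//.
by rewrite subrK.
Qed.

End brunn_minkowski_line.

(** * Prekopa-Leindler on the line for functions with supremum 1 *)

Section prekopa_leindler.
Context {R : realType}.
Notation lam := (@lebesgue_measure R).
Notation mu := (@lebesgue_tuple R).

(** With both suprema equal to 1, the superlevel sets of [u] and [v] are nonempty for every level c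
    in ]0, 1[, and their combinations lie in that of [w]. Brunn-Minkowski applies level by level,
    and the layer-cake formula integrates it. The normalisation yields the arithmetic mean of the
    integrals. *)
Lemma prekopa_leindler_normalized (l r : R) (u v w : R -> R) : 0 < l < 1 ->
  measurable_fun setT u -> measurable_fun setT v -> measurable_fun setT w ->
  (forall x, 0 <= u x <= 1) -> (forall x, 0 <= v x <= 1) ->
  (forall x, 0 <= w x) ->
  (forall x, 0 < u x -> - r <= x <= r) -> (forall x, 0 < v x -> - r <= x <= r) ->
  (forall c, c < 1 -> exists x, c < u x) ->
  (forall c, c < 1 -> exists x, c < v x) ->
  (forall x y, u x `^ (1 - l) * v y `^ l <= w ((1 - l) * x + l * y)) ->
  ((1 - l)%:E * (\int[lam]_x (u x)%:E) + l%:E * (\int[lam]_x (v x)%:E)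
   <= \int[lam]_x (w x)%:E)%E.
Proof.
move=> /[dup] l01 /andP[l0 l1] mu mv mw u01 v01 w0 ur vr usup vsup uvw.
have l1' : 0 < 1 - l by rewrite subr_gt0.
have u0 x : 0 <= u x by case/andP: (u01 x).
have v0 x : 0 <= v x by case/andP: (v01 x).
have mlev (f : R -> R) c : measurable_fun setT f -> measurable [set x | c < f x].
  move=> mf; rewrite -[X in measurable X]setTI.
  have : measurable_fun setT (fun x => c < f x) by exact: measurable_fun_ltr.
  by move=> /(_ measurableT [set true]); exact.
have mcake (f : R -> R) : measurable_fun setT f ->
    measurable_fun setT (fun c : R => lam [set x | c < f x]).
  move=> mf.
  have mA : measurable [set z : R * measurableTypeR R | z.1 < f z.2].
    rewrite -[X in measurable X]setTI.
    have : measurable_fun setT (fun z : R * measurableTypeR R => z.1 < f z.2).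
      apply: measurable_fun_ltr => //.
      exact: (measurableT_comp (mf : measurable_fun [set: measurableTypeR R] f)
        measurable_snd).
    by move=> /(_ measurableT [set true]); exact.
  apply: eq_measurable_fun (measurable_fun_xsection lam mA) => c _ /=.
  by congr (lam _); apply/seteqP; split => x; rewrite /xsection/= inE.
have cake01 (f : R -> R) : measurable_fun setT f -> (forall x, 0 <= f x <= 1) ->
    (\int[lam]_x (f x)%:E =
     \int[lam]_(c in `]0%R, 1%R[) lam [set x | (c < f x)%R])%E.
  move=> mf f01; rewrite ge0_layer_cake//; last by move=> x; case/andP: (f01 x).
  rewrite [LHS]integral_mkcond [RHS]integral_mkcond.
  apply: eq_integral => c _; rewrite !patchE.
  have -> : (c \in `]0, +oo[%classic) = (0 < (c : R)).
    by apply/idP/idP; rewrite inE/= in_itv/= andbT.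
  have -> : (c \in `]0, 1[%classic) = (0 < (c : R) < 1).
    by apply/idP/idP; rewrite inE/= in_itv/=.
  case: (ltP c 1) => c1; rewrite ?andbT// andbF; case: ifP => // _.
  rewrite (_ : [set x | _] = set0) ?measure0// -subset0 => x /= cx.
  by have := lt_le_trans cx (andP (f01 x)).2; rewrite ltNge c1.
rewrite (cake01 u)// (cake01 v)// (ge0_layer_cake lam mw w0).
have l0' : (0 <= l%:E)%E by rewrite lee_fin ltW.
have l1'' : (0 <= (1 - l)%:E)%E by rewrite lee_fin ltW.
rewrite -!ge0_integralZl//; last 2 first.
- by apply: measurable_funTS; exact: mcake.
- by apply: measurable_funTS; exact: mcake.
rewrite -ge0_integralD//; last 4 first.
- by move=> c _; rewrite mule_ge0.
- by apply: emeasurable_funM => //; apply: measurable_funTS; exact: mcake.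
- by move=> c _; rewrite mule_ge0.
- by apply: emeasurable_funM => //; apply: measurable_funTS; exact: mcake.
apply: (@le_trans _ _ (\int[lam]_(c in `]0%R, 1%R[) lam [set x | (c < w x)%R])%E).
  apply: ge0_le_integral => //.
  - by move=> c _; rewrite adde_ge0// mule_ge0.
  - by apply: emeasurable_funD; apply: emeasurable_funM => //;
      apply: measurable_funTS; exact: mcake.
  - by apply: measurable_funTS; exact: mcake.
  move=> c /=; rewrite in_itv/= => /andP[c0 c1].
  apply: (brunn_minkowski_line (r := r) l01); try exact: mlev.
  - by have [x ?] := usup _ c1; exists x.
  - by have [x ?] := vsup _ c1; exists x.
  - by move=> x /= cx; rewrite in_itv/=; apply/ur/lt_trans/cx.
  - by move=> x /= cx; rewrite in_itv/=; apply/vr/lt_trans/cx.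
  move=> x y /= cx cy; apply: lt_le_trans (uvw x y).
  (* The level splits as c = c^(1-l) c^l, and both factors increase strictly. *)
  rewrite -[ltLHS](powRr1 (ltW c0)) -[X in c `^ X](subrK l) powRD; last first.
    by rewrite (gt_eqF c0) implybT.
  apply: ltr_pM; rewrite ?powR_ge0//; apply: gt0_ltr_powR; rewrite ?nnegrE ?(ltW c0)//.
apply: ge0_subset_integral => //; first by apply: measurable_funTS; exact: mcake.
by move=> c /=; rewrite !in_itv/= => /andP[->].
Qed.

End prekopa_leindler.

(** * Prekopa-Leindler in every dimension *)

Section prekopa_leindler_tuple.
Context {R : realType}.
Notation lam := (@lebesgue_measure R).
Notation mu := (@lebesgue_tuple R).

Lemma ge0_le_fine_integral d (T : measurableType d)
    (m : {measure set T -> \bar R}) (f : T -> R) (A : set T) (M : R) :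
  measurable A -> (m A < +oo)%E -> measurable_fun setT f ->
  (forall x, 0 <= f x <= M * \1_A x) ->
  (\int[m]_x (f x)%:E <= M%:E * m A)%E.
Proof.
move=> mA Afin mf fM.
have [[x Ax]|A0] := pselect (A !=set0); last first.
  rewrite integral0_eq => [|x _].
    by have -> : A = set0 by [apply/seteqP; split => // x Ax; case: A0; exists x];
      rewrite measure0 mule0.
  have := fM x; rewrite indicE memNset ?mulr0; last by move=> Ax; apply: A0; exists x.
  by rewrite -eq_le => /eqP <-.
have M0 : 0 <= M.
  by have /andP[h1 h2] := fM x; move: (le_trans h1 h2); rewrite indicE mem_set// mulr1.
apply: (@le_trans _ _ (\int[m]_x (M * \1_A x)%:E)%E).
  apply: ge0_le_integral => //.
  - by move=> y _; rewrite lee_fin; case/andP: (fM y).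
  - exact/measurable_EFinP.
  - by apply/measurable_EFinP; apply: measurable_funM.
  - by move=> y _; rewrite lee_fin; case/andP: (fM y).
under eq_integral do rewrite EFinM.
by rewrite ge0_integralZl_EFin// ?integral_indic ?setIT//; exact/measurable_EFinP.
Qed.

(** Dividing [f] and [g] by their suprema a and b, and [h] by a^(1-l) b^l, gives the normalised
    case; the weighted mean inequality passes to the geometric mean. If a supremum is 0, the left
    side vanishes. The bound by a multiple of an indicator keeps the integrals finite, so [fine]
    loses nothing. *)
Lemma prekopa_leindler_line (l r M : R) (f g h : R -> R) : 0 < l < 1 ->
  measurable_fun setT f -> measurable_fun setT g -> measurable_fun setT h ->
  (forall x, 0 <= f x <= M * \1_`[- r, r] x) ->
  (forall x, 0 <= g x <= M * \1_`[- r, r] x) ->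
  (forall x, 0 <= h x <= M * \1_`[- r, r] x) ->
  (forall x y, f x `^ (1 - l) * g y `^ l <= h ((1 - l) * x + l * y)) ->
  fine (\int[lam]_x (f x)%:E) `^ (1 - l) * fine (\int[lam]_x (g x)%:E) `^ l
  <= fine (\int[lam]_x (h x)%:E).
Proof.
move=> /[dup] l01 /andP[l0 l1] mf mg mh fM gM hM fgh.
have l1' : 0 < 1 - l by rewrite subr_gt0.
have pos (k : R -> R) : (forall x, 0 <= k x <= M * \1_`[- r, r] x) ->
  forall x, 0 <= k x by move=> kM x; case/andP: (kM x).
have fin (k : R -> R) : measurable_fun setT k ->
    (forall x, 0 <= k x <= M * \1_`[- r, r] x) ->
    (\int[lam]_x (k x)%:E)%E \is a fin_num.
  move=> mk kM; rewrite ge0_fin_numE; last first.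
    by apply: integral_ge0 => x _; rewrite lee_fin; exact: pos kM _.
  have hr : (lam `[(- r)%R, r] < +oo)%E.
    by rewrite lebesgue_measure_itv/=; case: ifP => _; rewrite ?ltry// -EFinB ltry.
  apply: le_lt_trans (ge0_le_fine_integral _ hr mk kM) _ => //.
  by rewrite ltey_eq fin_numM// ge0_fin_numE.
have := fin _ mh hM; have := fin _ mg gM; have := fin _ mf fM.
have M1 (k : R -> R) : (forall x, 0 <= k x <= M * \1_`[- r, r] x) ->
    has_sup (range k).
  move=> kM; split; first by exists (k 0), 0.
  exists `|M| => _ [x _ <-]; case/andP: (kM x) => _ /le_trans; apply.
  rewrite indicE; case: (_ \in _); rewrite ?mulr1 ?mulr0//; exact: ler_norm.
have [[f0 g0] h0] := (pos _ fM, pos _ gM, pos _ hM).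
have supp (k : R -> R) : (forall x, 0 <= k x <= M * \1_`[- r, r] x) ->
    forall x, 0 < k x -> - r <= x <= r.
  move=> kM x kx0; have := lt_le_trans kx0 (andP (kM x)).2; rewrite indicE.
  by have [/set_mem/=|_] := boolP (x \in `[- r, r]%classic); rewrite ?in_itv//= mulr0 ltxx.
pose a := sup (range f); pose b := sup (range g).
have fa x : f x <= a by apply: ub_le_sup (M1 _ fM).2 _ _; exists x.
have gb x : g x <= b by apply: ub_le_sup (M1 _ gM).2 _ _; exists x.
have a0 : 0 <= a := le_trans (f0 0) (fa 0).
have b0 : 0 <= b := le_trans (g0 0) (gb 0).
have [a00|a_neq0] := eqVneq a 0.
  move=> _ _ _; rewrite [X in fine X `^ _]integral0_eq; last first.
    by move=> x _; congr EFin; apply/eqP; rewrite eq_le f0 -a00 fa.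
  by rewrite powR0 ?gt_eqF// mul0r fine_ge0// integral_ge0// => x _; rewrite lee_fin.
have [b00|b_neq0] := eqVneq b 0.
  move=> _ _ _; rewrite [X in _ * fine X `^ _]integral0_eq; last first.
    by move=> x _; congr EFin; apply/eqP; rewrite eq_le g0 -b00 gb.
  by rewrite powR0 ?gt_eqF// mulr0 fine_ge0// integral_ge0// => x _; rewrite lee_fin.
have {}a0 : 0 < a by rewrite lt_neqAle eq_sym a_neq0.
have {}b0 : 0 < b by rewrite lt_neqAle eq_sym b_neq0.
pose D := a `^ (1 - l) * b `^ l.
have D0 : 0 < D by rewrite mulr_gt0// powR_gt0.
have scale (k : R -> R) (c : R) : measurable_fun setT k -> (forall x, 0 <= k x) -> 0 < c ->
    (\int[lam]_x (k x)%:E = c%:E * \int[lam]_x (c^-1 * k x)%:E)%E.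
  move=> mk k0 c0; under [in RHS]eq_integral do rewrite EFinM.
  rewrite ge0_integralZl_EFin//.
  - by rewrite muleA -EFinM divff ?mul1e// gt_eqF.
  - by move=> x _; rewrite lee_fin.
  - exact/measurable_EFinP.
  - by rewrite invr_ge0 ltW.
rewrite (scale f a)// (scale g b)// (scale h D)//.
set X := (\int[lam]_x _)%E; set Y := (\int[lam]_x _)%E; set Z := (\int[lam]_x _)%E.
have finl (c : R) (W : \bar R) : 0 < c -> (0 <= W)%E ->
    (c%:E * W)%E \is a fin_num -> W \is a fin_num.
  move=> c0; case: W => [w| |]//=; by rewrite gt0_muley// lte_fin.
have i0 (c : R) (k : R -> R) : 0 < c -> (forall x, 0 <= k x) ->
    (0 <= \int[lam]_x (c^-1 * k x)%:E)%E.
  by move=> c0 k0; apply: integral_ge0 => x _; rewrite lee_fin mulr_ge0// invr_ge0 ltW.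
move=> /(finl _ _ a0 (i0 _ _ a0 f0)) Xf /(finl _ _ b0 (i0 _ _ b0 g0)) Yf.
move=> /(finl _ _ D0 (i0 _ _ D0 h0)) Zf.
have XYZ : ((1 - l)%:E * X + l%:E * Y <= Z)%E.
  apply: (prekopa_leindler_normalized (r := r) l01).
  - exact: measurable_funM.
  - exact: measurable_funM.
  - exact: measurable_funM.
  - by move=> x; rewrite mulr_ge0 ?invr_ge0 ?(ltW a0)//= ler_pdivrMl// mulr1.
  - by move=> x; rewrite mulr_ge0 ?invr_ge0 ?(ltW b0)//= ler_pdivrMl// mulr1.
  - by move=> x; rewrite mulr_ge0 ?invr_ge0 ?(ltW D0).
  - move=> x; rewrite pmulr_rgt0 ?invr_gt0// => fx0.
    exact: (supp _ fM).
  - move=> x; rewrite pmulr_rgt0 ?invr_gt0// => gx0.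
    exact: (supp _ gM).
  - move=> c c1; have e0 : 0 < (1 - c) * a by rewrite mulr_gt0// subr_gt0.
    have [_ [x _ <-] hx] := sup_adherent e0 (M1 _ fM).
    by exists x; rewrite ltr_pdivlMl//; apply: le_lt_trans hx; rewrite -/a; lra.
  - move=> c c1; have e0 : 0 < (1 - c) * b by rewrite mulr_gt0// subr_gt0.
    have [_ [x _ <-] hx] := sup_adherent e0 (M1 _ gM).
    by exists x; rewrite ltr_pdivlMl//; apply: le_lt_trans hx; rewrite -/b; lra.
  - move=> x y; rewrite ler_pdivlMl//; apply: le_trans (fgh x y).
    rewrite /D mulrACA -!powRM ?mulr_ge0 ?invr_ge0 ?(ltW a0) ?(ltW b0)//.
    by rewrite !mulrA !divff// !mul1r.
rewrite !fineM//= !powRM ?fine_ge0 ?i0 ?(ltW a0) ?(ltW b0)// mulrACA.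
rewrite ler_pM2l//; apply: le_trans (weighted_AGM l01 _ _) _; rewrite ?fine_ge0 ?i0//.
by rewrite -lee_fin EFinD !EFinM !fineK.
Qed.

Lemma tuple_of_pair_conv n (l s1 s2 : R) (x y : 'rV[R]_n) :
  tuple_of_pair ((1 - l) * s1 + l * s2, tuple_of_rV ((1 - l) *: x + l *: y)) =
  tuple_of_rV ((1 - l) *: rV_of_tuple (tuple_of_pair (s1, tuple_of_rV x)) +
               l *: rV_of_tuple (tuple_of_pair (s2, tuple_of_rV y))).
Proof.
apply: eq_from_tnth => i; rewrite tnth_mktuple !mxE.
case: (unliftP ord0 i) => [j ->|->]; last by rewrite !tnth_tuple_of_pair0.
by rewrite !tnth_tuple_of_pairS/= !tnth_mktuple !mxE.
Qed.

Lemma tuple_box_pair n (r s : R) (t : n.-tuple R) :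
  tuple_box r (tuple_of_pair (s, t)) <-> - r <= s <= r /\ tuple_box r t.
Proof.
rewrite -ler_norml; split=> [H|[H1 H2] i].
  split; first by have := H ord0; rewrite tnth_tuple_of_pair0.
  by move=> i; have := H (lift ord0 i); rewrite tnth_tuple_of_pairS.
by case: (unliftP ord0 i) => [j ->|->//]; rewrite tnth_tuple_of_pairS.
Qed.

(** Induction on n: for fixed first coordinates the induction hypothesis applies to the sections and
    says that the marginals [marg] satisfy the hypothesis of the one-dimensional case. Marginals are
    bounded by M (2r)^n on [-r, r], so the boundedness hypotheses propagate. *)
Lemma prekopa_leindler n (l r M : R) (f g h : n.-tuple R -> R) :
  0 < l < 1 -> 0 <= r ->
  measurable_fun setT f -> measurable_fun setT g -> measurable_fun setT h ->
  (forall t, 0 <= f t <= M * \1_(tuple_box r) t) ->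
  (forall t, 0 <= g t <= M * \1_(tuple_box r) t) ->
  (forall t, 0 <= h t <= M * \1_(tuple_box r) t) ->
  (forall x y, f (tuple_of_rV x) `^ (1 - l) * g (tuple_of_rV y) `^ l
     <= h (tuple_of_rV ((1 - l) *: x + l *: y))) ->
  fine (\int[mu n]_t (f t)%:E) `^ (1 - l) * fine (\int[mu n]_t (g t)%:E) `^ l
  <= fine (\int[mu n]_t (h t)%:E).
Proof.
move=> l01 r0; elim: n M f g h => [|n IHn] M f g h mf mg mh fM gM hM fgh.
  have E (k : 0.-tuple R -> R) : measurable_fun setT k ->
      fine (\int[mu 0]_t (k t)%:E) = k (tuple_of_rV 0).
    move=> mk; rewrite /= integral_dirac//; last exact/measurable_EFinP.
    by rewrite diracT mul1e/= [tuple_of_rV 0]tuple0.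
  rewrite !E//; apply: le_trans (fgh 0 0) _.
  by rewrite [X in h X]tuple0 [tuple_of_rV 0]tuple0.
pose marg (k : n.+1.-tuple R -> R) s :=
  fine (\int[mu n]_t (k (tuple_of_pair (s, t)))%:E).
have pos (k : n.+1.-tuple R -> R) :
    (forall t, 0 <= k t <= M * \1_(tuple_box r) t) -> forall t, 0 <= k t.
  by move=> kM t; case/andP: (kM t).
have boxfin : (mu n (@tuple_box R n r) < +oo)%E by rewrite lebesgue_tuple_box// ltry.
have ksec (k : n.+1.-tuple R -> R) s : measurable_fun setT k ->
    measurable_fun setT (fun t => k (tuple_of_pair (s, t))).
  by move=> mk; exact: (measurableT_comp mk (measurable_tuple_of_pair1 s)).
have ksecM (k : n.+1.-tuple R -> R) :
    (forall t, 0 <= k t <= M * \1_(tuple_box r) t) -> forall s t,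
    0 <= k (tuple_of_pair (s, t)) <= M * \1_`[- r, r] s * \1_(tuple_box r) t.
  move=> kM s t; rewrite (pos _ kM)/=; apply: le_trans (andP (kM _)).2 _.
  rewrite !indicE -mulrA -natrM mulnb.
  suff -> : (tuple_of_pair (s, t) \in tuple_box r) =
    (s \in `[- r, r]%classic) && (t \in tuple_box r) by [].
  apply/idP/idP; first by rewrite inE => /tuple_box_pair[h1 h2]; rewrite !mem_set//= in_itv.
  by move=> /andP[]; rewrite !inE/= in_itv/= => h1 h2; exact/tuple_box_pair.
have ksecE (k : n.+1.-tuple R -> R) s : measurable_fun setT k ->
    (forall t, 0 <= k t <= M * \1_(tuple_box r) t) ->
    (\int[mu n]_t (k (tuple_of_pair (s, t)))%:E = (marg k s)%:E)%E /\
    (0 <= marg k s <= M * (2 * r) ^+ n * \1_`[- r, r] s).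
  move=> mk kM.
  have i0 : (0 <= \int[mu n]_t (k (tuple_of_pair (s, t)))%:E)%E.
    by apply: integral_ge0 => t _; rewrite lee_fin (pos _ kM).
  have : (\int[mu n]_t (k (tuple_of_pair (s, t)))%:E <=
      (M * \1_`[(- r)%R, r] s)%:E * mu n (@tuple_box R n r))%E.
    exact: (ge0_le_fine_integral (@measurable_tuple_box R n r) boxfin (ksec _ s mk)
      (ksecM _ kM s)).
  rewrite lebesgue_tuple_box// -EFinM => H.
  have fin : (\int[mu n]_t (k (tuple_of_pair (s, t)))%:E)%E \is a fin_num.
    by rewrite ge0_fin_numE//; apply: le_lt_trans H _; rewrite ltry.
  rewrite fineK//; split => //; rewrite fine_ge0//=.
  by rewrite -lee_fin fineK// mulrAC.
have kint (k : n.+1.-tuple R -> R) : measurable_fun setT k ->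
    (forall t, 0 <= k t <= M * \1_(tuple_box r) t) ->
    (\int[mu n.+1]_t (k t)%:E = \int[lam]_s (marg k s)%:E)%E.
  move=> mk kM; rewrite ge0_integral_lebesgue_tupleS//.
  - by apply: eq_integral => s _; exact: (ksecE _ _ mk kM).1.
  - exact/measurable_EFinP.
  - by move=> t; rewrite lee_fin (pos _ kM).
have kmeas (k : n.+1.-tuple R -> R) : measurable_fun setT k ->
    (forall t, 0 <= k t <= M * \1_(tuple_box r) t) ->
    measurable_fun setT (marg k).
  move=> mk kM; apply: measurableT_comp => //.
  apply: (measurable_fun_section (f := EFin \o k)); first exact/measurable_EFinP.
  by move=> t; rewrite lee_fin (pos _ kM).
rewrite !kint//.
apply: (prekopa_leindler_line (r := r) (M := M * (2 * r) ^+ n) l01).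
- exact: kmeas.
- exact: kmeas.
- exact: kmeas.
- by move=> s; exact: (ksecE _ _ mf fM).2.
- by move=> s; exact: (ksecE _ _ mg gM).2.
- by move=> s; exact: (ksecE _ _ mh hM).2.
have M0 : 0 <= M.
  have /andP[h1 h2] := fM (tuple_of_rV 0); move: (le_trans h1 h2).
  by rewrite indicE mem_set ?mulr1// => i; rewrite tnth_mktuple mxE normr0.
have secM (k : n.+1.-tuple R -> R) s :
    (forall t, 0 <= k t <= M * \1_(tuple_box r) t) -> forall t,
    0 <= k (tuple_of_pair (s, t)) <= M * \1_(tuple_box r) t.
  move=> kM t; have /andP[-> /le_trans->]// := ksecM _ kM s t.
  by rewrite -mulrA ler_wpM2l// ler_piMl// indicE lern1 leq_b1.
move=> s1 s2; apply: (IHn M).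
- exact: ksec.
- exact: ksec.
- exact: ksec.
- exact: secM.
- exact: secM.
- exact: secM.
by move=> x y; rewrite tuple_of_pair_conv; apply: le_trans (fgh _ _); rewrite !rV_of_tupleK.
Qed.

End prekopa_leindler_tuple.

(** * Compact sets of row vectors: measurability and boundedness *)

Section compact_rV.
Context {R : realType}.
Notation mu := (@lebesgue_tuple R).

Lemma measurable_ball_rV n (x : 'rV[R]_n) (e : R) : 0 < e ->
  measurable (@rV_of_tuple R n @^-1` ball x e).
Proof.
move=> e0.
have -> : @rV_of_tuple R n @^-1` ball x e = \bigcap_(i in [set: 'I_n])
    ((fun t : n.-tuple R => tnth t i) @^-1` ball (x 0 i) e).
  apply/seteqP; split=> t /=.
    by move=> [_ H] i _; have := H 0 i; rewrite mxE.
  by move=> H; split => // i j; rewrite ord1 mxE; exact: H.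
apply: fin_bigcap_measurable; first exact: finite_finset.
move=> i _; rewrite -[X in measurable X]setTI.
by apply: measurable_tnth => //; exact: measurable_ball.
Qed.

(** The sigma-algebra on tuples is the product one, so closedness does not give measurability
    directly. A compact K is the intersection over k of finite unions of balls of radius 1/(k+1)
    centred in K, and sup-norm balls are products of intervals. *)
Lemma measurable_compact_rV n (K : set 'rV[R]_n) : compact K ->
  measurable (@rV_of_tuple R n @^-1` K).
Proof.
move=> cK.
have e0 k : 0 < k.+1%:R^-1 :> R by [].
have cov k : exists D : set 'rV[R]_n, [/\ finite_set D, D `<=` K &
    K `<=` \bigcup_(x in D) ball x k.+1%:R^-1].
  have := cK; rewrite compact_cover => /(_ _ K (fun x => (ball x k.+1%:R^-1)^°)).
  case=> [x _|x Kx|D DK KD].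
  - exact: open_interior.
  - by exists x => //; apply: nbhs_singleton; apply: nbhs_interior; exact: nbhsx_ballx.
  - eexists; split; first exact: (finite_fset D).
    + by move=> x /= /DK; rewrite inE.
    + by move=> x /KD[y yD xy]; exists y => //; exact: interior_subset xy.
pose D k := projT1 (cid (cov k)).
have DP k : [/\ finite_set (D k), D k `<=` K &
    K `<=` \bigcup_(x in D k) ball x k.+1%:R^-1] := projT2 (cid (cov k)).
have -> : @rV_of_tuple R n @^-1` K =
    \bigcap_k \bigcup_(x in D k) (@rV_of_tuple R n @^-1` ball x k.+1%:R^-1).
  apply/seteqP; split=> t /=.
    by move=> Kt k _; have [_ _ /(_ _ Kt)] := DP k.
  move=> H; apply: (compact_closed (@norm_hausdorff _ _) cK).
  move=> B /nbhs_ballP[e /= e1 eB].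
  have [k ke] : exists k, k.+1%:R^-1 < e.
    by have [k _ /(_ k (leqnn k))] := near_infty_natSinv_lt (PosNum e1); exists k.
  have [x Dx xt] := H k I; exists x; split; first by have [_ + _] := DP k; apply.
  by apply: eB; apply: ball_sym; apply: le_ball xt; exact: ltW.
apply: bigcapT_measurable => k; apply: fin_bigcup_measurable.
  by have [] := DP k.
by move=> x _; exact: measurable_ball_rV.
Qed.

Lemma compact_sub_box n (K : set 'rV[R]_n) : compact K ->
  exists2 r, 0 <= r & forall x, K x -> forall i, `|x 0 i| <= r.
Proof.
move=> /compact_bounded[r [_ H]]; exists (`|r| + 1); first by rewrite addr_ge0.
move=> x Kx i; apply: le_trans (H (`|r| + 1) _ x Kx).
  rewrite /Num.norm/= mx_normrE.
  by apply: (le_bigmax _ (fun ij => `|x ij.1 ij.2|) (0, i)).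
by rewrite (le_lt_trans (ler_norm r))// ltrDl.
Qed.

End compact_rV.

Lemma convex_setD {R : realType} n (K : set 'rV[R]_n) x y l : convex_set K ->
  0 <= l <= 1 -> K x -> K y -> K ((1 - l) *: x + l *: y).
Proof.
move=> cK /andP[l0 l1] Kx Ky.
have h0 : 0 <= 1 - l by rewrite subr_ge0.
have h1 : 1 - l <= 1 by rewrite gerBl.
have E : 1 - (1 - l) = l by rewrite opprB addrC subrK.
have := cK x y (Itv01 h0 h1).
by rewrite !inE => /(_ Kx Ky); rewrite /conv/= /unstable.onem/= E.
Qed.

(** * The volume of the parallel sections of a body *)

Section section_volume.
Context {R : realType} (n : nat).
Notation lam := (@lebesgue_measure R).
Notation mu := (@lebesgue_tuple R).
Variables (K : set 'rV[R]_n.+1) (theta : 'rV[R]_n.+1) (M : 'M[R]_(n, n.+1)).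
Hypothesis cK : compact K.
Hypothesis OO : col_mx theta M *m (col_mx theta M)^T = 1%:M.

Let O : 'M[R]_(n.+1, n.+1) := col_mx theta M.

Let OO' : O *m O^T = 1%:M. Proof. exact: OO. Qed.

(** The section at height t along [theta], in the orthonormal coordinates given by the rows of
    [M]. *)
Definition section_set (t : R) : set (n.-tuple R) :=
  [set y | K (t *: theta + rV_of_tuple y *m M)].

Definition section_vol (t : R) : R := fine (mu n (section_set t)).

Lemma rV_of_tuple_pair_mul (s : R) (y : n.-tuple R) :
  rV_of_tuple (tuple_of_pair (s, y)) *m O = s *: theta + rV_of_tuple y *m M.
Proof.
have -> : rV_of_tuple (tuple_of_pair (s, y)) =
    row_mx s%:M (rV_of_tuple y) :> 'rV[R]_(1 + n).
  apply/rowP => i; rewrite mxE; case: (unliftP ord0 i) => [j ->|->].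
    rewrite tnth_tuple_of_pairS/=.
    have -> : lift ord0 j = rshift 1 j by exact/val_inj.
    by rewrite row_mxEr mxE.
  rewrite tnth_tuple_of_pair0/=.
  have -> : ord0 = lshift n (ord0 : 'I_1) by exact/val_inj.
  by rewrite row_mxEl mxE eqxx mulr1n.
rewrite -mul_scalar_mx; exact: (@mul_row_col _ 1 1 n n.+1 s%:M (rV_of_tuple y) theta M).
Qed.

Let ind (z : n.+1.-tuple R) : R := \1_[set z | K (rV_of_tuple z *m O)] z.

Let measurable_KO : measurable [set z : n.+1.-tuple R | K (rV_of_tuple z *m O)].
Proof.
have -> : [set z : n.+1.-tuple R | K (rV_of_tuple z *m O)] =
    (fun z => tuple_of_rV (rV_of_tuple z *m O)) @^-1` (@rV_of_tuple R n.+1 @^-1` K).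
  by apply/seteqP; split => z /=; rewrite tuple_of_rVK.
rewrite -[X in measurable X]setTI; apply: measurable_tuple_mulmx => //.
exact: measurable_compact_rV.
Qed.

Lemma section_setE t y :
  section_set t y <-> K (rV_of_tuple (tuple_of_pair (t, y)) *m O).
Proof. by rewrite rV_of_tuple_pair_mul. Qed.

Lemma measurable_section_set t : measurable (section_set t).
Proof.
rewrite (_ : section_set t = (fun y : n.-tuple R => tuple_of_pair (t, y)) @^-1`
    [set z : n.+1.-tuple R | K (rV_of_tuple z *m O)]).
  by rewrite -[X in measurable X]setTI; apply: measurable_tuple_of_pair1 => //;
    exact: measurable_KO.
by apply/seteqP; split => y /section_setE.
Qed.

(** Orthogonal coordinates preserve the Euclidean norm. If all original coordinates are at most r,
    the squared norm is at most (n+1) r^2; the cruder ((n+1) r)^2 avoids a square root. One box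
    serves all heights. *)
Lemma exists_section_box : exists2 r : R, 0 <= r & forall t y, section_set t y ->
  - r <= t <= r /\ tuple_box r y.
Proof.
have [r r0 Kr] := compact_sub_box cK.
exists (n.+1%:R * r) => [|t y]; first exact: mulr_ge0.
move=> /section_setE H; apply/tuple_box_pair.
set z := tuple_of_pair (t, y) in H *.
have zz : dot (rV_of_tuple z) (rV_of_tuple z) <= (n.+1%:R * r) ^+ 2.
  rewrite -(dot_orthogonal _ _ OO') /dot.
  apply: (@le_trans _ _ (\sum_(i < n.+1) r ^+ 2)).
    apply: ler_sum => i _; rewrite -expr2 -real_normK ?num_real// ler_sqr ?nnegrE//.
    exact: Kr.
  rewrite sumr_const card_ord exprMn -[_ *+ _]mulr_natl ler_wpM2r ?sqr_ge0//.
  by rewrite -natrX ler_nat leq_pmulr.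
move=> i; rewrite -[leRHS]ger0_norm ?mulr_ge0// -ler_sqr ?nnegrE//.
rewrite !real_normK ?num_real//; apply: le_trans zz.
rewrite /dot (bigD1 i)//= mxE -expr2 lerDl.
by apply: sumr_ge0 => j _; rewrite -expr2 sqr_ge0.
Qed.

Lemma section_volE t : mu n (section_set t) = (section_vol t)%:E.
Proof.
have [r r0 rP] := exists_section_box.
rewrite /section_vol fineK// ge0_fin_numE//.
apply: (@le_lt_trans _ _ (mu n (@tuple_box R n r))).
  apply: le_measure; rewrite ?inE.
  - exact: measurable_section_set.
  - exact: measurable_tuple_box.
  - by move=> y /rP[].
by rewrite lebesgue_tuple_box// ltry.
Qed.

Lemma section_vol_ge0 t : 0 <= section_vol t.
Proof. by rewrite fine_ge0. Qed.

Lemma measurable_section_vol : measurable_fun setT section_vol.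
Proof.
have mind : measurable_fun setT (fun z => (ind z)%:E).
  by apply/measurable_EFinP; exact: measurable_indic.
apply: measurableT_comp => //.
apply: eq_measurable_fun (measurable_fun_section mind _) => [t _|z];
  last by rewrite lee_fin.
rewrite -[section_set t]setIT -integral_indic//; last exact: measurable_section_set.
apply: eq_integral => y _; rewrite /ind !indicE.
suff -> : (tuple_of_pair (t, y) \in [set z : n.+1.-tuple R | K (rV_of_tuple z *m O)]) =
  (y \in section_set t) by [].
by apply/idP/idP; rewrite !inE => /section_setE.
Qed.

Lemma dot_mul_theta (x : 'rV[R]_n.+1) : dot (x *m O) theta = x 0 0.
Proof.
have -> : theta = delta_mx 0 0 *m O.
  by rewrite -rowE; apply/rowP => j; rewrite !mxE; case: splitP => //= k _; rewrite ord1.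
rewrite dot_orthogonal// /dot (bigD1 0)//= big1 ?mxE ?eqxx ?mulr1 ?addr0// => i i0.
by rewrite mxE (negbTE i0) andbF mulr0.
Qed.

(** Rotating by [O] turns the scalar product with [theta] into the first coordinate, which Tonelli
    separates. The choices phi = 1 and phi = t^2 give the mass and the second moment of the section
    function. *)
Lemma integral_section_vol (phi : R -> R) : measurable_fun setT phi ->
  (forall t, 0 <= phi t) ->
  (\int[mu n.+1]_(z in @rV_of_tuple R n.+1 @^-1` K) (phi (dot (rV_of_tuple z) theta))%:E =
   \int[lam]_t (phi t * section_vol t)%:E)%E.
Proof.
move=> mphi phi0.
have mK := measurable_compact_rV cK.
pose F (z : n.+1.-tuple R) : \bar R :=
  (phi (dot (rV_of_tuple z) theta) * \1_(@rV_of_tuple R n.+1 @^-1` K) z)%:E.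
have mF : measurable_fun setT F.
  apply/measurable_EFinP; apply: measurable_funM; last exact: measurable_indic.
  apply: measurableT_comp => //; apply: measurable_dot => i.
    exact: measurable_rV_of_tuple.
  exact: measurable_cst.
have F0 z : (0 <= F z)%E by rewrite lee_fin mulr_ge0.
transitivity (\int[mu n.+1]_z F z)%E.
  rewrite integral_mkcond; apply: eq_integral => z _; rewrite patchE /F indicE.
  by case: ifPn => _; rewrite ?mulr1 ?mulr0.
rewrite -(ge0_integral_tuple_orthogonal OO')// ge0_integral_lebesgue_tupleS//; last first.
  exact: (measurableT_comp mF (measurable_tuple_mulmx _)).
apply: eq_integral => t _.
transitivity (\int[mu n]_y ((phi t)%:E * (\1_(section_set t) y)%:E))%E.
  apply: eq_integral => y _; rewrite /F tuple_of_rVK dot_mul_theta mxE.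
  rewrite tnth_tuple_of_pair0/= -EFinM; congr (_ * _)%:E; rewrite !indicE.
  suff -> : (tuple_of_rV (rV_of_tuple (tuple_of_pair (t, y)) *m O) \in
     @rV_of_tuple R n.+1 @^-1` K) = (y \in section_set t) by [].
  by apply/idP/idP; rewrite !inE/= tuple_of_rVK => /section_setE.
rewrite ge0_integralZl_EFin//.
- rewrite integral_indic//; last exact: measurable_section_set.
  by rewrite setIT EFinM -section_volE.
- by apply/measurable_EFinP; apply: measurable_indic; exact: measurable_section_set.
Qed.

Lemma lebesgue_tuple_orthogonal m (Q : 'M[R]_m) (A : set (m.-tuple R)) :
  Q *m Q^T = 1%:M -> measurable A ->
  mu m [set t | A (tuple_of_rV (rV_of_tuple t *m Q))] = mu m A.
Proof.
move=> QQ mA.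
have mI : measurable_fun setT (fun t => (\1_A t : R)%:E).
  by apply/measurable_EFinP; exact: measurable_indic.
have mB : measurable [set t | A (tuple_of_rV (rV_of_tuple t *m Q))].
  rewrite -[X in measurable X]setTI.
  exact: (measurable_tuple_mulmx Q measurableT mA).
transitivity (\int[mu m]_t (\1_A t)%:E)%E; last by rewrite integral_indic// setIT.
rewrite -(ge0_integral_tuple_orthogonal QQ mI)//.
have := integral_indic (mu m) measurableT mB.
by rewrite setIT => <-.
Qed.

Lemma lebesgue_tuple_shift m (a : 'rV[R]_m) (A : set (m.-tuple R)) :
  measurable A -> mu m [set t | A (tuple_of_rV (rV_of_tuple t + a))] = mu m A.
Proof.
move=> mA.
have mI : measurable_fun setT (fun t => (\1_A t : R)%:E).
  by apply/measurable_EFinP; exact: measurable_indic.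
have mB : measurable [set t | A (tuple_of_rV (rV_of_tuple t + a))].
  rewrite -[X in measurable X]setTI.
  exact: (measurable_tuple_shift a measurableT mA).
transitivity (\int[mu m]_t (\1_A t)%:E)%E; last by rewrite integral_indic// setIT.
rewrite -(ge0_integral_tuple_shift a mI)//.
have := integral_indic (mu m) measurableT mB.
by rewrite setIT => <-.
Qed.

(** Symmetry of K reflects the section at height t onto the one at height -t, and y |-> -y is
    orthogonal. *)
Lemma section_volN t : K = [set - x | x in K] ->
  section_vol (- t) = section_vol t.
Proof.
move=> KN.
have KNE x : K (- x) -> K x.
  by rewrite {1}KN => -[y Ky /oppr_inj <-].
have NN : (- 1%:M : 'M[R]_n) *m (- 1%:M)^T = 1%:M.
  by rewrite linearN/= trmx1 mulmxN mulNmx mulmx1 opprK.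
rewrite /section_vol -(lebesgue_tuple_orthogonal NN); last exact: measurable_section_set.
congr (fine (mu n _)); apply/seteqP; split => y; rewrite /section_set/= tuple_of_rVK.
  move=> H; apply: KNE; move: H; congr K.
  by rewrite opprD scaleNr mulmxN mulNmx ?opprK mulmx1 ?opprK.
move=> H; apply: KNE; move: H; congr K.
by rewrite opprD scaleNr mulmxN mulNmx ?opprK mulmx1 ?opprK.
Qed.

(** Prekopa-Leindler for the indicators of three sections: convexity of K is the pointwise
    hypothesis, and a point outside its section contributes 0 to a positive power, that is 0. *)
Lemma section_vol_log_concave l s t : convex_set K -> 0 < l < 1 ->
  section_vol s `^ (1 - l) * section_vol t `^ l <=
  section_vol ((1 - l) * s + l * t).
Proof.
move=> cvK l01.
have [r r0 rP] := exists_section_box.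
have E u : section_vol u = fine (\int[mu n]_y (\1_(section_set u) y)%:E).
  by rewrite integral_indic ?setIT//; exact: measurable_section_set.
have sub_ind u y : 0 <= (\1_(section_set u) y : R) <= \1_(tuple_box r) y.
  apply/andP; split => //; rewrite !indicE.
  case: (boolP (y \in section_set u)) => [/set_mem/rP[_ h]|_]; last by rewrite ler0n.
  by rewrite mem_set.
rewrite !E; apply: (@prekopa_leindler _ n l r 1) => //.
- by apply: measurable_indic; exact: measurable_section_set.
- by apply: measurable_indic; exact: measurable_section_set.
- by apply: measurable_indic; exact: measurable_section_set.
- by move=> y; rewrite mul1r; exact: sub_ind.
- by move=> y; rewrite mul1r; exact: sub_ind.
- by move=> y; rewrite mul1r; exact: sub_ind.
move=> x y.
have [/andP[l0 l1]] := l01; have l1' : 0 < 1 - l by rewrite subr_gt0.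
rewrite !indicE; case: (boolP (tuple_of_rV x \in _)) => [/set_mem hx|_]; last first.
  by rewrite powR0 ?gt_eqF// mul0r.
case: (boolP (tuple_of_rV y \in _)) => [/set_mem hy|_]; last first.
  by rewrite [X in _ * X]powR0 ?gt_eqF// mulr0.
rewrite !powR1 mulr1 mem_set//.
move: hx hy; rewrite /section_set/= !tuple_of_rVK => hx hy.
have l01' : 0 <= l <= 1 by rewrite !ltW.
have := convex_setD cvK l01' hx hy; congr K.
by rewrite !scalerDr !scalerA addrACA -scalerDl mulmxDl -!scalemxAl.
Qed.

(** A point that lies in infinitely many of the sections at heights t k lies in the section at T,
    since K is closed. The tails [W N] have measure at least c and lie in one box, so continuity
    from above gives their intersection measure at least c. *)
Lemma section_vol_usc (T c : R) (t : R^nat) : t @ \oo --> T ->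
  (forall k, c <= section_vol (t k)) -> c <= section_vol T.
Proof.
move=> tT ct.
have [r r0 rP] := exists_section_box.
pose W N := \bigcup_(k in [set k | (N <= k)%N]) section_set (t k).
have mW N : measurable (W N).
  by apply: bigcup_measurable => k _; exact: measurable_section_set.
have mIW : measurable (\bigcap_N W N) by exact: bigcapT_measurable.
have Wbox N : W N `<=` tuple_box r by move=> y [k _ /rP[]].
have W0 : (mu n (W 0%N) < +oo)%E.
  apply: (@le_lt_trans _ _ (mu n (@tuple_box R n r))).
    by apply: le_measure; rewrite ?inE//; exact: measurable_tuple_box.
  by rewrite lebesgue_tuple_box// ltry.
have ndW : {homo W : N m / (N <= m)%N >-> (m <= N)%O}.
  move=> N m Nm; apply/subsetPset => y [k /= mk yk]; exists k => //=.
  exact: leq_trans mk.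
have cvgW := nonincreasing_cvg_mu W0 mW mIW ndW.
have cW : (c%:E <= mu n (\bigcap_N W N))%E.
  apply: (cvge_to_ge cvgW); apply: nearW => N /=.
  apply: (@le_trans _ _ (mu n (section_set (t N)))).
    by rewrite section_volE lee_fin.
  apply: le_measure; rewrite ?inE//; first exact: measurable_section_set.
  by move=> y yN; exists N => /=.
rewrite -lee_fin -section_volE; apply: le_trans cW _.
apply: le_measure; rewrite ?inE//; first exact: measurable_section_set.
move=> y yW; rewrite /section_set/=.
apply: (compact_closed (@norm_hausdorff _ _) cK) => B TB.
have /(_ B TB)[N _ NB] : (fun k => t k *: theta + rV_of_tuple y *m M) @ \oo -->
    T *: theta + rV_of_tuple y *m M.
  by apply: cvgD; [exact: cvgZr_tmp|exact: cvg_cst].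
by have [k Nk yk] := yW N I; exists (t k *: theta + rV_of_tuple y *m M); split => //;
  exact: NB.
Qed.

End section_volume.

(** * Algebra of the scalar product *)

Section dot_theory.
Context {R : realType} (n : nat).
Implicit Types x y z : 'rV[R]_n.

Lemma dotDl x y z : dot (x + y) z = dot x z + dot y z :> R.
Proof. by rewrite !dotE mulmxDl mxE. Qed.

Lemma dotZl a x y : dot (a *: x) y = a * dot x y :> R.
Proof. by rewrite !dotE -scalemxAl mxE. Qed.

Lemma dotZr a x y : dot x (a *: y) = a * dot x y :> R.
Proof. by rewrite dotC dotZl dotC. Qed.

Lemma dotDr x y z : dot x (y + z) = dot x y + dot x z :> R.
Proof. by rewrite dotC dotDl !(dotC x). Qed.

Lemma dotNl x y : dot (- x) y = - dot x y :> R.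
Proof. by rewrite -scaleN1r dotZl mulN1r. Qed.

Lemma dotNr x y : dot x (- y) = - dot x y :> R.
Proof. by rewrite dotC dotNl dotC. Qed.

Lemma dot_ge0 x : 0 <= dot x x.
Proof. by apply: sumr_ge0 => i _; rewrite -expr2 sqr_ge0. Qed.

Lemma dot_eq0 x : (dot x x == 0) = (x == 0).
Proof.
apply/eqP/eqP => [/eqP|->]; last by rewrite /dot big1// => i _; rewrite mxE mul0r.
rewrite /dot psumr_eq0; last by move=> i _; rewrite -expr2 sqr_ge0.
move=> /allP x0; apply/rowP => i; rewrite mxE; apply/eqP.
by have := x0 i (mem_index_enum _); rewrite /= -expr2 sqrf_eq0.
Qed.

Lemma mul_trmx11 x y : x *m y^T = (dot x y)%:M.
Proof. by rewrite [LHS]mx11_scalar dotE. Qed.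

End dot_theory.

(** * Orthonormal frames *)

Section frames.
Context {R : realType} (n : nat).
Implicit Types (x u theta : 'rV[R]_n.+1) (M : 'M[R]_(n, n.+1)).

Lemma orthogonal_col_mx theta M :
  col_mx theta M *m (col_mx theta M)^T = 1%:M <->
  [/\ dot theta theta = 1, M *m theta^T = 0 & M *m M^T = 1%:M].
Proof.
have -> : (1%:M : 'M[R]_(1 + n)) = block_mx 1%:M 0 0 1%:M by exact: scalar_mx_block.
rewrite tr_col_mx mul_col_row mul_trmx11; split.
  by move=> /eq_block_mx[/matrixP/(_ 0 0) + _ -> ->]; rewrite !mxE eqxx !mulr1n => ->.
move=> [-> Mt ->]; rewrite Mt; congr block_mx.
by rewrite -[_ *m _]trmxK trmx_mul trmxK Mt trmx0.
Qed.

Lemma orthogonal_decomp theta M x :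
  col_mx theta M *m (col_mx theta M)^T = 1%:M ->
  x = dot x theta *: theta + (x *m M^T) *m M.
Proof.
move=> /mulmx1C.
rewrite tr_col_mx mul_row_col => E.
rewrite -[LHS]mulmx1 -E mulmxDr !mulmxA; congr (_ + _).
by rewrite mul_trmx11 mul_scalar_mx.
Qed.

(* Householder: the reflection exchanging [theta] with the first basis vector. *)
Lemma exists_orthonormal_completion theta : dot theta theta = 1 ->
  exists M : 'M[R]_(n, n.+1), col_mx theta M *m (col_mx theta M)^T = 1%:M.
Proof.
move=> tt; pose e : 'rV[R]_n.+1 := delta_mx 0 0.
pose w := e - theta; pose a := 2 / dot w w.
pose W := w^T *m w; pose Q : 'M[R]_n.+1 := 1%:M - a *: W.
have WT : W^T = W by rewrite trmx_mul trmxK.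
have WW : W *m W = dot w w *: W.
  by rewrite /W mulmxA -(mulmxA w^T) mul_trmx11 mul_mx_scalar -scalemxAl.
have QT : Q^T = Q by rewrite /Q linearB/= linearZ/= WT trmx1.
(* If [theta] is already the first basis vector, then w = 0 and a = 2 / 0 = 0: [Q] is the identity
   and the formula still holds. *)
have aw : a ^+ 2 * dot w w = 2 * a.
  have [w0|w0] := eqVneq (dot w w) 0; first by rewrite /a w0 invr0; ring.
  by rewrite /a; field.
have QQ : Q *m Q^T = 1%:M.
  rewrite QT /Q mulmxBl mul1mx mulmxBr mulmx1 -scalemxAl -scalemxAr scalerA WW.
  rewrite scalerA -expr2 aw mulr_natl mulr2n scalerDl.
  by rewrite opprB addrK subrK.
have eQ : e *m Q = theta.
  have et : dot e theta = theta 0 0.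
    rewrite /dot (bigD1 0)//= big1 ?mxE ?eqxx ?mul1r ?addr0// => i i0.
    by rewrite mxE (negbTE i0) andbF mul0r.
  have ee : dot e e = 1.
    rewrite /dot (bigD1 0)//= big1 ?mxE ?eqxx ?mul1r ?addr0// => i i0.
    by rewrite mxE (negbTE i0) andbF mul0r.
  have ww : dot w w = 2 * (1 - dot e theta).
    by rewrite /w dotDl !dotDr !dotNl !dotNr ee tt (dotC theta); ring.
  have ew : dot e w = 1 - dot e theta.
    by rewrite /w dotDr dotNr ee.
  rewrite /Q mulmxBr mulmx1 -scalemxAr mulmxA mul_trmx11 mul_scalar_mx scalerA ew.
  have [w0|w0] := eqVneq (dot w w) 0.
    have : w == 0 by rewrite -dot_eq0 w0.
    by rewrite subr_eq0 => /eqP et'; rewrite /w et' subrr scaler0 subr0.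
  suff -> : a * (1 - dot e theta) = 1 by rewrite scale1r /w opprB addrC subrK.
  by rewrite /a ww; field; move: w0; rewrite ww mulf_eq0 negb_or => /andP[].
exists (@dsubmx R 1 n n.+1 Q).
suff -> : theta = @usubmx R 1 n n.+1 Q by rewrite vsubmxK.
rewrite -eQ -rowE; apply/rowP => j; rewrite !mxE.
by have -> : lshift n (0 : 'I_1) = 0 by exact/val_inj.
Qed.

End frames.

(** * From an isotropic body to an even log-concave density *)

Section hyperplane_sections.
Context {R : realType}.
Notation lam := (@lebesgue_measure R).
Notation mu := (@lebesgue_tuple R).

(** Log-concavity is stated with powers instead of [ln], since a section volume may be 0. *)
Definition even_log_concave (g : R -> R) := [/\ measurable_fun setT g,
  forall t, 0 <= g t, forall t, g (- t) = g t &
  forall l s t, 0 < l < 1 -> g s `^ (1 - l) * g t `^ l <= g ((1 - l) * s + l * t)].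

(** Expanding the square leaves L^2 times the squared norm of [theta]. The coordinate products have
    varying sign; they are integrable because K is bounded, which allows the sum to leave the
    integral. *)
Lemma isotropic_second_moment n (K : set 'rV[R]_n) (L : R) (theta : 'rV[R]_n) :
  isotropic K L -> dot theta theta = 1 ->
  (\int[mu n]_(z in @rV_of_tuple R n @^-1` K) (dot (rV_of_tuple z) theta ^+ 2)%:E =
   (L ^+ 2)%:E)%E.
Proof.
move=> [[cK cvK _] _ K1 L0 KL] tt.
have mK := measurable_compact_rV cK.
have [r r0 Kr] := compact_sub_box cK.
pose x (i : 'I_n) (z : n.-tuple R) := rV_of_tuple z 0 i.
have intx i j : (mu n).-integrable (@rV_of_tuple R n @^-1` K)
    (EFin \o (fun z => x i z * x j z)).
  apply: measurable_bounded_integrable => //.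
  - by rewrite -[X in (X < _)%E]/(vol K) K1 ltry.
  - apply: measurable_funTS; apply: measurable_funM; exact: measurable_rV_of_tuple.
  exists (r ^+ 2); split; first exact: num_real.
  move=> y ry z /= Kz; apply/ltW/le_lt_trans/ry; rewrite normrM expr2.
  by apply: ler_pM => //; exact: Kr.
transitivity (\int[mu n]_(z in @rV_of_tuple R n @^-1` K)
   \sum_(p : 'I_n * 'I_n) ((theta 0 p.1 * theta 0 p.2)%:E * (x p.1 z * x p.2 z)%:E))%E.
  apply: eq_integral => z _; rewrite expr2 /dot big_distrlr/= pair_bigA/= -sumEFin.
  by apply: eq_bigr => p _; rewrite -EFinM; congr (_%:E); rewrite /x; ring.
rewrite integral_sum//; last first.
  by move=> p; apply: integrableZl => //; exact: (intx p.1 p.2).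
transitivity (\sum_(p : 'I_n * 'I_n) (theta 0 p.1 * theta 0 p.2 * (L ^+ 2)%:M p.1
  p.2)%:E)%E.
  apply: eq_bigr => p _; rewrite integralZl//; last exact: intx.
  by rewrite [RHS]EFinM -KL.
rewrite sumEFin; congr (_%:E).
rewrite -(pair_bigA _ (fun i j => theta 0 i * theta 0 j * (L ^+ 2)%:M i j))/=.
rewrite -[RHS]mul1r -tt /dot mulr_suml; apply: eq_bigr => i _.
rewrite (bigD1 i)//= big1 ?addr0 => [|j ji]; first by rewrite mxE eqxx mulr1n.
by rewrite mxE eq_sym (negbTE ji) mulr0n mulr0.
Qed.

(** The nearest point is a theta: for x in the hyperplane, 0 <= |x - a theta|^2 = |x|^2 - a^2. *)
Lemma dist0_hyperplane n (theta : 'rV[R]_n) (a : R) : dot theta theta = 1 ->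
  dist0 [set x | dot x theta = a] = `|a|.
Proof.
move=> tt; rewrite /dist0.
have E : enorm (a *: theta) = `|a|.
  by rewrite /enorm dotZl dotZr tt mulr1 -expr2 sqrtr_sqr.
have lb : lbound (@enorm R n @` [set x | dot x theta = a]) `|a|.
  move=> _ [x /= xa <-]; rewrite -sqrtr_sqr /enorm ler_wsqrtr//.
  have := dot_ge0 (x - a *: theta).
  rewrite dotDl !dotDr !dotNl !dotNr !dotZl !dotZr (dotC theta) tt xa.
  lra.
apply/eqP; rewrite eq_le; apply/andP; split; last first.
  by apply: lb_le_inf => //; exists (enorm (a *: theta)), (a *: theta) => //=;
    rewrite dotZl tt mulr1.
apply: ge_inf; first by exists `|a|.
by exists (a *: theta) => //=; rewrite dotZl tt mulr1.
Qed.

Lemma hyperplane_section d (K : set 'rV[R]_d) (L tau : R) (H : set 'rV[R]_d) :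
  isotropic K L -> hyperplane H -> dist0 H = tau ->
  exists g : R -> R, [/\ even_log_concave g,
    (\int[lam]_t (g t)%:E = 1)%E,
    (\int[lam]_t (t ^+ 2 * g t)%:E = (L ^+ 2)%:E)%E,
    forall (T c : R) (t : R^nat), t @ \oo --> T ->
      (forall k, c <= g (t k)) -> c <= g T &
    hyperplane_vol H (K `&` H) = (g tau)%:E].
Proof.
case: d K H => [|n] K H iK [u [c [u0 HE]]] Htau.
  by move: u0; rewrite thinmx0 eqxx.
have [[cK cvK _] KN K1 L0 KL] := iK.
have uu : 0 < dot u u by rewrite lt_neqAle eq_sym dot_eq0 u0 dot_ge0.
have eu : 0 < enorm u by rewrite sqrtr_gt0.
pose theta := (enorm u)^-1 *: u; pose a := (enorm u)^-1 * c.
have tt : dot theta theta = 1.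
  rewrite /theta dotZl dotZr mulrA -expr2 /enorm exprVn sqr_sqrtr ?(ltW uu)//.
  by rewrite mulVf// gt_eqF.
have HE' : H = [set x | dot x theta = a].
  rewrite HE; apply/seteqP; split => x; rewrite /= /theta /a dotZr; first by move=> ->.
  by apply: mulfI; rewrite gt_eqF// invr_gt0.
have frameP M : col_mx theta M *m (col_mx theta M)^T = 1%:M ->
    frame H (a *: theta, M).
  move=> OM; have [_ Mt MM] := (orthogonal_col_mx _ _).1 OM.
  split => //=; rewrite HE'; apply/seteqP; split => [_ [y _ <-]|x /= xa].
    by rewrite /= dotDl dotZl tt mulr1 dotE -mulmxA Mt mulmx0 mxE addr0.
  by exists (x *m M^T) => //; rewrite [RHS](orthogonal_decomp _ OM) xa.
have [M0 OM0] := exists_orthonormal_completion tt.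
rewrite /hyperplane_vol; set f := xget _ _.
(* Completing [theta] shows that a frame exists, so [xget] does not return its default. *)
have [MM fH] : frame H f by apply: (@xgetPex _ (0, 0)); exists (a *: theta, M0);
  exact: frameP.
case: f MM fH => p M /= MM fH.
have pMH y : dot (p + y *m M) theta = a.
  have : H (p + y *m M) by rewrite -fH; exists y.
  by rewrite HE'.
have pa : dot p theta = a by have := pMH 0; rewrite mul0mx addr0.
have Mt : M *m theta^T = 0.
  apply/row_matrixP => i; apply/rowP => j; rewrite ord1 row0 rowE mulmxA.
  have := pMH (delta_mx 0 i); rewrite dotDl pa dotE -[RHS]addr0 => /addrI ->.
  by rewrite mxE.
have OM : col_mx theta M *m (col_mx theta M)^T = 1%:M by exact/orthogonal_col_mx.
exists (section_vol K theta M); split.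
- split.
  + exact: measurable_section_vol.
  + exact: section_vol_ge0.
  + by move=> t; exact: section_volN.
  + by move=> l s t; exact: section_vol_log_concave.
- have := integral_section_vol cK OM (measurable_cst (1 : R)) (fun=> ler01).
  under [RHS]eq_integral do rewrite mul1r.
  move=> <-; transitivity (1%:E * vol K)%E; last by rewrite mul1e.
  exact: (integral_cst (mu n.+1) (measurable_compact_rV cK) 1%:E).
- have := @integral_section_vol _ _ K theta M cK OM (fun t => t ^+ 2).
  rewrite (isotropic_second_moment iK tt) => -> //.
  by move=> t; rewrite sqr_ge0.
- by move=> T c' t; exact: section_vol_usc.
have -> : section_vol K theta M tau = section_vol K theta M a.
  rewrite -Htau HE' dist0_hyperplane//.
  by have [h|h] := leP 0 a; [rewrite ger0_norm|rewrite ltr0_norm// section_volN].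
rewrite -section_volE// /vol.
(* The base point is p = a theta + (p M^T) M, so the two parametrisations of the section differ by
   the translation p M^T. *)
rewrite -[RHS](lebesgue_tuple_shift (p *m M^T)); last exact: measurable_section_set.
congr (mu n _); apply/seteqP; split => y /=.
  rewrite /section_set/= tuple_of_rVK => -[+ _]; congr K.
  by rewrite {1}(orthogonal_decomp p OM) pa mulmxDl addrA addrAC.
rewrite /section_set/= tuple_of_rVK => Ky; split; last by rewrite HE'/=.
move: Ky; congr K.
by rewrite [in RHS](orthogonal_decomp p OM) pa mulmxDl addrA addrAC.
Qed.

End hyperplane_sections.

(** * Integrals of exponentials and their second moments *)

Section exponential_integrals.
Context {R : realType}.
Notation lam := (@lebesgue_measure R).

Lemma is_derive_continuous (f df : R -> R) :
  (forall x : R, is_derive x 1 f (df x)) -> continuous f.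
Proof.
move=> fdf x; apply: differentiable_continuous; apply/derivable1_diffP.
exact: ex_derive.
Qed.

Lemma integral_is_derive (f F : R -> R) (a b : R) : a <= b ->
  continuous f -> (forall x : R, is_derive x 1 F (f x)) ->
  (\int[lam]_(x in `[a, b]) (f x)%:E = (F b - F a)%:E)%E.
Proof.
rewrite le_eqVlt => /predU1P[->|ab] cf Ff.
  by rewrite set_itv1 integral_set1 subrr.
have cF := is_derive_continuous Ff.
rewrite (@continuous_FTC2 _ f F) ?EFinB//.
- exact: continuous_subspaceT.
- split.
  + by move=> x _; exact: ex_derive.
  + by apply/cvg_at_right_filter; exact: cF.
  + by apply/cvg_at_left_filter; exact: cF.
- by move=> x _; rewrite derive1E; exact: derive_val.
Qed.

Lemma integraly_is_derive (f F : R -> R) (a l : R) :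
  (forall x, a <= x -> 0 <= f x) -> continuous f ->
  (forall x : R, is_derive x 1 F (f x)) -> F x @[x --> +oo] --> l ->
  (\int[lam]_(x in `[a, +oo[) (f x)%:E = (l - F a)%:E)%E.
Proof.
move=> f0 cf Ff Fl; have cF := is_derive_continuous Ff.
rewrite (@ge0_continuous_FTC2y _ f F a l) ?EFinB//.
- exact: continuous_subspaceT.
- by apply/cvg_at_right_filter; exact: cF.
- by move=> x _; rewrite derive1E; exact: derive_val.
Qed.

Definition exp_prim (s : R) (t : R) : R := - (expR (- (s * t)) / s).

(** Obtained by integrating t^2 expR(-st) by parts twice, with the constant that makes it vanish at
    +oo for s > 0. *)
Definition exp2_prim (s : R) (t : R) : R :=
  - ((t ^+ 2 / s + 2 * t / s ^+ 2 + 2 / s ^+ 3) * expR (- (s * t))).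

Lemma is_derive_exp_prim (s t : R) : s != 0 ->
  is_derive t 1 (exp_prim s) (expR (- (s * t))).
Proof.
move=> s0; rewrite /exp_prim; apply: is_derive_eq.
by rewrite /GRing.scale/=; field.
Qed.

Lemma is_derive_exp2_prim (s t : R) : s != 0 ->
  is_derive t 1 (exp2_prim s) (t ^+ 2 * expR (- (s * t))).
Proof.
move=> s0; rewrite /exp2_prim; apply: is_derive_eq.
by rewrite /GRing.scale/=; field.
Qed.

Lemma continuous_exp (s : R) : continuous (fun t : R => expR (- (s * t))).
Proof.
apply: (@is_derive_continuous _ (fun t => - s * expR (- (s * t)))) => t.
by apply: is_derive_eq; rewrite /GRing.scale/= mulr1 mulrC.
Qed.

Lemma continuous_exp2 (s : R) : continuous (fun t : R => t ^+ 2 * expR (- (s * t))).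
Proof.
apply: (@is_derive_continuous _
  (fun t => (2 * t - s * t ^+ 2) * expR (- (s * t)))) => t.
by apply: is_derive_eq; rewrite /GRing.scale/=; ring.
Qed.

(** Cube the tangent bound at x / 3. Cubic growth is enough to beat the quadratic factor of
    [exp2_prim] at infinity. *)
Lemma expR_ge_cube (x : R) : 0 <= x -> (1 + x / 3) ^+ 3 <= expR x.
Proof.
move=> x0; have -> : expR x = expR (x / 3) ^+ 3.
  by rewrite -expRM_natl; congr expR; field.
by apply: lerXn2r; rewrite ?nnegrE ?expR_ge0 ?expR_ge1Dx// addr_ge0// divr_ge0.
Qed.

Lemma cvg_exp_prim (s : R) : 0 < s -> exp_prim s x @[x --> +oo] --> (0 : R).
Proof.
move=> s0; rewrite -oppr0; apply: cvgN; rewrite -(mul0r s^-1); apply: cvgMl.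
apply: (@cvg_comp _ _ _ (fun x => s * x) (fun x => expR (- x)) _ (pinfty_nbhs R)).
  exact: gt0_cvgMry.
exact: cvgr_expR.
Qed.

Lemma cvg_exp2_prim (s : R) : 0 < s -> exp2_prim s x @[x --> +oo] --> (0 : R).
Proof.
move=> s0; rewrite -oppr0; apply: cvgN.
(* For t >= 1 the polynomial factor is at most A t^2, and expR(st) >= (st)^3 / 27, which leaves a
   multiple of 1 / t. *)
pose A := s^-1 + 2 / s ^+ 2 + 2 / s ^+ 3.
apply: (@squeeze_cvgr _ _ _ _ (fun=> 0) (fun t => A * 27 / s ^+ 3 * t^-1)).
- near=> t; have t0 : 0 < t by near: t; exact: nbhs_pinfty_gt.
  have t1 : 1 <= t by near: t; exact: nbhs_pinfty_ge.
  have [si0 sn0] : 0 < s^-1 /\ s != 0 by rewrite invr_gt0 gt_eqF.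
  apply/andP; split.
    rewrite mulr_ge0 ?expR_ge0// !addr_ge0// divr_ge0 ?exprn_ge0 ?mulr_ge0 ?(ltW s0)
      ?(ltW t0)//.
  rewrite expRN ler_pdivrMr ?expR_gt0//.
  have H := expR_ge_cube (ltW (mulr_gt0 s0 t0)).
  have H1 : (s * t) ^+ 3 / 27 <= expR (s * t).
    apply: le_trans H; have -> : (s * t) ^+ 3 / 27 = (s * t / 3) ^+ 3 by field.
    by apply: lerXn2r; rewrite ?nnegrE ?addr_ge0 ?divr_ge0 ?mulr_ge0 ?(ltW s0) ?(ltW
      t0)// lerDr.
  apply: (@le_trans _ _ (A * 27 / s ^+ 3 / t * ((s * t) ^+ 3 / 27))); last first.
    rewrite ler_wpM2l// /A !divr_ge0 ?mulr_ge0 ?addr_ge0 ?divr_ge0 ?exprn_ge0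
      ?invr_ge0 ?(ltW s0) ?(ltW t0)//.
  have -> : A * 27 / s ^+ 3 / t * ((s * t) ^+ 3 / 27) = A * t ^+ 2.
    by field; rewrite sn0 gt_eqF.
  have -> : A * t ^+ 2 = s^-1 * t ^+ 2 + 2 / s ^+ 2 * t ^+ 2 + 2 / s ^+ 3 * t ^+ 2.
    by rewrite /A; ring.
  apply: lerD; first apply: lerD.
  - by rewrite mulrC.
  - rewrite mulrAC ler_wpM2l ?divr_ge0 ?exprn_ge0 ?(ltW s0)//.
    by rewrite expr2 ler_peMl// ltW.
  - rewrite -[leLHS]mulr1 ler_wpM2l ?divr_ge0 ?exprn_ge0 ?(ltW s0)//.
    by rewrite -(expr1n _ 2) ler_sqr ?nnegrE ?(ltW t0).
- exact: cvg_cst.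
- rewrite -(mulr0 (A * 27 / s ^+ 3)); apply: cvgMr.
  apply: (gtr0_cvgV0 (f := id) _).2; last exact: cvg_id.
  by near=> t; near: t; exact: nbhs_pinfty_gt.
Unshelve. all: by end_near. Qed.

Lemma integral_exp_itv (s a b : R) : s != 0 -> a <= b ->
  (\int[lam]_(t in `[a, b]) (expR (- (s * t)))%:E =
   (exp_prim s b - exp_prim s a)%:E)%E.
Proof.
move=> s0 ab; apply: integral_is_derive => //; first exact: continuous_exp.
by move=> x; exact: is_derive_exp_prim.
Qed.

Lemma integral_exp2_itv (s a b : R) : s != 0 -> a <= b ->
  (\int[lam]_(t in `[a, b]) (t ^+ 2 * expR (- (s * t)))%:E =
   (exp2_prim s b - exp2_prim s a)%:E)%E.
Proof.
move=> s0 ab; apply: integral_is_derive => //; first exact: continuous_exp2.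
by move=> x; exact: is_derive_exp2_prim.
Qed.

Lemma integral_exp_itvy (s a : R) : 0 < s ->
  (\int[lam]_(t in `[a, +oo[) (expR (- (s * t)))%:E = (- exp_prim s a)%:E)%E.
Proof.
move=> s0; transitivity ((0 - exp_prim s a)%:E); last by rewrite add0r.
apply: integraly_is_derive.
- by move=> x _; exact: expR_ge0.
- exact: continuous_exp.
- by move=> x; apply: is_derive_exp_prim; rewrite gt_eqF.
- exact: cvg_exp_prim.
Qed.

Lemma integral_exp2_itvy (s a : R) : 0 < s ->
  (\int[lam]_(t in `[a, +oo[) (t ^+ 2 * expR (- (s * t)))%:E =
   (- exp2_prim s a)%:E)%E.
Proof.
move=> s0; transitivity ((0 - exp2_prim s a)%:E); last by rewrite add0r.
apply: integraly_is_derive.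
- by move=> x _; rewrite mulr_ge0 ?sqr_ge0 ?expR_ge0.
- exact: continuous_exp2.
- by move=> x; apply: is_derive_exp2_prim; rewrite gt_eqF.
- exact: cvg_exp2_prim.
Qed.

Lemma integral_sqr_itv (a b : R) : a <= b ->
  (\int[lam]_(t in `[a, b]) (t ^+ 2)%:E = (b ^+ 3 / 3 - a ^+ 3 / 3)%:E)%E.
Proof.
move=> ab; apply: (integral_is_derive (F := fun t => t ^+ 3 / 3)) => //.
  exact: exprn_continuous.
by move=> x; apply: is_derive_eq; rewrite /GRing.scale/=; field.
Qed.

End exponential_integrals.

(** * Comparing second moments of functions with equal mass *)

Section comparison.
Context {R : realType}.
Notation lam := (@lebesgue_measure R).
Notation D := (`[0%R, +oo[%classic : set R).

Lemma ge0_integral_even (f : R -> R) : measurable_fun setT f ->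
  (forall x, 0 <= f x) -> (forall x, f (- x) = f x) ->
  (\int[lam]_x (f x)%:E = 2%:E * \int[lam]_(x in D) (f x)%:E)%E.
Proof.
move=> mf f0 fN.
have mEf : measurable_fun setT (EFin \o f) by exact/measurable_EFinP.
rewrite -(setUv D) ge0_integral_setU//=; last 4 first.
- exact: measurableC.
- by rewrite setUv.
- by move=> x _; rewrite lee_fin.
- exact/disj_setPCl.
rewrite [in RHS]mule_natl mule2n; congr (_ + _)%E.
rewrite ge0_integration_by_substitution0//=.
rewrite setCitvr integral_itv_bndo_bndc; last exact: measurable_funTS.
by apply: eq_integral => x _; rewrite /= fN.
Qed.

Section two_functions.
Variables (f phi : R -> R) (m V W : R).
Hypotheses (mf : measurable_fun setT f) (mphi : measurable_fun setT phi).
Hypotheses (f0 : forall t, 0 <= f t) (phi0 : forall t, 0 <= phi t).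
Hypothesis intf : (\int[lam]_(t in D) (f t)%:E = m%:E)%E.
Hypothesis intphi : (\int[lam]_(t in D) (phi t)%:E = m%:E)%E.
Hypothesis intf2 : (\int[lam]_(t in D) (t ^+ 2 * f t)%:E = V%:E)%E.
Hypothesis intphi2 : (\int[lam]_(t in D) (t ^+ 2 * phi t)%:E = W%:E)%E.

(** Only nonnegative combinations are integrated; negative terms of an inequality are moved to its
    other side, so that no integrability has to be discussed. *)
Let integral_comb (a b a' b' : R) : 0 <= a -> 0 <= b -> 0 <= a' -> 0 <= b' ->
  (\int[lam]_(t in D)
    (a * (t ^+ 2 * f t) + b * f t + (a' * (t ^+ 2 * phi t) + b' * phi t))%:E =
   (a * V + b * m + (a' * W + b' * m))%:E)%E.
Proof.
move=> a0 b0 a0' b0'.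
have m2 (h : R -> R) : measurable_fun setT h -> measurable_fun setT (fun t : R =>
  t ^+ 2 * h t).
  by move=> mh; apply: measurable_funM => //; exact: exprn_measurable.
have p2 (h : R -> R) : (forall t, 0 <= h t) -> forall t, 0 <= t ^+ 2 * h t.
  by move=> h0 t; rewrite mulr_ge0// sqr_ge0.
have scal (k : R) (h : R -> R) (v : R) : 0 <= k -> measurable_fun setT h ->
    (forall t, 0 <= h t) -> (\int[lam]_(t in D) (h t)%:E = v%:E)%E ->
    (\int[lam]_(t in D) (k * h t)%:E = (k * v)%:E)%E.
  move=> k0 mh h0 hv; under eq_integral do rewrite EFinM.
  rewrite ge0_integralZl_EFin//.
  - by rewrite hv -EFinM.
  - by move=> t _; rewrite lee_fin.
  - by apply/measurable_EFinP; exact: measurable_funTS.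
have add (h k : R -> R) (v w : R) : measurable_fun setT h -> measurable_fun setT k ->
    (forall t, 0 <= h t) -> (forall t, 0 <= k t) ->
    (\int[lam]_(t in D) (h t)%:E = v%:E)%E ->
    (\int[lam]_(t in D) (k t)%:E = w%:E)%E ->
    (\int[lam]_(t in D) (h t + k t)%:E = (v + w)%:E)%E.
  move=> mh mk h0 k0 hv kw; under eq_integral do rewrite EFinD.
  rewrite ge0_integralD//.
  - by rewrite hv kw EFinD.
  - by move=> t _; rewrite lee_fin.
  - by apply/measurable_EFinP; exact: measurable_funTS.
  - by move=> t _; rewrite lee_fin.
  - by apply/measurable_EFinP; exact: measurable_funTS.
have mZ (k : R) (h : R -> R) : measurable_fun setT h -> measurable_fun setT (fun t :
  R => k * h t).
  by move=> mh; exact: measurable_funM.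
have comb (k l : R) (h : R -> R) (v w : R) : 0 <= k -> 0 <= l ->
    measurable_fun setT h -> (forall t, 0 <= h t) ->
    (\int[lam]_(t in D) (h t)%:E = v%:E)%E ->
    (\int[lam]_(t in D) (t ^+ 2 * h t)%:E = w%:E)%E ->
    (\int[lam]_(t in D) (k * (t ^+ 2 * h t) + l * h t)%:E = (k * w + l * v)%:E)%E.
  move=> k0 l0 mh h0 hv hw.
  apply: (add (fun t => k * (t ^+ 2 * h t)) (fun t => l * h t)).
  - by apply: mZ; exact: m2.
  - exact: mZ.
  - by move=> t; rewrite mulr_ge0// p2.
  - by move=> t; rewrite mulr_ge0.
  - by apply: (scal k (fun t => t ^+ 2 * h t)) => //; [exact: m2|exact: p2].
  - exact: scal.
apply: (add (fun t => a * (t ^+ 2 * f t) + b * f t)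
            (fun t => a' * (t ^+ 2 * phi t) + b' * phi t)).
- by apply: measurable_funD; apply: mZ => //; exact: m2.
- by apply: measurable_funD; apply: mZ => //; exact: m2.
- by move=> t; rewrite addr_ge0// mulr_ge0// p2.
- by move=> t; rewrite addr_ge0// mulr_ge0// p2.
- exact: comb.
- exact: comb.
Qed.

Let le_comb (a b a' b' c d c' d' : R) : 0 <= a -> 0 <= b -> 0 <= a' -> 0 <= b' ->
  0 <= c -> 0 <= d -> 0 <= c' -> 0 <= d' ->
  (forall t, 0 <= t ->
    a * (t ^+ 2 * f t) + b * f t + (a' * (t ^+ 2 * phi t) + b' * phi t) <=
    c * (t ^+ 2 * f t) + d * f t + (c' * (t ^+ 2 * phi t) + d' * phi t)) ->
  a * V + b * m + (a' * W + b' * m) <= c * V + d * m + (c' * W + d' * m).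
Proof.
move=> a0 b0 a0' b0' c0 d0 c0' d0' H.
rewrite -lee_fin -integral_comb// -integral_comb//.
have mc (x y x' y' : R) : measurable_fun D (fun t : R =>
    (x * (t ^+ 2 * f t) + y * f t + (x' * (t ^+ 2 * phi t) + y' * phi t))%:E).
  apply/measurable_EFinP; apply: measurable_funTS.
  have mt2 : measurable_fun setT (fun t : R => t ^+ 2) by exact: exprn_measurable.
  by do ! [apply: measurable_funD|apply: measurable_funM].
apply: ge0_le_integral => //.
- move=> t _; rewrite lee_fin.
  by rewrite !addr_ge0// mulr_ge0// mulr_ge0// sqr_ge0.
- exact: mc.
- exact: mc.
- by move=> t /=; rewrite in_itv/= andbT => t0; rewrite lee_fin; exact: H.
Qed.

(** The product (c^2 - t^2) (th phi - f) is nonnegative on both sides of c. Integrating it, with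
    equal masses and second moments, gives (1 - th) (W - c^2 m) >= 0, and W < c^2 m rules out th <
    1. *)
Lemma truncated_comparison (th c : R) :
  (forall t, 0 <= t <= c -> f t <= th * phi t) ->
  (forall t, c < t -> phi t = 0) -> 0 <= c -> V = W -> W < c ^+ 2 * m -> 1 <= th.
Proof.
move=> fphi phic c0 VW Wc; rewrite leNgt; apply/negP => th1.
have : 0 * V + c ^+ 2 * m + (1 * W + (1 - th) * c ^+ 2 * m) <=
       1 * V + 0 * m + ((1 - th) * W + c ^+ 2 * m).
  apply: le_comb; rewrite ?mulr_ge0 ?sqr_ge0 ?subr_ge0 ?(ltW th1)// => t t0.
  case: (leP t c) => tc; last first.
    rewrite phic// !mulr0 !mul0r !addr0 mul1r add0r ler_wpM2r//.
    by rewrite ler_sqr ?nnegrE// ltW.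
  have tc2 : 0 <= c ^+ 2 - t ^+ 2 by rewrite subr_ge0 ler_sqr.
  have ftc : 0 <= th * phi t - f t by rewrite subr_ge0 fphi// t0 tc.
  rewrite -subr_ge0 [leRHS](_ : _ = (c ^+ 2 - t ^+ 2) * (th * phi t - f t)); last by ring.
  exact: mulr_ge0.
rewrite VW -subr_ge0 [leRHS](_ : _ = (1 - th) * (W - c ^+ 2 * m)); last by ring.
by rewrite pmulr_rge0 ?subr_gt0// subr_ge0 leNgt Wc.
Qed.

(** A nonincreasing f crosses the plateau at most once and stays below phi after it, so (r^2 - t^2)
    (f - phi) >= 0 for the crossing point r; integrating with equal masses gives W - V >= 0. *)
Lemma plateau_comparison (u C : R) : 0 <= u ->
  (forall s t, 0 <= s <= t -> f t <= f s) ->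
  (forall t, 0 <= t < u -> phi t = C) ->
  (forall t, u <= t -> f t <= phi t) -> V <= W.
Proof.
move=> u0 fdec phiC fphi.
(* The crossing point is sup S, or 0 when f is below the plateau from the start. *)
pose S := [set t | 0 <= t <= u /\ C <= f t].
have [r [/andP[r0 ru] rl rr]] : exists r, [/\ 0 <= r <= u,
    forall t, 0 <= t < r -> C <= f t & forall t, r < t < u -> f t <= C].
  have [S0|S0] := pselect (S !=set0); last first.
    exists 0; split=> [|t /andP[t0]|t /andP[t0 tu]]; first by rewrite lexx.
      by rewrite ltNge t0.
    by rewrite leNgt; apply/negP => /ltW Ct; apply: S0; exists t; split; rewrite // !ltW.
  have supS : has_sup S by split => //; exists u => t [/andP[]].
  exists (sup S); split=> [|t /andP[t0 tS]|t /andP[St tu]].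
  - have [x Sx] := S0; have [/andP[x0 xu] _] := Sx.
    rewrite (le_trans x0) ?(ub_le_sup supS.2)//=.
    by apply: sup_le_ub => // y [/andP[]].
  - have e0 : 0 < sup S - t by rewrite subr_gt0.
    have [y [_ Cy] ty] := sup_adherent e0 supS; apply: le_trans Cy _.
    by apply: fdec; rewrite t0/= ltW//; apply: le_lt_trans ty; lra.
  - rewrite leNgt; apply/negP => /ltW Ct.
    have [x Sx] := S0; have [/andP[x0 xu] _] := Sx.
    have xS : x <= sup S by exact: ub_le_sup supS.2 _ Sx.
    have : t <= sup S.
      apply: ub_le_sup supS.2 _ _; split => //; rewrite (ltW tu) andbT.
      exact: le_trans x0 (le_trans xS (ltW St)).
    by rewrite leNgt St.
have : 1 * V + 0 * m + (0 * W + r ^+ 2 * m) <= 0 * V + r ^+ 2 * m + (1 * W + 0 * m).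
  apply: le_comb; rewrite ?sqr_ge0// => t t0.
  rewrite -subr_ge0 [leRHS](_ : _ = (r ^+ 2 - t ^+ 2) * (f t - phi t)); last by ring.
  have [tr|rt|->] := ltgtP t r; last by rewrite subrr mul0r.
    rewrite mulr_ge0// subr_ge0; first by rewrite ler_sqr ?nnegrE// ltW.
    by rewrite phiC ?rl// t0 (lt_le_trans tr).
  rewrite mulr_le0// subr_le0; first by rewrite ler_sqr ?nnegrE// ltW.
  by have [tu|ut] := ltP t u; [rewrite phiC ?t0// rr// rt|exact: fphi].
lra.
Qed.

End two_functions.
End comparison.

(** * One-variable inequalities *)

Section real_inequalities.
Context {R : realType}.
Implicit Types x y z b : R.

Lemma is_derive_ge0 (h dh : R -> R) : (forall x : R, is_derive x 1 h (dh x)) ->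
  (forall x, 0 <= x -> 0 <= dh x) -> 0 <= h 0 -> forall x, 0 <= x -> 0 <= h x.
Proof.
move=> hd dh0 h0 x; rewrite le_eqVlt => /predU1P[<-//|x0].
have [|c] := @MVT R h dh _ _ x0 (fun x _ => hd x).
  exact/continuous_subspaceT/(is_derive_continuous hd).
rewrite in_itv/= => /andP[c0 _] /eqP; rewrite subr_eq => /eqP ->.
by rewrite addr_ge0// mulr_ge0 ?dh0 ?subr0// ltW.
Qed.

(** The Taylor bounds follow one from the other: each difference has the preceding one as
    derivative. *)
Lemma expR_ge_taylor2 x : 0 <= x -> 1 + x + x ^+ 2 / 2 <= expR x.
Proof.
move=> x0; rewrite -subr_ge0.
apply: (@is_derive_ge0 (fun x => expR x - (1 + x + x ^+ 2 / 2))
  (fun x => expR x - (1 + x))) => //.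
- by move=> t; apply: is_derive_eq; rewrite /GRing.scale/=; field.
- by move=> t t0; rewrite subr_ge0 expR_ge1Dx.
- by rewrite expR0 expr0n/= mul0r !addr0 subrr.
Qed.

Lemma expR_ge_taylor3 x : 0 <= x -> 1 + x + x ^+ 2 / 2 + x ^+ 3 / 6 <= expR x.
Proof.
move=> x0; rewrite -subr_ge0.
apply: (@is_derive_ge0 (fun x => expR x - (1 + x + x ^+ 2 / 2 + x ^+ 3 / 6))
  (fun x => expR x - (1 + x + x ^+ 2 / 2))) => //.
- by move=> t; apply: is_derive_eq; rewrite /GRing.scale/=; field.
- by move=> t t0; rewrite subr_ge0 expR_ge_taylor2.
- by rewrite expR0 !expr0n/= !mul0r !addr0 subrr.
Qed.

Lemma expR_ge_taylor4 x : 0 <= x ->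
  1 + x + x ^+ 2 / 2 + x ^+ 3 / 6 + x ^+ 4 / 24 <= expR x.
Proof.
move=> x0; rewrite -subr_ge0.
apply: (@is_derive_ge0
  (fun x => expR x - (1 + x + x ^+ 2 / 2 + x ^+ 3 / 6 + x ^+ 4 / 24))
  (fun x => expR x - (1 + x + x ^+ 2 / 2 + x ^+ 3 / 6))) => //.
- by move=> t; apply: is_derive_eq; rewrite /GRing.scale/=; field.
- by move=> t t0; rewrite subr_ge0 expR_ge_taylor3.
- by rewrite expR0 !expr0n/= !mul0r !addr0 subrr.
Qed.

(** With z = expR x this is x <= sinh x. It replaces a logarithm by an algebraic expression with an
    error of third order at z = 1, the equality case of [plateau_inequality]. *)
Lemma le_expR_sinh z : 1 <= z -> z <= expR ((z - z^-1) / 2).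
Proof.
move=> z1; have z0 : 0 < z by exact: lt_le_trans z1.
have lz0 : 0 <= ln z by exact: ln_ge0.
rewrite -[leLHS]lnK ?posrE// ler_expR -subr_ge0.
have -> : (z - z^-1) / 2 - ln z = (expR (ln z) - expR (- ln z)) / 2 - ln z.
  by rewrite expRN lnK ?posrE.
apply: (@is_derive_ge0 (fun x => (expR x - expR (- x)) / 2 - x)
  (fun x => (expR x + expR (- x)) / 2 - 1)) => //.
- by move=> t; apply: is_derive_eq; rewrite /GRing.scale/=; field.
- move=> t t0; rewrite subr_ge0 ler_pdivlMr// mul1r.
  have h1 := expR_ge1Dx t; have h2 := expR_ge1Dx (- t); lra.
Qed.

(* The parameter [w] is [sqrt 3] times the standard deviation, in units of the
   decay rate, of the density that is constant on [[0, y - 1]] and then decays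
   exponentially. *)
Lemma plateau_inequality (a w y : R) : 0 < a -> a ^+ 2 = 6 -> 0 < w -> 1 <= y ->
  w ^+ 2 = y ^+ 2 + 3 + 2 / y ->
  a * y / w <= expR (a - 1 - w + y).
Proof.
move=> a0 a6 w0 y1 wy; have y0 : 0 < y by exact: lt_le_trans y1.
have wy' : w ^+ 2 * y = y ^+ 3 + 3 * y + 2 by rewrite wy; field; rewrite gt_eqF.
have [a2 a25] : 2 < a /\ a < 5 / 2.
  by split; rewrite -ltr_sqr ?nnegrE ?(ltW a0)// a6; lra.
have aw : 1 <= a * y / w.
  rewrite ler_pdivlMr// mul1r -ler_sqr ?nnegrE ?mulr_ge0 ?(ltW a0) ?(ltW y0) ?(ltW w0)//.
  rewrite exprMn a6 wy -subr_ge0.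
  have -> : 6 * y ^+ 2 - (y ^+ 2 + 3 + 2 / y) = (y - 1) * (5 * y ^+ 2 + 5 * y + 2) / y.
    by field; rewrite gt_eqF.
  by rewrite divr_ge0 ?mulr_ge0 ?subr_ge0 ?(ltW y0)//; nra.
apply: le_trans (le_expR_sinh aw) _; rewrite ler_expR.
rewrite -subr_ge0.
have -> : a - 1 - w + y - (a * y / w - (a * y / w)^-1) / 2 =
  (2 * a * y * w * (y + a - 1) - (6 * y ^+ 2 - w ^+ 2 + 2 * a * y * w ^+ 2)) /
  (2 * a * w * y).
  rewrite -a6; field; rewrite !gt_eqF//.
rewrite divr_ge0 ?mulr_ge0 ?(ltW a0) ?(ltW y0) ?(ltW w0)// subr_ge0.
rewrite -(ler_pM2r y0).
pose N := y ^+ 3 + 3 * y + 2; pose B := y * N; pose A := 5 * y ^+ 3 - 3 * y - 2.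
have -> : (6 * y ^+ 2 - w ^+ 2 + 2 * a * y * w ^+ 2) * y = A + 2 * a * B.
  rewrite /A /B /N -wy'.
  have -> : 5 * y ^+ 3 - 3 * y - 2 = 6 * y ^+ 3 - (y ^+ 3 + 3 * y + 2) by ring.
  by rewrite -wy'; ring.
have h0 : 0 <= y - 1 by rewrite subr_ge0.
have N0 : 0 <= N by rewrite /N !addr_ge0 ?exprn_ge0 ?mulr_ge0 ?(ltW y0).
have AB0 : 0 <= A + 2 * a * B.
  have -> : A = (y - 1) * (5 * y ^+ 2 + 5 * y + 2) by rewrite /A; ring.
  have B0 : 0 <= B by rewrite mulr_ge0 ?(ltW y0).
  by rewrite addr_ge0// mulr_ge0 ?mulr_ge0 ?(ltW a0)//; nra.
have ya0 : 0 <= y + a - 1 by lra.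
(* Only one side still contains [w], as a factor of degree 1, so squaring leaves polynomials in y
   and a. *)
rewrite -ler_sqr ?nnegrE ?mulr_ge0 ?(ltW a0) ?(ltW y0) ?(ltW w0)//.
have -> : (2 * a * y * w * (y + a - 1) * y) ^+ 2 =
    4 * a ^+ 2 * y ^+ 3 * (w ^+ 2 * y) * (y + a - 1) ^+ 2 by ring.
rewrite a6 wy' -/N -subr_ge0.
(* Equality at y = 1 is a double root. The summand with the factor a^2 - 6, which is 0, makes this
   an identity for arbitrary a. *)
have -> : 4 * 6 * y ^+ 3 * N * (y + a - 1) ^+ 2 - (A + 2 * a * B) ^+ 2 =
    (y - 1) ^+ 2 * (216 * (a - 2) + (600 * a - 1224) * (y - 1)
      + (660 * a - 1353) * (y - 1) ^+ 2 + (396 * a - 774) * (y - 1) ^+ 3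
      + (148 * a - 265) * (y - 1) ^+ 4 + (28 * a - 48) * (y - 1) ^+ 5)
    + (a ^+ 2 - 6) * (24 * y ^+ 3 * N - 4 * B ^+ 2).
  by rewrite /A /B /N; ring.
(* 41/20 = 1353/660 is the largest zero among the coefficients, which are affine in a. *)
have a205 : 41 / 20 < a by rewrite -ltr_sqr ?nnegrE ?(ltW a0)// a6; lra.
have term (k : R) i : 0 <= k -> 0 <= k * (y - 1) ^+ i.
  by move=> k0; rewrite mulr_ge0// exprn_ge0.
have a60 : a ^+ 2 - 6 = 0 by rewrite a6 subrr.
rewrite [X in _ + X * _]a60 [X in _ + X]mul0r [leRHS]addr0.
apply: mulr_ge0; first exact: sqr_ge0.
apply: addr_ge0; last by apply: term; lra.
apply: addr_ge0; last by apply: term; lra.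
apply: addr_ge0; last by apply: term; lra.
apply: addr_ge0; last by apply: term; lra.
apply: addr_ge0; last by apply: (term _ 1%N); lra.
by lra.
Qed.

(** With q = 15 / S this reads (b^2/2 + b) / (expR b - 1) <= q (2 - q) = 1 - (1 - q)^2, a rational
    bound for the quantity called 1 - r^2 below. *)
Lemma taylor4_comparison b (S : R) : 0 < b -> S = 2 * b ^+ 2 + 6 * b + 15 ->
  (b ^+ 2 / 2 + b) * S ^+ 2 <= 15 * (2 * S - 15) * (expR b - 1).
Proof.
move=> b0 SE; have H := expR_ge_taylor4 (ltW b0).
apply: (@le_trans _ _ (15 * (2 * S - 15) * (b + b ^+ 2 / 2 + b ^+ 3 / 6 + b ^+ 4 / 24))).
  rewrite -subr_ge0.
  have -> : 15 * (2 * S - 15) * (b + b ^+ 2 / 2 + b ^+ 3 / 6 + b ^+ 4 / 24) -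
     (b ^+ 2 / 2 + b) * S ^+ 2 =
     b ^+ 3 * (b ^+ 3 / 2 + (3 / 2 * (b - 7 / 8) ^+ 2 + 45 / 128)).
    by rewrite SE; field.
  have h3 : 0 <= b ^+ 3 by rewrite exprn_ge0// ltW.
  by have h2 := sqr_ge0 (b - 7 / 8); rewrite mulr_ge0//; lra.
rewrite ler_wpM2l//; last by lra.
by rewrite mulr_ge0//; rewrite SE; nra.
Qed.

(* With [r = sigma b / sqrt 2], the hypothesis on [r] reads
   [expR b - 1 = (b^2 / 2 + b) / (1 - r^2)]; it forces
   [r >= 1 - 15 / (2 b^2 + 6 b + 15)]. *)
Lemma truncated_std_inequality b r : 0 < b -> 0 <= r < 1 ->
  (1 - r ^+ 2) * (expR b - 1) = b ^+ 2 / 2 + b ->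
  (1 - r) * (2 - r) * (1 - r ^+ 2 + (b ^+ 2 / 2 + b)) <= 2 * (1 + r).
Proof.
move=> b0 /andP[r0 r1] Er.
pose S := 2 * b ^+ 2 + 6 * b + 15.
have H := taylor4_comparison b0 (erefl S).
have S0 : 0 < S by rewrite /S; nra.
pose m := b ^+ 2 / 2 + b; have m0 : 0 < m by rewrite /m; nra.
have E0 : 0 < expR b - 1 by rewrite subr_gt0 expR_gt1.
pose q := 15 / S; have q0 : 0 < q by rewrite divr_gt0.
(* 1 - r^2 and the bound are the values of x (2 - x) at 1 - r and at q, and this function increases
   up to 1. *)
have qr : 1 - r <= q.
  have : (1 - r ^+ 2) * S ^+ 2 <= 15 * (2 * S - 15).
    rewrite -(ler_pM2r E0) mulrAC Er; exact: H.
  rewrite /q ler_pdivlMr// => H1.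
  rewrite leNgt; apply/negP => H2.
  have S15 : 15 < S by rewrite /S; nra.
  have XS : (1 - r) * S <= S by rewrite ler_piMl ?(ltW S0)// gerBl.
  have : 0 < ((1 - r) * S - 15) * (2 * S - (1 - r) * S - 15).
    by rewrite mulr_gt0//; lra.
  have -> : ((1 - r) * S - 15) * (2 * S - (1 - r) * S - 15) =
    (1 - r ^+ 2) * S ^+ 2 - 15 * (2 * S - 15) by ring.
  by rewrite subr_gt0 ltNge H1.
have q1 : q < 1 by rewrite /q ltr_pdivrMr// mul1r /S; nra.
(* In terms of e = 1 - r the left side of the claim increases and the right side decreases, so the
   case e = q suffices; there everything is rational in b. *)
have P0 : q * (1 + q) * (q * (2 - q) + m) <= 2 * (2 - q).
  have -> : q * (1 + q) * (q * (2 - q) + m) =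
     (15 * (S + 15) * (15 * (2 * S - 15) + m * S ^+ 2)) / S ^+ 4.
    by rewrite /q; field; rewrite gt_eqF.
  rewrite ler_pdivrMr ?exprn_gt0//.
  have -> : 2 * (2 - q) * S ^+ 4 = 2 * (2 * S - 15) * S ^+ 3.
    by rewrite /q; field; rewrite gt_eqF.
  rewrite -subr_ge0 /m /S.
  have -> : 2 * (2 * S - 15) * S ^+ 3 -
     15 * (S + 15) * (15 * (2 * S - 15) + (b ^+ 2 / 2 + b) * S ^+ 2) =
     b ^+ 2 * (11475 + 14985 * b + 7029 * b ^+ 2 + 2772 * b ^+ 3 +
       636 * b ^+ 4 + 108 * b ^+ 5 + 4 * b ^+ 6).
    by rewrite /S; field.
  have bk k : 0 <= b ^+ k by rewrite exprn_ge0// ltW.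
  apply: mulr_ge0; first exact: bk.
  by move: (bk 2%N) (bk 3%N) (bk 4%N) (bk 5%N) (bk 6%N); lra.
pose e := 1 - r; have e0 : 0 <= e by rewrite /e; lra.
have -> : (1 - r) * (2 - r) * (1 - r ^+ 2 + m) = e * (1 + e) * (e * (2 - e) + m).
  by rewrite /e; ring.
have -> : 2 * (1 + r) = 2 * (2 - e) by rewrite /e; ring.
apply: (@le_trans _ _ (q * (1 + q) * (q * (2 - q) + m))).
  apply: ler_pM => //.
  - by rewrite mulr_ge0// addr_ge0.
  - by rewrite addr_ge0 ?(ltW m0)// mulr_ge0//; rewrite /e; lra.
  - by apply: ler_pM => //; rewrite -/e in qr; lra.
  - rewrite lerD2r -subr_ge0; rewrite -/e in qr.
    have -> : q * (2 - q) - e * (2 - e) = (q - e) * (2 - q - e) by ring.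
    by rewrite mulr_ge0//; lra.
by apply: le_trans P0 _; rewrite ler_pM2l// lerD2l lerN2.
Qed.

End real_inequalities.

(** * The standard deviation [sigma] and the extremal values [phi_Y] *)

Section sigma_theory.
Context {R : realType}.
Implicit Types b t y e : R.

Let expR_gt1' b : 0 < b -> 0 < expR b - 1.
Proof. by move=> b0; rewrite subr_gt0 expR_gt1. Qed.

Let onem_expRN b : 0 < b -> 0 < 1 - expR (- b).
Proof. by move=> b0; rewrite subr_gt0 expR_lt1 oppr_lt0. Qed.

Let onem_expRNE b : 1 - expR (- b) = (expR b - 1) / expR b.
Proof. by rewrite mulrBl divff ?mul1r ?expRN// gt_eqF// expR_gt0. Qed.

Let radicandE b : 0 < b -> 2 - expR (- b) * b * (b + 2) / (1 - expR (- b)) =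
  2 - (b ^+ 2 + 2 * b) / (expR b - 1).
Proof.
move=> b0; have h1 := expR_gt1' b0; have e0 := expR_gt0 b.
by rewrite onem_expRNE expRN; field; rewrite !gt_eqF.
Qed.

Let sigma_sqr_gt0 b : 0 < b -> 0 < 2 - (b ^+ 2 + 2 * b) / (expR b - 1).
Proof.
move=> b0; rewrite subr_gt0 ltr_pdivrMr ?expR_gt1'//.
have h1 := expR_ge_taylor3 (ltW b0); have h2 : 0 < b ^+ 3 by rewrite exprn_gt0.
lra.
Qed.

Lemma sqr_sigma b : 0 < b -> sigma b ^+ 2 = 2 - (b ^+ 2 + 2 * b) / (expR b - 1).
Proof.
by move=> b0; rewrite /sigma radicandE// sqr_sqrtr// ltW// sigma_sqr_gt0.
Qed.

Lemma sigma_gt0 b : 0 < b -> 0 < sigma b.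
Proof. by move=> b0; rewrite /sigma sqrtr_gt0 radicandE// sigma_sqr_gt0. Qed.

Lemma sqr_sigma_lt2 b : 0 < b -> sigma b ^+ 2 < 2.
Proof.
move=> b0; rewrite sqr_sigma// gtrBl divr_gt0 ?expR_gt1'//.
by rewrite addr_gt0 ?exprn_gt0 ?mulr_gt0.
Qed.

(** The right side is the variance of the uniform law on [-b, b]. Cleared of denominators and
    divided by expR b, the difference has derivative (2b/3) (1 - expR(-b) (1 + b)) >= 0. *)
Lemma sqr_sigma_le b : 0 < b -> sigma b ^+ 2 <= b ^+ 2 / 3.
Proof.
move=> b0; rewrite sqr_sigma// lerBlDr -lerBlDl ler_pdivlMr ?expR_gt1'//.
have : 0 <= expR (- b) * (2 / 3 * b ^+ 2 + 2 * b + 2) + (b ^+ 2 / 3 - 2).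
  apply: (@is_derive_ge0 _
    (fun b => expR (- b) * (2 / 3 * b ^+ 2 + 2 * b + 2) + (b ^+ 2 / 3 - 2))
    (fun b => 2 / 3 * b * (1 - expR (- b) * (1 + b)))).
  - by move=> t; apply: is_derive_eq; rewrite /GRing.scale/=; field.
  - move=> t t0; apply: mulr_ge0; first by rewrite mulr_ge0.
    rewrite subr_ge0 expRN mulrC ler_pdivrMr ?expR_gt0//.
    by rewrite mul1r expR_ge1Dx.
  - by rewrite oppr0 expR0 expr0n/=; lra.
  - exact: ltW.
rewrite expRN => H; have e0 := expR_gt0 b.
have := mulr_ge0 (ltW e0) H; rewrite mulrDr mulrA divff ?gt_eqF// mul1r.
lra.
Qed.

(** Keeps the argument of [f_Y b] in its support for all t up to sqrt 3. *)
Lemma sigma_le b t : 0 < b -> 0 <= t <= Num.sqrt 3 -> t * sigma b <= b.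
Proof.
move=> b0 /andP[t0 t3]; have s0 := sigma_gt0 b0.
rewrite -ler_sqr ?nnegrE ?mulr_ge0 ?(ltW s0) ?(ltW b0)// exprMn.
apply: (@le_trans _ _ (3 * (b ^+ 2 / 3))); last by lra.
apply: ler_pM; rewrite ?sqr_ge0 ?sqr_sigma_le//.
by rewrite -(@sqr_sqrtr R 3)// ler_sqr ?nnegrE.
Qed.

(** Intermediate values for d (expR b - 1) - (b^2 + 2b) with d = 2 - y^2: it is at most 0 at b = y
    by [sqr_sigma_le], and cubic growth makes it nonnegative at [b1]. *)
Lemma exists_sigma y : 0 < y -> y ^+ 2 < 2 -> exists2 b, 0 < b & sigma b = y.
Proof.
move=> y0 y2; pose d := 2 - y ^+ 2; have d0 : 0 < d by rewrite subr_gt0.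
pose h b : R := d * (expR b - 1) - (b ^+ 2 + 2 * b).
(* d b1 = 18 makes the cubic Taylor term d b1^3 / 6 equal to 3 b1^2, and d <= 2 gives b1 >= 9, so it
   exceeds b1^2 + 2 b1. *)
pose b1 := 18 / d; have b10 : 0 < b1 by rewrite divr_gt0.
have hd (t : R) : is_derive t 1 h (d * expR t - (2 * t + 2)).
  by apply: is_derive_eq; rewrite /GRing.scale/=; ring.
have yy : 0 <= y ^+ 2 by rewrite sqr_ge0.
have b19 : 9 <= b1 by rewrite ler_pdivlMr// /d; lra.
have yb1 : y <= b1.
  have y22 : y < 2 by rewrite -ltr_sqr ?nnegrE ?(ltW y0)//; lra.
  lra.
have hy : h y <= 0.
  have := sqr_sigma_le y0; rewrite sqr_sigma// lerBlDr -lerBlDl ler_pdivlMr ?expR_gt1'//.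
  have e1 := expR_gt1' y0.
  move=> H; rewrite subr_le0; apply: le_trans _ H.
  by rewrite ler_wpM2r ?(ltW e1)// /d; lra.
have hb1 : 0 <= h b1.
  have T := expR_ge_taylor3 (ltW b10).
  have E : d * b1 = 18 by rewrite /b1 mulrC divfK// gt_eqF.
  have b12 : 0 <= b1 ^+ 2 by rewrite sqr_ge0.
  have H3 : 3 * b1 ^+ 2 <= d * (expR b1 - 1).
    have -> : 3 * b1 ^+ 2 = d * (b1 ^+ 3 / 6).
      have -> : d * (b1 ^+ 3 / 6) = (d * b1) * (b1 ^+ 2 / 6) by field.
      by rewrite E; field.
    by rewrite ler_pM2l//; lra.
  rewrite /h subr_ge0; apply: le_trans H3.
  have h9 : 9 * b1 <= b1 ^+ 2 by rewrite expr2 ler_wpM2r// ltW.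
  lra.
have [||c cyb hc] := @IVT R h y b1 0 yb1.
- exact/continuous_subspaceT/(is_derive_continuous hd).
- by rewrite ge_min hy/= le_max hb1 orbT.
have c0 : 0 < c by move: cyb; rewrite in_itv/= => /andP[+ _]; exact: lt_le_trans.
exists c => //; apply/eqP; rewrite -(eqrXn2 (n := 2))// ?(ltW y0) ?(ltW (sigma_gt0 c0))//.
rewrite sqr_sigma//; apply/eqP.
have e1 := expR_gt1' c0; move: hc; rewrite /h => /eqP; rewrite subr_eq0 => /eqP <-.
by rewrite mulfK ?gt_eqF// /d; lra.
Qed.

(** The quantity under the infimum in (a) without the indicator, which makes it monotone in t; the
    two agree on [0, sqrt 3]. *)
Definition phi_Y b t : R := sigma b * expR (- (sigma b * t)) / (2 * (1 - expR (- b))).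

Lemma phi_YE b t : 0 < b -> 0 <= t <= Num.sqrt 3 ->
  sigma b * f_Y b (t * sigma b) = phi_Y b t.
Proof.
move=> b0 /[dup] t03 /andP[t0 _]; have s0 := sigma_gt0 b0.
rewrite /f_Y indicE mem_set ?mulr1.
  by rewrite ger0_norm ?mulr_ge0 ?(ltW s0)// /phi_Y mulrA (mulrC t).
rewrite /= in_itv/= sigma_le// andbT.
apply: (@le_trans _ _ 0); first by rewrite oppr_le0 ltW.
by rewrite mulr_ge0 ?(ltW s0).
Qed.

(** The limit b -> 0. An upper estimate suffices, since it is only used against a lower bound of all
    [phi_Y b t]. *)
Lemma phi_Y_uniform t e : 0 <= t -> 0 < e ->
  exists2 b, 0 < b & phi_Y b t <= (2 * Num.sqrt 3)^-1 + e.
Proof.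
(* From sigma b <= b / sqrt 3 and 1 - expR(-b) >= b (1 - b), the claim reduces to (1 - b) (1 + 2 e
   sqrt 3) >= 1, which follows from b <= e and b <= 1/2. *)
move=> t0 e0; pose b := Num.min e 2^-1.
have b0 : 0 < b by rewrite lt_min e0 invr_gt0/=.
have be : b <= e by rewrite ge_min lexx.
have b2 : b <= 2^-1 by rewrite ge_min lexx orbT.
have s0 := sigma_gt0 b0; have d0 := onem_expRN b0.
have r3 : 0 < Num.sqrt 3 :> R by rewrite sqrtr_gt0.
have r31 : 1 <= Num.sqrt 3 :> R by rewrite -[X in X <= _]sqrtr1 ler_wsqrtr// ler1n.
exists b => //.
have sb : sigma b <= b / Num.sqrt 3.
  rewrite -ler_sqr ?nnegrE ?divr_ge0 ?(ltW s0) ?(ltW b0) ?(ltW r3)//.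
  have -> : (b / Num.sqrt 3) ^+ 2 = b ^+ 2 / 3 by rewrite exprMn exprVn sqr_sqrtr.
  exact: sqr_sigma_le.
have db : b * (1 - b) <= 1 - expR (- b).
  have -> : 1 - expR (- b) = (expR b - 1) * expR (- b).
    by rewrite onem_expRNE expRN.
  apply: ler_pM; rewrite ?(ltW b0)//; first by lra.
    by have := expR_ge1Dx b; lra.
  by have := expR_ge1Dx (- b); lra.
rewrite /phi_Y ler_pdivrMr; last by rewrite mulr_gt0.
apply: (@le_trans _ _ (b / Num.sqrt 3)).
  apply: le_trans sb; rewrite ler_piMr ?(ltW s0)// expR_le1 oppr_le0.
  by rewrite mulr_ge0// ltW.
apply: (@le_trans _ _ (((2 * Num.sqrt 3)^-1 + e) * (2 * (b * (1 - b))))); last first.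
  by rewrite ler_pM2l ?ler_pM2l// addr_gt0// invr_gt0 mulr_gt0.
have -> : ((2 * Num.sqrt 3)^-1 + e) * (2 * (b * (1 - b))) =
  b / Num.sqrt 3 * ((1 - b) * (1 + 2 * e * Num.sqrt 3)) by field; rewrite gt_eqF.
rewrite ler_peMr ?divr_ge0 ?(ltW b0) ?(ltW r3)//.
have h1 : 2 * b <= 2 * e * Num.sqrt 3.
  by rewrite -[leLHS]mulr1; apply: ler_pM => //; rewrite ?mulr_ge0 ?(ltW b0)// ler_pM2l.
have b1 : 0 <= 1 - b by lra.
apply: (@le_trans _ _ ((1 - b) * (1 + 2 * b))); last by rewrite ler_wpM2l// lerD2l.
have -> : (1 - b) * (1 + 2 * b) = 1 + b * (1 - 2 * b) by ring.
by rewrite lerDl mulr_ge0 ?(ltW b0)//; lra.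
Qed.

(** The limit b -> +oo, parametrised by y = sigma b, which tends to sqrt 2 from below. The
    normalising factor is bounded through y alone, so [phi_Y b t] is at most K y for a continuous K
    whose value at sqrt 2 is the Laplace bound. *)
Lemma phi_Y_laplace t e : 0 <= t -> 0 < e ->
  exists2 b, 0 < b & phi_Y b t <= (Num.sqrt 2)^-1 * expR (- (t * Num.sqrt 2)) + e.
Proof.
move=> t0 e0; pose a : R := Num.sqrt 2.
have a0 : 0 < a by rewrite sqrtr_gt0.
have a2 : a ^+ 2 = 2 by rewrite sqr_sqrtr.
pose K y : R := a / 2 * expR (- (y * t)) * (1 + (2 - y ^+ 2) / 4).
have Kd (y : R) : is_derive y 1 K (a / 2 * expR (- (y * t)) *
   (- t * (1 + (2 - y ^+ 2) / 4) - y / 2)).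
  by apply: is_derive_eq; rewrite /GRing.scale/=; field.
have Ka : K a = a^-1 * expR (- (t * a)).
  rewrite /K a2 subrr mul0r addr0 mulr1 (mulrC a t); congr (_ * _).
  by rewrite -a2; field; rewrite gt_eqF.
have cK : K y @[y --> a^'-] --> K a.
  by apply/cvg_at_left_filter; exact: (is_derive_continuous Kd).
(* Taking y above 4/3 forces b >= 2, because y^2 <= b^2 / 3. *)
have a43 : 4 / 3 < a by rewrite -ltr_sqr ?nnegrE ?(ltW a0)// a2; lra.
have [y [y1 ya Ky]] : exists y, [/\ 4 / 3 < y, y < a & K y < K a + e].
  near a^'- => y; exists y; split.
  - by near: y; exact: nbhs_left_gt.
  - by near: y; exact: nbhs_left_lt.
  - by near: y; apply: (cvgr_lt _ cK); rewrite ltrDl.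
have y0 : 0 < y by lra.
have y2 : y ^+ 2 < 2 by rewrite -a2 ltr_sqr ?nnegrE ?(ltW y0) ?(ltW a0).
have [b b0 sb] := exists_sigma y0 y2; exists b => //.
rewrite -/a -Ka; apply: le_trans (ltW Ky).
have e1 := expR_gt1' b0; have e2 := expR_gt0 b; have d0 := onem_expRN b0.
have b2 : 2 <= b.
  rewrite -ler_sqr ?nnegrE ?(ltW b0)//.
  have h1 := sqr_sigma_le b0; rewrite sb in h1.
  have h2 : (4 / 3) ^+ 2 < y ^+ 2 by rewrite ltr_sqr ?nnegrE ?(ltW y0).
  lra.
have E : (2 - y ^+ 2) * (expR b - 1) = b ^+ 2 + 2 * b.
  by rewrite -sb sqr_sigma//; field; rewrite gt_eqF.
(* By [E], the claim times expR b says (b^2 + 2b) / 4 >= 1, true for b >= 2. *)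
have H : 1 <= (1 + (2 - y ^+ 2) / 4) * (1 - expR (- b)).
  rewrite onem_expRNE mulrA ler_pdivlMr// mul1r.
  have -> : (1 + (2 - y ^+ 2) / 4) * (expR b - 1) =
    expR b - 1 + (2 - y ^+ 2) * (expR b - 1) / 4 by field.
  have b22 : 2 * 2 <= b ^+ 2 by rewrite expr2; apply: ler_pM.
  by rewrite E; lra.
rewrite /phi_Y sb ler_pdivrMr ?mulr_gt0// /K.
have -> : a / 2 * expR (- (y * t)) * (1 + (2 - y ^+ 2) / 4) * (2 * (1 - expR (- b))) =
  a * expR (- (y * t)) * ((1 + (2 - y ^+ 2) / 4) * (1 - expR (- b))) by field.
apply: (@le_trans _ _ (a * expR (- (y * t)))).
  by rewrite ler_wpM2r ?expR_ge0// ltW.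
by rewrite ler_peMr// mulr_ge0 ?expR_ge0// ltW.
Unshelve. all: by end_near. Qed.

(** With r = sigma b / sqrt 2 < 1 the claim becomes 1 - expR(-b) <= r expR(sqrt 2 t (1 - r)). The
    right side increases with t, so the worst case is t = 1 / sqrt 2; there the quadratic Taylor
    bound reduces it to [truncated_std_inequality]. *)
Lemma phi_Y_ge_laplace b t : 0 < b -> (Num.sqrt 2)^-1 <= t ->
  (Num.sqrt 2)^-1 * expR (- (t * Num.sqrt 2)) <= phi_Y b t.
Proof.
move=> b0; set a : R := Num.sqrt 2 => ta.
have a0 : 0 < a by rewrite sqrtr_gt0.
have a2 : a ^+ 2 = 2 by rewrite sqr_sqrtr.
have s0 := sigma_gt0 b0; have s2 := sqr_sigma_lt2 b0.
have e1 := expR_gt1' b0; have e2 := expR_gt0 b; have d0 := onem_expRN b0.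
pose r := sigma b / a.
have sr : sigma b = a * r by rewrite /r mulrC divfK// gt_eqF.
have r0 : 0 < r by rewrite divr_gt0.
have r1 : r < 1 by rewrite ltr_pdivrMr// mul1r -ltr_sqr ?nnegrE ?(ltW s0) ?(ltW a0)// a2.
have r2 : r ^+ 2 = sigma b ^+ 2 / 2 by rewrite sr [in RHS]exprMn a2; field.
have E : (1 - r ^+ 2) * (expR b - 1) = b ^+ 2 / 2 + b.
  by rewrite r2 sqr_sigma//; field; rewrite gt_eqF.
have r01 : 0 <= r < 1 by rewrite ltW.
have T := truncated_std_inequality b0 r01 E.
have r2' : 0 < 1 - r ^+ 2 by rewrite subr_gt0 expr_lt1// ltW.
have r1' : 0 < 1 - r by rewrite subr_gt0.
have key : 1 - expR (- b) <= r * expR (1 - r).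
  apply: (@le_trans _ _ (r * (1 + (1 - r) + (1 - r) ^+ 2 / 2))); last first.
    by rewrite ler_pM2l// expR_ge_taylor2// ltW.
  rewrite onem_expRNE ler_pdivrMr// -(ler_pM2l r2') -subr_ge0.
  have -> : (1 - r ^+ 2) * (r * (1 + (1 - r) + (1 - r) ^+ 2 / 2) * expR b) -
    (1 - r ^+ 2) * (expR b - 1) =
    (1 - r) / 2 * (2 * (1 + r) -
      (1 - r) * (2 - r) * (1 - r ^+ 2 + (1 - r ^+ 2) * (expR b - 1))) by field.
  by rewrite E mulr_ge0 ?divr_ge0 ?(ltW r1')// subr_ge0.
rewrite /phi_Y sr ler_pdivlMr ?mulr_gt0//.
have -> : a * r * expR (- (a * r * t)) =
    a * (r * expR (a * t * (1 - r))) * expR (- (t * a)).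
  have -> : expR (- (a * r * t)) = expR (a * t * (1 - r)) * expR (- (t * a)).
    by rewrite -expRD; congr expR; ring.
  by ring.
have -> : a^-1 * expR (- (t * a)) * (2 * (1 - expR (- b))) =
    a * (1 - expR (- b)) * expR (- (t * a)).
  by rewrite -a2; field; rewrite gt_eqF.
rewrite ler_wpM2r ?expR_ge0// ler_pM2l//; apply: le_trans key _.
rewrite ler_pM2l// ler_expR ler_peMl ?(ltW r1')//.
by rewrite -(@divff _ a) ?gt_eqF// ler_pM2l.
Qed.

End sigma_theory.

(** * The steep-slope inequality and the moments of the comparison densities *)

Section even_log_concave_theory.
Context {R : realType}.
Notation lam := (@lebesgue_measure R).
Notation D := (`[0%R, +oo[%classic : set R).

(** Here S = s L and x is the plateau length in units of 1 / s. The polynomial hypothesis is the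
    comparison of second moments, that is p = sqrt 3 S <= w; the last one says that L g(T) is below
    the Laplace value. The worst t is sqrt 3, and since p expR(-p) decreases for p >= 1, the worst p
    is w, where [plateau_inequality] decides. *)
Lemma plateau_contradiction (S x t : R) : Num.sqrt 2 <= S -> 0 <= x ->
  t <= Num.sqrt 3 -> S ^+ 2 * (1 + x) <= x ^+ 3 / 3 + x ^+ 2 + 2 * x + 2 ->
  S * expR x < Num.sqrt 2 * (1 + x) * expR ((S - Num.sqrt 2) * t) -> False.
Proof.
set a2 : R := Num.sqrt 2; set a3 : R := Num.sqrt 3 => S2 x0 t3 HS.
have a20 : 0 < a2 by rewrite sqrtr_gt0.
have a30 : 0 < a3 by rewrite sqrtr_gt0.
have a22 : a2 ^+ 2 = 2 by rewrite sqr_sqrtr.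
have a32 : a3 ^+ 2 = 3 by rewrite sqr_sqrtr.
have S0 : 0 < S by exact: lt_le_trans S2.
pose y := 1 + x; have y1 : 1 <= y by rewrite lerDl.
have y0 : 0 < y by exact: lt_le_trans y1.
pose w := Num.sqrt (y ^+ 2 + 3 + 2 / y).
have rad0 : 0 < y ^+ 2 + 3 + 2 / y by rewrite !addr_gt0 ?exprn_gt0 ?divr_gt0.
have w0 : 0 < w by rewrite sqrtr_gt0.
have w2 : w ^+ 2 = y ^+ 2 + 3 + 2 / y by rewrite sqr_sqrtr// ltW.
pose a := a3 * a2; have a0 : 0 < a by rewrite mulr_gt0.
have a6 : a ^+ 2 = 6 by rewrite exprMn a32 a22; ring.
have H := plateau_inequality a0 a6 w0 y1 w2.
pose p := a3 * S; have p0 : 0 < p by rewrite mulr_gt0.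
have ap : a <= p by rewrite ler_pM2l.
have a1 : 1 <= a by rewrite -ler_sqr ?nnegrE ?(ltW a0)// a6; lra.
have pw : p <= w.
  rewrite -ler_sqr ?nnegrE ?(ltW p0) ?(ltW w0)// exprMn a32 w2.
  rewrite -(ler_pM2r y0).
  have -> : (y ^+ 2 + 3 + 2 / y) * y = 3 * (x ^+ 3 / 3 + x ^+ 2 + 2 * x + 2).
    by rewrite /y; field; rewrite gt_eqF.
  by rewrite -mulrA ler_pM2l.
rewrite ltNge => /negP; apply.
apply: (@le_trans _ _ (a2 * y * expR (p - a))).
  rewrite -/y ler_wpM2l//; first by rewrite mulr_ge0 ?(ltW a20) ?(ltW y0).
  rewrite ler_expR /p /a -mulrBr mulrC.
  by rewrite ler_wpM2r ?subr_ge0.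
rewrite -(ler_pM2l a30).
have -> : a3 * (a2 * y * expR (p - a)) = a * y * expR (p - a) by rewrite /a; ring.
rewrite mulrA -/p; rewrite ler_pdivrMr// in H.
apply: (@le_trans _ _ (expR (a - 1 - w + y) * w * expR (p - a))).
  by rewrite ler_wpM2r// expR_ge0.
have -> : expR (a - 1 - w + y) * w * expR (p - a) = w * expR (p - w) * expR x.
  rewrite mulrAC -expRD mulrC -mulrA -expRD; congr (_ * expR _).
  by rewrite /y; ring.
rewrite ler_wpM2r ?expR_ge0//.
have -> : p - w = - (w - p) by ring.
rewrite expRN ler_pdivrMr ?expR_gt0//.
apply: (@le_trans _ _ (p * (1 + (w - p)))); last by rewrite ler_pM2l// expR_ge1Dx.
have -> : p * (1 + (w - p)) = w + (p - 1) * (w - p) by ring.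
by rewrite lerDl mulr_ge0// subr_ge0// (le_trans a1).
Qed.

Lemma integral_indic_itv (h : R -> R) (c : R) : 0 <= c -> measurable_fun setT h ->
  (\int[lam]_(t in D) (h t * \1_(`[0, c]) t)%:E = \int[lam]_(t in `[0%R, c]) (h t)%:E)%E.
Proof.
move=> c0 mh.
have -> : `[0, c]%classic = D `&` `[0, c].
  apply/seteqP; split => [t|t []//] /=; rewrite !in_itv/= andbT => /andP[t0 tc].
  by rewrite t0 tc.
rewrite integral_mkcondr; apply: eq_integral => t; rewrite inE /= => Dt.
rewrite patchE indicE in_setI mem_set//=.
by case: ifPn => _; rewrite ?mulr1 ?mulr0.
Qed.

Lemma measurable_fun_indic_itv (h : R -> R) (c : R) : measurable_fun setT h ->
  measurable_fun setT (fun t => h t * \1_(`[0, c]) t).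
Proof. by move=> mh; apply: measurable_funM => //; exact: measurable_indic. Qed.

Lemma integral_uniform_itv (k c : R) : 0 <= k -> 0 <= c ->
  (\int[lam]_(t in D) (k * \1_(`[0, c]) t)%:E = (k * c)%:E)%E /\
  (\int[lam]_(t in D) (t ^+ 2 * (k * \1_(`[0, c]) t))%:E = (k * (c ^+ 3 / 3))%:E)%E.
Proof.
move=> k0 c0; split.
  rewrite (integral_indic_itv (h := cst k))//.
  transitivity (\int[lam]_(t in `[0%R, c]) k%:E)%E => //.
  rewrite integral_cst//= lebesgue_measure_itv/= lte_fin EFinM.
  by case: ltP => h; rewrite -?EFinB ?subr0//; congr (_ * _%:E)%E; lra.
under eq_integral do rewrite mulrA.
rewrite (integral_indic_itv (h := fun t => t ^+ 2 * k))//; last first.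
  by apply: measurable_funM => //; exact: exprn_measurable.
under eq_integral do rewrite mulrC EFinM.
rewrite ge0_integralZl_EFin//.
- by rewrite integral_sqr_itv// -EFinM expr0n/= mul0r subr0.
- by move=> t _; rewrite lee_fin sqr_ge0.
- by apply/measurable_EFinP; apply: measurable_funTS; exact: exprn_measurable.
Qed.

Lemma integral_truncated_exp (k s c : R) : 0 <= k -> s != 0 -> 0 <= c ->
  (\int[lam]_(t in D) (k * expR (- (s * t)) * \1_(`[0, c]) t)%:E =
   (k * (exp_prim s c - exp_prim s 0))%:E)%E /\
  (\int[lam]_(t in D) (t ^+ 2 * (k * expR (- (s * t)) * \1_(`[0, c]) t))%:E =
   (k * (exp2_prim s c - exp2_prim s 0))%:E)%E.
Proof.
move=> k0 s0 c0.
have me : measurable_fun setT (fun t : R => expR (- (s * t))).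
  by apply: continuous_measurable_fun; exact: continuous_exp.
have me2 : measurable_fun setT (fun t : R => t ^+ 2 * expR (- (s * t))).
  by apply: continuous_measurable_fun; exact: continuous_exp2.
split.
  rewrite (integral_indic_itv (h := fun t => k * expR (- (s * t))))//;
    last exact: measurable_funM.
  under eq_integral do rewrite EFinM.
  rewrite ge0_integralZl_EFin; [|by []|by move=> t _; rewrite lee_fin expR_ge0| |by []].
    by rewrite integral_exp_itv.
  by apply/measurable_EFinP; exact: measurable_funTS.
under eq_integral do rewrite mulrA mulrCA.
rewrite (integral_indic_itv (h := fun t => k * (t ^+ 2 * expR (- (s * t)))))//;
  last exact: measurable_funM.
under eq_integral do rewrite EFinM.
rewrite ge0_integralZl_EFin; [|by []| | |by []].
- by rewrite integral_exp2_itv.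
- by move=> t _; rewrite lee_fin mulr_ge0 ?sqr_ge0 ?expR_ge0.
- by apply/measurable_EFinP; exact: measurable_funTS.
Qed.

Lemma integral_plateau (h : R -> R) (u : R) : 0 <= u -> measurable_fun setT h ->
  (forall t, 0 <= h t) ->
  (\int[lam]_(t in D) (h t)%:E =
   \int[lam]_(t in `[0%R, u]) (h t)%:E + \int[lam]_(t in `[u, +oo[) (h t)%:E)%E.
Proof.
move=> u0 mh h0.
have -> : D = `[0, u[ `|` `[u, +oo[.
  apply/seteqP; split => t /=; rewrite !in_itv/= !andbT.
    by move=> t0; case: (ltP t u) => tu; [left; rewrite t0|right].
  by case=> [/andP[]//|]; exact: le_trans.
rewrite ge0_integral_setU//.
- rewrite integral_itv_bndo_bndc//.
  by apply/measurable_EFinP; exact: measurable_funTS.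
- by apply/measurable_EFinP; exact: measurable_funTS.
- by move=> t _; rewrite lee_fin.
- apply/disj_setPS => t [] /=; rewrite !in_itv/= andbT => /andP[_ tu].
  by rewrite leNgt tu.
Qed.

(** The maximum encodes a plateau on [0, u] continued by the exponential; u = 0 gives the full
    exponential. *)
Lemma integral_plateau_exp (k s u : R) : 0 <= k -> 0 < s -> 0 <= u ->
  (\int[lam]_(t in D) (k * expR (- (s * Num.max u t)))%:E =
   (k * expR (- (s * u)) * (u + s^-1))%:E)%E /\
  (\int[lam]_(t in D) (t ^+ 2 * (k * expR (- (s * Num.max u t))))%:E =
   (k * expR (- (s * u)) * (u ^+ 3 / 3 + u ^+ 2 / s + 2 * u / s ^+ 2 + 2 / s ^+ 3))%:E)%E.
Proof.
move=> k0 s0 u0; have sn0 : s != 0 by rewrite gt_eqF.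
have mh : measurable_fun setT (fun t : R => k * expR (- (s * Num.max u t))).
  apply: measurable_funM => //; apply: measurableT_comp => //.
  apply: measurableT_comp => //; apply: measurable_funM => //.
  by apply: measurable_maxr.
have m2 : measurable_fun setT (fun t : R => t ^+ 2) by exact: exprn_measurable.
have h0 (t : R) : 0 <= k * expR (- (s * Num.max u t)) by rewrite mulr_ge0// expR_ge0.
have k1 : 0 <= k * expR (- (s * u)) by rewrite mulr_ge0// expR_ge0.
split.
  rewrite (integral_plateau u0)//.
  transitivity (\int[lam]_(t in `[0%R, u]) (k * expR (- (s * u)))%:E +
                \int[lam]_(t in `[u, +oo[) (k%:E * (expR (- (s * t)))%:E))%E.
    congr (_ + _)%E; apply: eq_integral => t; rewrite inE/= in_itv/= ?andbT.
      by move=> /andP[_ tu]; rewrite max_l.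
    by move=> tu; rewrite max_r// EFinM.
  rewrite integral_cst//= lebesgue_measure_itv/= lte_fin.
  rewrite ge0_integralZl_EFin; [|by []|by move=> t _; rewrite lee_fin expR_ge0| |by []];
    last first.
    apply/measurable_EFinP; apply: measurable_funTS.
    by apply: continuous_measurable_fun; exact: continuous_exp.
  rewrite integral_exp_itvy// /exp_prim opprK.
  have -> : (if (0 < u)%R then u%:E - 0%R%:E else 0)%E = u%:E.
    by case: ltP => h; rewrite -?EFinB ?subr0//; congr (_%:E); lra.
  by rewrite -!EFinM -EFinD; congr (_%:E); field.
rewrite (integral_plateau u0); last 2 first.
- exact: measurable_funM.
- by move=> t; rewrite mulr_ge0// sqr_ge0.
transitivity (\int[lam]_(t in `[0%R, u]) ((k * expR (- (s * u)))%:E * (t ^+ 2)%:E) +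
              \int[lam]_(t in `[u, +oo[) (k%:E * (t ^+ 2 * expR (- (s * t)))%:E))%E.
  congr (_ + _)%E; apply: eq_integral => t; rewrite inE/= in_itv/= ?andbT.
    by move=> /andP[_ tu]; rewrite max_l// mulrC EFinM.
  by move=> tu; rewrite max_r// -EFinM mulrCA.
rewrite ge0_integralZl_EFin; [|by []|by move=> t _; rewrite lee_fin sqr_ge0| |by []];
  last by apply/measurable_EFinP; exact: measurable_funTS.
rewrite ge0_integralZl_EFin; [|by []| | |by []]; last 2 first.
- by move=> t _; rewrite lee_fin mulr_ge0 ?sqr_ge0 ?expR_ge0.
- apply/measurable_EFinP; apply: measurable_funTS.
  by apply: continuous_measurable_fun; exact: continuous_exp2.
rewrite integral_exp2_itvy// /exp2_prim opprK integral_sqr_itv//.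
by rewrite -!EFinM -EFinD; congr (_%:E); field.
Qed.

End even_log_concave_theory.

(** * The lower bound for even log-concave densities *)

Section extremal_density.
Context {R : realType}.
Notation lam := (@lebesgue_measure R).
Notation D := (`[0%R, +oo[%classic : set R).
Variables (g : R -> R) (L : R).
Hypothesis glc : even_log_concave g.
Hypothesis L0 : 0 < L.
Hypothesis intg : (\int[lam]_t (g t)%:E = 1)%E.
Hypothesis intg2 : (\int[lam]_t (t ^+ 2 * g t)%:E = (L ^+ 2)%:E)%E.

Let mg : measurable_fun setT g. Proof. by case: glc. Qed.
Let g0 t : 0 <= g t. Proof. by case: glc. Qed.
Let gN t : g (- t) = g t. Proof. by case: glc. Qed.
Let gconc l s t : 0 < l < 1 -> g s `^ (1 - l) * g t `^ l <= g ((1 - l) * s + l * t).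
Proof. by case: glc => _ _ _; apply. Qed.

Let half_integral (x : \bar R) (r : R) : (r%:E = 2%:E * x)%E -> x = (r / 2)%:E.
Proof.
move=> h; have : ((2^-1)%:E * r%:E = (2^-1)%:E * (2%:E * x))%E by rewrite h.
by rewrite muleA -!EFinM mulVf// mul1e => <-; rewrite mulrC.
Qed.

Let intgD : (\int[lam]_(t in D) (g t)%:E = (1 / 2)%:E)%E.
Proof. by apply: half_integral; rewrite -ge0_integral_even. Qed.

Let intg2D : (\int[lam]_(t in D) (t ^+ 2 * g t)%:E = (L ^+ 2 / 2)%:E)%E.
Proof.
apply: half_integral; rewrite -intg2 (@ge0_integral_even _ (fun t => t ^+ 2 * g t))//.
- by apply: measurable_funM => //; exact: exprn_measurable.
- by move=> t; rewrite mulr_ge0// sqr_ge0.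
- by move=> t; rewrite gN sqrrN.
Qed.

(** The point s lies between -t and t, where g takes the same value; l is the corresponding
    weight. *)
Lemma even_log_concave_nonincreasing s t : 0 <= s <= t -> g t <= g s.
Proof.
move=> /andP[s0]; rewrite le_eqVlt => /predU1P[->//|st].
have [->|gt0] := eqVneq (g t) 0; first exact: g0.
have t0 : 0 < t by exact: le_lt_trans st.
pose l := (s + t) / (2 * t).
have l01 : 0 < l < 1.
  rewrite /l divr_gt0 ?ltr_pdivrMr ?mulr_gt0//; last by rewrite ltr_wpDl.
  by rewrite mul1r mulr_natl mulr2n ltrD2r.
have := gconc (- t) t l01; rewrite gN -powRD; last by rewrite gt0 implybT.
rewrite subrK powRr1//.
by have -> : (1 - l) * - t + l * t = s by rewrite /l; field; rewrite gt_eqF.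
Qed.

Let r3 : R := Num.sqrt 3.
Let r30 : 0 < r3. Proof. by rewrite sqrtr_gt0. Qed.
Let r32 : r3 ^+ 2 = 3. Proof. by rewrite sqr_sqrtr. Qed.

Let indic_ge0 (k c : R) : 0 <= k -> forall t, 0 <= k * \1_(`[0, c]) t.
Proof. by move=> k0 t; rewrite mulr_ge0. Qed.

Let indic_in (c t : R) : 0 <= t <= c -> \1_(`[0, c]) t = 1 :> R.
Proof. by move=> h; rewrite indicE mem_set//= in_itv. Qed.

Let indic_out (c t : R) : c < t -> \1_(`[0, c]) t = 0 :> R.
Proof. by move=> h; rewrite indicE memNset//= in_itv/= (leNgt t c) h andbF. Qed.

(** If g vanished at T, it would live on [-u, u] with u < sqrt 3 L. A nonincreasing profile there
    has at most the second moment u^2 / 3 of the uniform density, which is below L^2. The midpoint u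
    is positive even for T = 0. *)
Lemma even_log_concave_gt0 T : 0 <= T < r3 * L -> 0 < g T.
Proof.
move=> /andP[T0 T3]; rewrite lt_neqAle g0 andbT eq_sym; apply/eqP => gT.
pose u := (T + r3 * L) / 2.
have Tu : T <= u by rewrite /u; lra.
have u3 : u < r3 * L by rewrite /u; lra.
have u0 : 0 < u by rewrite /u; lra.
pose k := (2 * u)^-1; have k0 : 0 <= k by rewrite invr_ge0 mulr_ge0// ltW.
have [I1 I2] := integral_uniform_itv k0 (ltW u0).
have ku : k * u = 1 / 2 by rewrite /k; field; rewrite gt_eqF.
have : L ^+ 2 / 2 <= k * (u ^+ 3 / 3).
  apply: (@plateau_comparison _ g (fun t => k * \1_(`[0,
    u]) t) (1 / 2) _ _ _ _ _ _ intgD _ intg2D I2 u k) => //.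
  - exact: (measurable_fun_indic_itv (h := cst k)).
  - exact: indic_ge0.
  - by rewrite I1 ku.
  - exact: ltW.
  - exact: even_log_concave_nonincreasing.
  - by move=> t /andP[t0 tu]; rewrite indic_in ?mulr1// t0 ltW.
  - move=> t ut; apply: (@le_trans _ _ 0); last exact: indic_ge0.
    by rewrite -gT even_log_concave_nonincreasing// T0 (le_trans Tu).
have -> : k * (u ^+ 3 / 3) = u ^+ 2 / 6.
  by rewrite /k; field; rewrite gt_eqF.
have : u ^+ 2 < (r3 * L) ^+ 2.
  by rewrite ltr_sqr ?nnegrE ?(ltW u0)// mulr_ge0 ?(ltW r30) ?(ltW L0).
by rewrite [X in _ < X -> _]exprMn r32; lra.
Qed.

(** Without differentiability, s is the supremum of the chord slopes of -ln g on the left of T. By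
    concavity each is at most every chord slope on the right; the chord to T1 makes the supremum
    finite. For T = 0 the slope 0 works, since g is largest at 0. *)
Lemma log_slope T T1 : 0 <= T < T1 -> 0 < g T1 ->
  exists2 s, 0 <= s & forall t, 0 <= t -> g t <= g T * expR (- (s * (t - T))).
Proof.
move=> /andP[T0 TT1] gT1.
have gT : 0 < g T.
  by apply: lt_le_trans gT1 _; rewrite even_log_concave_nonincreasing// T0 ltW.
have [T00|Tn0] := eqVneq T 0.
  exists 0 => // t t0; rewrite mul0r oppr0 expR0 mulr1 T00.
  by rewrite even_log_concave_nonincreasing// lexx.
have {}T0 : 0 < T by rewrite lt_neqAle eq_sym Tn0.
have gpos t : 0 <= t < T -> 0 < g t.
  move=> /andP[t0 tT]; apply: lt_le_trans gT _.
  by rewrite even_log_concave_nonincreasing// t0 ltW.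
have three a b : 0 <= a < T -> T < b -> 0 < g b ->
    (ln (g a) - ln (g T)) / (T - a) <= (ln (g T) - ln (g b)) / (b - T).
  move=> /[dup] aT /andP[a0 aT'] Tb gb; have ga := gpos _ aT.
  have ba : 0 < b - a by rewrite subr_gt0 (lt_trans aT').
  pose l := (T - a) / (b - a).
  have l01 : 0 < l < 1.
    apply/andP; split; first by rewrite divr_gt0// subr_gt0.
    by rewrite ltr_pdivrMr// mul1r ltrD2r.
  have := gconc a b l01.
  have -> : (1 - l) * a + l * b = T by rewrite /l; field; rewrite gt_eqF.
  move=> h; have : ln (g a `^ (1 - l) * g b `^ l) <= ln (g T).
    by rewrite ler_ln ?posrE// mulr_gt0// powR_gt0.
  rewrite lnM ?posrE ?powR_gt0// !ln_powR => {}h.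
  rewrite ler_pdivrMr ?subr_gt0// mulrAC ler_pdivlMr ?subr_gt0//.
  have : ((1 - l) * ln (g a) + l * ln (g b)) * (b - a) <= ln (g T) * (b - a).
    by rewrite ler_wpM2r// ltW.
  have -> : ((1 - l) * ln (g a) + l * ln (g b)) * (b - a) =
    (b - T) * ln (g a) + (T - a) * ln (g b) by rewrite /l; field; rewrite gt_eqF.
  by move=> {}h; rewrite -subr_ge0; move: h; rewrite -subr_ge0; congr (_ <= _); ring.
pose S := [set (ln (g a) - ln (g T)) / (T - a) | a in [set a | 0 <= a < T]].
have S0 : S ((ln (g 0) - ln (g T)) / (T - 0)) by exists 0 => //=; rewrite lexx.
have supS : has_sup S.
  split; first by exists ((ln (g 0) - ln (g T)) / (T - 0)).
  by exists ((ln (g T) - ln (g T1)) / (T1 - T)) => _ [a aT <-]; exact: three.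
exists (sup S) => [|t t0].
  have g00 : 0 < g 0 by rewrite gpos// lexx.
  have gT0 : g T <= g 0 by rewrite even_log_concave_nonincreasing// lexx ltW.
  apply: le_trans (ub_le_sup supS.2 S0); apply: divr_ge0; last by rewrite subr0 ltW.
  by rewrite subr_ge0 ler_ln.
have [tT|Tt|->] := ltgtP t T; last by rewrite subrr mulr0 oppr0 expR0 mulr1.
  have gt : 0 < g t by rewrite gpos// t0.
  have := ub_le_sup supS.2 (_ : S ((ln (g t) - ln (g T)) / (T - t))).
  rewrite ler_pdivrMr ?subr_gt0// => H.
  rewrite -[leLHS]lnK ?posrE// -[X in X * _]lnK ?posrE// -expRD ler_expR.
  have {}H := H (ex_intro2 _ _ t (introT andP (conj t0 tT)) erefl).
  lra.
have [->|gt0] := eqVneq (g t) 0; first by rewrite mulr_ge0 ?expR_ge0.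
have gt : 0 < g t by rewrite lt_neqAle eq_sym gt0 g0.
have : sup S <= (ln (g T) - ln (g t)) / (t - T).
  apply: sup_le_ub; first by exists ((ln (g 0) - ln (g T)) / (T - 0)).
  by move=> _ [a aT <-]; exact: three.
rewrite ler_pdivlMr ?subr_gt0// => H.
rewrite -[leLHS]lnK ?posrE// -[X in X * _]lnK ?posrE// -expRD ler_expR.
lra.
Qed.

(** * The three ranges of the slope *)

Section slope.
Variables (t0 s : R).
Let T := t0 * L.
Let v := g T.
Hypothesis gT : 0 < g T.
Hypothesis slope : forall t, 0 <= t -> g t <= g T * expR (- (s * (t - T))).

Lemma flat_slope_bound : s = 0 -> (2 * r3)^-1 <= L * g T.
Proof.
(* The uniform density on [-c, c] has second moment c^2 / 3 = L^2. *)
move=> s0; pose c := r3 * L; have c0 : 0 < c by rewrite mulr_gt0.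
pose k := (2 * c)^-1; have k0 : 0 < k by rewrite invr_gt0 mulr_gt0.
have [I1 I2] := integral_uniform_itv (ltW k0) (ltW c0).
have kc : k * c = 1 / 2 by rewrite /k; field; rewrite gt_eqF.
have kc3 : k * (c ^+ 3 / 3) = L ^+ 2 / 2.
  have -> : k * (c ^+ 3 / 3) = c ^+ 2 / 6 by rewrite /k; field; rewrite gt_eqF.
  by rewrite /c exprMn r32; field.
have : 1 <= g T / k.
  apply: (@truncated_comparison _ g (fun t => k * \1_(`[0,
    c]) t) (1 / 2) _ _ _ _ _ _ intgD _ intg2D I2 _ c) => //.
  - exact: (measurable_fun_indic_itv (h := cst k)).
  - exact/indic_ge0/ltW.
  - by rewrite I1 kc.
  - move=> t /[dup] tc /andP[t0' _]; rewrite indic_in// mulr1 divfK ?gt_eqF//.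
    by have := slope t0'; rewrite s0 mul0r oppr0 expR0 mulr1.
  - by move=> t ct; rewrite indic_out ?mulr0.
  - exact: ltW.
  - rewrite kc3 /c exprMn r32; have : 0 < L ^+ 2 by rewrite exprn_gt0.
    lra.
rewrite ler_pdivlMr// mul1r => H.
have -> : (2 * r3)^-1 = L * k by rewrite /k /c; field; rewrite !gt_eqF.
by rewrite ler_pM2l.
Qed.

Lemma moderate_slope_bound : 0 < s -> (s * L) ^+ 2 < 2 ->
  exists2 b, 0 < b & phi_Y b t0 <= L * g T.
Proof.
move=> s0 sL2; have sL0 : 0 < s * L by rewrite mulr_gt0.
have [b b0 sb] := exists_sigma sL0 sL2; exists b => //.
have sn0 : s != 0 by rewrite gt_eqF.
have e1 : 0 < expR b - 1 by rewrite subr_gt0 expR_gt1.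
have eb := expR_gt0 b.
pose d := 1 - expR (- b); have d0 : 0 < d by rewrite subr_gt0 expR_lt1 oppr_lt0.
have dE : d = (expR b - 1) / expR b by rewrite /d expRN; field; rewrite gt_eqF.
(* [f_Y b] rescaled to rate s is cut at b / s and has second moment (sigma b / s)^2 = L^2. *)
pose c := b / s; have c0 : 0 < c by rewrite divr_gt0.
have sc : s * c = b by rewrite /c mulrC divfK.
pose k := s / (2 * d); have k0 : 0 < k by rewrite divr_gt0 ?mulr_gt0.
have [I1 I2] := integral_truncated_exp (ltW k0) sn0 (ltW c0).
have M1 : k * (exp_prim s c - exp_prim s 0) = 1 / 2.
  rewrite /exp_prim sc mulr0 oppr0 expR0 /k.
  have -> : expR (- b) = 1 - d by rewrite /d; ring.
  by field; rewrite sn0 gt_eqF.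
have M2 : k * (exp2_prim s c - exp2_prim s 0) = L ^+ 2 / 2.
  have -> : L ^+ 2 = sigma b ^+ 2 / s ^+ 2 by rewrite sb exprMn; field.
  rewrite sqr_sigma// /exp2_prim sc (mulr0 s) oppr0 expR0 expRN /k dE /c.
  by field; rewrite sn0 !gt_eqF.
(* The ratio of the supporting exponential to the normalised one on [0, c]; that it is at least 1 is
   the bound sought, up to rewriting. *)
have H : 1 <= g T * expR (s * T) / k.
  apply: (@truncated_comparison _ g (fun t => k * expR (- (s * t)) * \1_(`[0,
    c]) t) (1 / 2) _ _ _ _ _ _ intgD _ intg2D I2 _ c) => //.
  - apply: (measurable_fun_indic_itv (h := fun t => k * expR (- (s * t)))).
    by apply: measurable_funM => //; apply: continuous_measurable_fun;
      exact: continuous_exp.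
  - by move=> t; rewrite mulr_ge0// mulr_ge0 ?expR_ge0// ltW.
  - by rewrite I1 M1.
  - move=> t /[dup] tc /andP[t0' _]; rewrite indic_in// mulr1 mulrA divfK ?gt_eqF//.
    rewrite -mulrA -expRD; apply: le_trans (slope t0') _.
    by rewrite ler_pM2l// ler_expR; lra.
  - by move=> t ct; rewrite indic_out ?mulr0.
  - exact: ltW.
  - rewrite M2; have -> : L ^+ 2 / 2 = sigma b ^+ 2 / s ^+ 2 / 2.
      by rewrite sb exprMn; field.
    have -> : c ^+ 2 * (1 / 2) = b ^+ 2 / s ^+ 2 / 2 by rewrite /c; field.
    rewrite !ltr_pM2r ?invr_gt0 ?exprn_gt0//.
    have h1 := sqr_sigma_le b0; have h2 : 0 < b ^+ 2 by rewrite exprn_gt0.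
    lra.
rewrite ler_pdivlMr// mul1r in H.
have -> : phi_Y b t0 = L * (k * expR (- (s * T))).
  rewrite /phi_Y sb -/d /k /T.
  have -> : s * L * t0 = s * (t0 * L) by ring.
  by field; rewrite gt_eqF.
rewrite ler_pM2l// -(ler_pM2r (expR_gt0 (s * T))) -mulrA -expRD addNr expR0 mulr1.
exact: H.
Qed.

(** The supporting exponential G expR(-st) is kept beyond u and flattened on [0, u], where u is
    chosen to make the half-line mass 1/2. The result has at least the second moment of g, which is
    incompatible with a small g(T). *)
Lemma steep_slope_bound : 0 < s -> 2 <= (s * L) ^+ 2 -> t0 <= r3 ->
  (Num.sqrt 2)^-1 * expR (- (t0 * Num.sqrt 2)) <= L * g T.
Proof.
move=> s0 sL2 t03; set a : R := Num.sqrt 2.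
have sn0 : s != 0 by rewrite gt_eqF.
have sL0 : 0 < s * L by rewrite mulr_gt0.
have a0 : 0 < a by rewrite sqrtr_gt0.
have a2 : a ^+ 2 = 2 by rewrite sqr_sqrtr.
rewrite leNgt; apply/negP => H.
pose G := g T * expR (s * T); have G0 : 0 < G by rewrite mulr_gt0 ?expR_gt0.
have slopeG t : 0 <= t -> g t <= G * expR (- (s * t)).
  move=> t0'; apply: le_trans (slope t0') _.
  by rewrite /G -mulrA -expRD ler_pM2l// ler_expR; lra.
(* The exponential dominates g, so its half-line mass G / s is at least 1/2. *)
have sG : s <= 2 * G.
  have [I1 _] := integral_plateau_exp (ltW G0) s0 (lexx 0).
  have : ((1 / 2)%:E <= (G * expR (- (s * 0)) * (0 + s^-1))%:E)%E.
    rewrite -intgD -I1; apply: ge0_le_integral => //.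
    - by move=> t _; rewrite lee_fin.
    - by apply/measurable_EFinP; exact: measurable_funTS.
    - apply/measurable_EFinP; apply: measurable_funTS.
      apply: measurable_funM => //; apply: measurableT_comp => //.
      apply: measurableT_comp => //; apply: measurable_funM => //.
      by apply: measurable_maxr.
    - move=> t /=; rewrite in_itv/= andbT => t0'; rewrite lee_fin.
      by rewrite max_r// slopeG.
  rewrite lee_fin mulr0 oppr0 expR0 mulr1 add0r ler_pdivlMr// => h; lra.
(* For u = x / s the plateau profile has mass 1/2 exactly when p x = (1 + x) expR(-x) equals y,
   which lies in ]0, 1]. *)
pose y := s / (2 * G); have y0 : 0 < y by rewrite divr_gt0// mulr_gt0.
have G20 : 0 < 2 * G by rewrite mulr_gt0.
have y1 : y <= 1 by rewrite /y ler_pdivrMr // mul1r.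
pose p (x : R) := (1 + x) * expR (- x).
have pd (x : R) : is_derive x 1 p (- x * expR (- x)).
  by apply: is_derive_eq; rewrite /GRing.scale/=; ring.
have z0 : 0 <= 2 / y by rewrite divr_ge0 ?(ltW y0).
have p0 : p 0 = 1 by rewrite /p oppr0 expR0 addr0 mulr1.
(* The quadratic Taylor bound at 2 / y is just enough to bring p below y, which closes the interval
   for the intermediate value. *)
have pz : p (2 / y) <= y.
  rewrite /p expRN ler_pdivrMr ?expR_gt0//.
  apply: (@le_trans _ _ (y * (1 + 2 / y + (2 / y) ^+ 2 / 2))); last first.
    by rewrite ler_pM2l// expR_ge_taylor2.
  rewrite -subr_ge0.
  have -> : y * (1 + 2 / y + (2 / y) ^+ 2 / 2) - (1 + 2 / y) = y + 1.
    by field; rewrite gt_eqF.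
  by rewrite addr_ge0// ltW.
have [||x xz px] := @IVT R p 0 (2 / y) y z0.
- exact/continuous_subspaceT/(is_derive_continuous pd).
- by rewrite p0 ge_min pz orbT le_max y1.
have x0 : 0 <= x by move: xz; rewrite in_itv/= => /andP[].
pose u := x / s; have u0 : 0 <= u by rewrite divr_ge0// ltW.
have su : s * u = x by rewrite /u mulrC divfK.
have x1 : 0 < 1 + x by rewrite ltr_wpDr.
have [I1 I2] := integral_plateau_exp (ltW G0) s0 u0.
have ex : expR (- x) = s / (2 * G) / (1 + x) by rewrite -/y -px /p mulrAC divff
  ?mul1r// gt_eqF.
have M1 : G * expR (- (s * u)) * (u + s^-1) = 1 / 2.
  by rewrite su ex /u; field; rewrite sn0 !gt_eqF.
have : L ^+ 2 / 2 <= G * expR (- (s * u)) *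
    (u ^+ 3 / 3 + u ^+ 2 / s + 2 * u / s ^+ 2 + 2 / s ^+ 3).
  apply: (@plateau_comparison _ g (fun t => G * expR (- (s * Num.max u t))) (1 / 2) _
    _ _ _ _ _ intgD _ intg2D I2 u (G * expR (- (s * u)))) => //.
  - apply: measurable_funM => //; apply: measurableT_comp => //.
    apply: measurableT_comp => //; apply: measurable_funM => //.
    by apply: measurable_maxr.
  - by move=> t; rewrite mulr_ge0 ?expR_ge0// ltW.
  - by rewrite I1 M1.
  - exact: even_log_concave_nonincreasing.
  - by move=> t /andP[_ tu]; rewrite max_l// ltW.
  - by move=> t ut; rewrite max_r// slopeG// (le_trans u0).
have -> : G * expR (- (s * u)) *
    (u ^+ 3 / 3 + u ^+ 2 / s + 2 * u / s ^+ 2 + 2 / s ^+ 3) =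
    (x ^+ 3 / 3 + x ^+ 2 + 2 * x + 2) / (2 * s ^+ 2 * (1 + x)).
  by rewrite su ex /u; field; rewrite sn0 !gt_eqF.
rewrite ler_pdivlMr ?mulr_gt0 ?exprn_gt0// => HV.
have asL : a <= s * L by rewrite -ler_sqr ?nnegrE ?(ltW a0) ?(ltW sL0)// a2.
apply: (plateau_contradiction asL x0 t03).
  by apply: le_trans HV; rewrite exprMn [leLHS](_ : _ = L ^+ 2 / 2 * (2 * s ^+ 2 * (1
    + x)))//; field.
have ex' : s = 2 * G * ((1 + x) * expR (- x)) by rewrite -/(p x) px /y; field;
  rewrite gt_eqF.
rewrite [X in X * L * _]ex'.
have -> : 2 * G * ((1 + x) * expR (- x)) * L * expR x =
    (1 + x) * (2 * (L * G)) * (expR (- x) * expR x) by ring.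
rewrite -expRD addNr expR0 mulr1.
have -> : a * (1 + x) * expR ((s * L - a) * t0) = (1 + x) * (a * expR ((s * L - a) *
  t0)) by ring.
rewrite ltr_pM2l//.
have -> : L * G = L * g T * expR (s * T) by rewrite /G mulrA.
have -> : (s * L - a) * t0 = - (t0 * a) + s * T by rewrite /T; ring.
rewrite expRD !mulrA ltr_pM2r ?expR_gt0//.
have -> : a * expR (- (t0 * a)) = 2 * (a^-1 * expR (- (t0 * a))).
  by rewrite -a2; field; rewrite gt_eqF.
by rewrite -mulrA ltr_pM2l.
Qed.

End slope.

(* The extremal densities [phi_Y b], together with their limits for [b -> 0]
   (uniform) and [b -> +oo] (Laplace), are selected by the slope of [ln g]. *)
Lemma even_log_concave_lower_bound A t0 : 0 <= t0 < r3 ->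
  (forall b, 0 < b -> A <= phi_Y b t0) -> A <= L * g (t0 * L).
Proof.
move=> /andP[t00 t03] HA.
have T0 : 0 <= t0 * L by rewrite mulr_ge0// ltW.
have T3 : t0 * L < r3 * L by rewrite ltr_pM2r.
have gT : 0 < g (t0 * L) by rewrite even_log_concave_gt0// T0.
(* A point beyond the height where g is still positive, as [log_slope] requires. *)
pose T1 := (t0 * L + r3 * L) / 2.
have TT1 : 0 <= t0 * L < T1 by rewrite T0/= /T1; lra.
have gT1 : 0 < g T1.
  rewrite even_log_concave_gt0//; case/andP: TT1 => _ h.
  by rewrite (le_trans T0 (ltW h))/= /T1; lra.
have [s s0 sP] := log_slope TT1 gT1.
move: s0; rewrite le_eqVlt => /predU1P[s0|s0].
  apply: le_trans (flat_slope_bound sP (esym s0)).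
  apply/ler_addgt0Pr => e e0; have [b b0 hb] := phi_Y_uniform t00 e0.
  exact: le_trans (HA _ b0) hb.
have [sL|sL] := ltP ((s * L) ^+ 2) 2.
  by have [b b0] := moderate_slope_bound gT sP s0 sL; exact/le_trans/HA.
apply: le_trans (steep_slope_bound gT sP s0 sL (ltW t03)).
apply/ler_addgt0Pr => e e0; have [b b0 hb] := phi_Y_laplace t00 e0.
exact: le_trans (HA _ b0) hb.
Qed.

End extremal_density.

(** * The standard deviation of the truncated Laplace law *)

Section truncated_laplace_variance.
Context {R : realType}.
Notation lam := (@lebesgue_measure R).

Lemma ge0_integral_opp (f : R -> \bar R) : measurable_fun setT f ->
  (forall x, (0 <= f x)%E) -> (\int[lam]_x f (- x)%R = \int[lam]_x f x)%E.
Proof.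
move=> mf f0.
have mphi : measurable_fun setT (-%R : R -> measurableTypeR R) by exact: oppr_measurable.
transitivity (\int[pushforward lam (-%R : R -> measurableTypeR R)]_x f x)%E.
  by rewrite ge0_integral_pushforward.
by apply: eq_measure_integral => A mA _; exact: lebesgue_measureN.
Qed.

(** The density is only known through the probabilities of sets, so h(X) is decomposed into
    superlevel sets by the layer-cake formula, and Tonelli reassembles h against f. *)
Lemma ge0_expectation_density d (T : measurableType d) (P : probability T R)
    (X : {RV P >-> R}) (f h : R -> R) : has_density P X f ->
  measurable_fun setT f -> (forall x, 0 <= f x) ->
  measurable_fun setT h -> (forall x, 0 <= h x) ->
  (\int[P]_w (h (X w))%:E = \int[lam]_x (f x * h x)%:E)%E.
Proof.
move=> XP mf f0 mh h0; pose GR := measurableTypeR R.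
have mlev c : measurable [set x | c < h x].
  rewrite -[X in measurable X]setTI.
  have : measurable_fun setT (fun x => c < h x) by exact: measurable_fun_ltr.
  by move=> /(_ measurableT [set true]); exact.
rewrite ge0_layer_cake//; last exact: measurableT_comp.
pose F (z : GR * GR) : \bar R :=
  ((f z.2) * \1_[set z : GR * GR | 0 < (z.1 : R) < h z.2] z)%:E.
have mS : measurable [set z : GR * GR | 0 < (z.1 : R) < h z.2].
  rewrite (_ : [set _ | _] = [set z | 0 < (z.1 : R)] `&` [set z | (z.1 : R) < h z.2]);
    last first.
    by apply/seteqP; split => z /= => [/andP[]|[-> ->]].
  apply: measurableI; rewrite -[X in measurable X]setTI.
    have : measurable_fun setT (fun z : GR * GR => 0 < (z.1 : R)).
      by apply: measurable_fun_ltr => //; exact: measurable_fst.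
    by move=> /(_ measurableT [set true]); exact.
  have : measurable_fun setT (fun z : GR * GR => (z.1 : R) < h z.2).
    apply: measurable_fun_ltr; first exact: measurable_fst.
    exact: (measurableT_comp (mh : measurable_fun [set: GR] h) measurable_snd).
  by move=> /(_ measurableT [set true]); exact.
have mF : measurable_fun setT F.
  apply/measurable_EFinP; apply: measurable_funM; last exact: measurable_indic.
  exact: (measurableT_comp (mf : measurable_fun [set: GR] f) measurable_snd).
have F0 z : (0 <= F z)%E by rewrite lee_fin mulr_ge0.
transitivity (\int[lam]_c \int[lam]_x F (c, x))%E.
  rewrite integral_mkcond; apply: eq_integral => c _.
  have cE : (c \in `]0, +oo[%classic) = (0 < (c : R)).
    by apply/idP/idP; rewrite inE/= in_itv/= andbT.
  rewrite patchE cE; case: ifPn => c0; last first.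
    rewrite [RHS]integral0_eq// => x _; rewrite /F indicE memNset ?mulr0//=.
    by move=> /andP[h1 _]; rewrite h1 in c0.
  transitivity (distribution P X [set x | (c : R) < h x]) => //.
  rewrite XP// integral_mkcond; apply: eq_integral => x _; rewrite patchE /F/= indicE.
  have -> : ((c, x) \in [set z : GR * GR | 0 < (z.1 : R) < h z.2]) =
    (x \in [set x | (c : R) < h x]) by apply/idP/idP; rewrite !inE/= c0.
  by case: ifPn => _; rewrite ?mulr1 ?mulr0.
rewrite (fubini_tonelli F)//; apply: eq_integral => x _.
transitivity (\int[lam]_c ((f x)%:E * (\1_`]0, h x[%classic c)%:E))%E.
  apply: eq_integral => c _; rewrite /F/= -EFinM !indicE.
  have -> // : ((c, x) \in [set z : GR * GR | 0 < (z.1 : R) < h z.2]) =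
    (c \in `]0, h x[%classic) by apply/idP/idP; rewrite !inE/= ?in_itv.
rewrite ge0_integralZl_EFin; [|by []|by move=> c _; rewrite lee_fin| |by []]; last first.
  by apply/measurable_EFinP; exact: measurable_indic.
rewrite integral_indic// setIT EFinM; congr (_ * _)%E.
transitivity (lam `]0, h x[%classic) => //.
rewrite lebesgue_measure_itv/= lte_fin.
by case: ltP => [_|hx]; rewrite ?oppr0 ?adde0//; congr (_%:E); apply/eqP;
  rewrite eq_le hx h0.
Qed.

Lemma measurable_f_Y (b : R) : measurable_fun setT (f_Y b).
Proof.
rewrite /f_Y; apply: measurable_funM; last exact: measurable_indic.
apply: measurable_funM => //; apply: measurableT_comp => //.
by apply: measurableT_comp => //; exact: normr_measurable.
Qed.

Lemma f_Y_ge0 (b t : R) : 0 < b -> 0 <= f_Y b t.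
Proof.
move=> b0; rewrite /f_Y mulr_ge0// divr_ge0 ?expR_ge0// mulr_ge0//.
by rewrite subr_ge0 expR_le1 oppr_le0 ltW.
Qed.

Lemma f_YN (b t : R) : f_Y b (- t) = f_Y b t.
Proof.
rewrite /f_Y normrN !indicE; congr (_ * _%:R).
suff -> : (- t \in `[- b, b]%classic) = (t \in `[- b, b]%classic) by [].
by apply/idP/idP; rewrite !inE/= !in_itv/= lerN2 [- t <= b]lerNl andbC.
Qed.

(** By symmetry of [f_Y b] the positive and negative parts of X have the same integral, so the mean
    is 0 and the variance is twice the second moment over [0, b]. *)
Lemma std_dev_truncated_laplace d (T : measurableType d) (P : probability T R)
    (X : {RV P >-> R}) (b : R) : 0 < b -> has_density P X (f_Y b) ->
  std_dev P X = sigma b.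
Proof.
move=> b0 XP.
have fb0 t := f_Y_ge0 t b0.
have mfb := measurable_f_Y b.
have mmax (u : R -> R) : measurable_fun setT u -> measurable_fun setT (fun x =>
  Num.max (u x) 0).
  by move=> mu; apply: measurable_maxr.
have mean0 : fine 'E_P[X] = 0.
  rewrite expectation_def integralE.
  have -> : (\int[P]_w ((fun w => (X w)%:E)^\+ w) = \int[lam]_x (f_Y b x * Num.max x
    0)%:E)%E.
    rewrite -(ge0_expectation_density XP (h := fun x => Num.max x 0))//.
    - by apply: eq_integral => w _; rewrite funeposE -EFin_max.
    - exact: mmax.
    - by move=> x; rewrite le_max lexx orbT.
  have -> : (\int[P]_w ((fun w => (X w)%:E)^\- w) = \int[lam]_x (f_Y b x * Num.max x
    0)%:E)%E.
    rewrite -(@ge0_integral_opp (fun x => (f_Y b x * Num.max x 0)%:E)).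
    - under [RHS]eq_integral do rewrite f_YN.
      rewrite -(ge0_expectation_density XP (h := fun x => Num.max (- x) 0))//.
      + by apply: eq_integral => w _; rewrite funenegE -EFinN -EFin_max.
      + exact: mmax.
      + by move=> x; rewrite le_max lexx orbT.
    - by apply/measurable_EFinP; apply: measurable_funM => //; exact: mmax.
    - by move=> x; rewrite lee_fin mulr_ge0// le_max lexx orbT.
  (* For an infinite common value the difference is infinite and [fine] returns 0 too, so finiteness
     need not be checked. *)
  case: (\int[lam]_x _)%E => [r| |]//=.
  by rewrite subrr.
have -> : std_dev P X = Num.sqrt (fine (\int[lam]_x (f_Y b x * x ^+ 2)%:E)%E).
  rewrite -(ge0_expectation_density XP (h := fun x => x ^+ 2))//; last first.
    by move=> x; rewrite sqr_ge0.
  rewrite /std_dev /variance covariance.unlock mean0 unlock.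
  by congr (Num.sqrt (fine _)); apply: eq_integral => w _;
    rewrite -[LHS]/(((X w - 0) * (X w - 0))%:E) subr0 expr2.
have e1 : 0 < expR b - 1 by rewrite subr_gt0 expR_gt1.
have eb := expR_gt0 b.
pose d0 := 1 - expR (- b).
have d00 : 0 < d0 by rewrite subr_gt0 expR_lt1 oppr_lt0.
have dE : d0 = (expR b - 1) / expR b by rewrite /d0 expRN; field; rewrite gt_eqF.
pose k := (2 * d0)^-1; have k0 : 0 < k by rewrite invr_gt0 mulr_gt0.
rewrite ge0_integral_even; last 3 first.
- by apply: measurable_funM => //; exact: (measurable_funX 2 (@measurable_id _ _ setT)).
- by move=> x; rewrite mulr_ge0// sqr_ge0.
- by move=> x; rewrite f_YN sqrrN.
have [_ I2] := integral_truncated_exp (ltW k0) (oner_neq0 R) (ltW b0).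
have -> : (\int[lam]_(x in `[0%R, +oo[) (f_Y b x * x ^+ 2)%:E =
  \int[lam]_(t in `[0%R, +oo[) (t ^+ 2 * (k * expR (- (1 * t)) * \1_(`[0, b]) t))%:E)%E.
  apply: eq_integral => t; rewrite inE/= in_itv/= andbT => t0; congr (_%:E).
  rewrite /f_Y mul1r ger0_norm// mulrC; congr (_ * _).
  rewrite (mulrC k) !indicE; congr (_ * _%:R).
  suff -> : (t \in `[- b, b]%classic) = (t \in `[0, b]%classic) by [].
  apply/idP/idP; rewrite !inE/= !in_itv/= t0/=; first by move=> /andP[].
  by move=> ->; rewrite andbT (le_trans _ t0)// oppr_le0 ltW.
rewrite I2 -EFinM/= -[RHS]ger0_norm ?(ltW (sigma_gt0 b0))// -sqrtr_sqr sqr_sigma//.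
congr Num.sqrt; rewrite /exp2_prim !mulr0 ?oppr0 !mul1r ?expR0 !expRN /k dE.
by field; rewrite !gt_eqF.
Qed.

End truncated_laplace_variance.

(** * Bounds for hyperplane sections *)

Section section_bounds.
Context {R : realType}.
Let r3 : R := Num.sqrt 3.

Lemma phi_Y_nonincreasing (b s t : R) : 0 < b -> s <= t -> phi_Y b t <= phi_Y b s.
Proof.
move=> b0 st; have s0 := sigma_gt0 b0.
have d0 : 0 < 2 * (1 - expR (- b)) by rewrite mulr_gt0// subr_gt0 expR_lt1 oppr_lt0.
rewrite /phi_Y ler_pM2r ?invr_gt0// ler_pM2l// ler_expR lerN2.
by rewrite ler_pM2l.
Qed.

Lemma hyperplane_vol_ge d (K H : set 'rV[R]_d) (L t0 A : R) :
  isotropic K L -> hyperplane H -> dist0 H = t0 * L -> 0 <= t0 <= r3 ->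
  (forall b, 0 < b -> A <= phi_Y b t0) ->
  ((L^-1 * A)%:E <= hyperplane_vol H (K `&` H))%E.
Proof.
move=> isoK hH distH /andP[t00 t03] HA.
have L0 : 0 < L by case: isoK.
have [g [gc g1 g2 usc ->]] := hyperplane_section isoK hH distH.
rewrite lee_fin.
have key t : 0 <= t < r3 -> (forall b, 0 < b -> A <= phi_Y b t) -> L^-1 * A <= g (t * L).
  move=> ht Ht; rewrite ler_pdivrMl//.
  exact: (even_log_concave_lower_bound gc L0 g1 g2).
have [t0r|t0r] := ltP t0 r3; first by apply: key => //; rewrite t00.
have r30 : 0 < r3 by rewrite sqrtr_gt0.
have -> : t0 = r3 by apply/eqP; rewrite eq_le t03.
(* These heights start at 0 and stay below sqrt 3 L; since [phi_Y b] decreases, the bound assumed at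
   sqrt 3 holds at each of them. *)
apply: (usc _ _ (fun k => (r3 - r3 * k.+1%:R^-1) * L)) => [|k].
  apply: cvgMr_tmp; rewrite -[X in _ --> X]subr0; apply: cvgB; first exact: cvg_cst.
  rewrite -[X in _ --> X](mulr0 r3); apply: cvgMl_tmp; exact: cvg_harmonic.
have k0 : 0 < k.+1%:R^-1 :> R by rewrite invr_gt0.
have k1 : k.+1%:R^-1 <= 1 :> R by rewrite invf_le1// ler1n.
apply: key => [|b b0].
  by rewrite ltrBlDr ltrDl mulr_gt0// andbT subr_ge0 ler_piMr// ltW.
by apply: (le_trans (HA b b0)); apply: phi_Y_nonincreasing;
  rewrite // lerBlDr ler_wpDr// mulr_ge0// ltW.
Qed.

(** The bound on t is the solution of phi_Y b t = 1 / (2 sqrt 3), and [c0] is the infimum of these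
    solutions over b. *)
Lemma phi_Y_ge_uniform (b t : R) : 0 < b ->
  t <= (sigma b)^-1 * ln (r3 * sigma b / (1 - expR (- b))) ->
  (2 * r3)^-1 <= phi_Y b t.
Proof.
move=> b0; have s0 := sigma_gt0 b0.
have d0 : 0 < 1 - expR (- b) by rewrite subr_gt0 expR_lt1 oppr_lt0.
have r30 : 0 < r3 by rewrite sqrtr_gt0.
rewrite ler_pdivlMl// => H.
have {}H : expR (sigma b * t) <= r3 * sigma b / (1 - expR (- b)).
  by rewrite -[leRHS]lnK ?posrE ?divr_gt0 ?mulr_gt0// ler_expR.
have e0 := expR_gt0 (sigma b * t).
rewrite /phi_Y expRN -subr_ge0.
have -> : sigma b / expR (sigma b * t) / (2 * (1 - expR (- b))) - (2 * r3)^-1 =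
  (r3 * sigma b / (1 - expR (- b)) - expR (sigma b * t)) / (2 * r3 * expR (sigma b * t)).
  by field; rewrite !gt_eqF.
by rewrite divr_ge0 ?subr_ge0// ltW// !mulr_gt0.
Qed.

(** Brings (c) into the range of (a). Below [c0] the uniform value bounds every [phi_Y b t] from
    below, hence also their Laplace limit: sqrt 2 expR(sqrt 2 t) <= 2 sqrt 3, and expR x >= 1 + x
    then bounds t. *)
Lemma c0_le_sqrt3 (t : R) : 0 <= t -> (t%:E <= c0)%E -> t <= r3.
Proof.
move=> t0 tc.
have r30 : 0 < r3 by rewrite sqrtr_gt0.
pose a : R := Num.sqrt 2.
have a0 : 0 < a by rewrite sqrtr_gt0.
have a2 : a ^+ 2 = 2 by rewrite sqr_sqrtr.
have H : (2 * r3)^-1 <= a^-1 * expR (- (t * a)).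
  apply/ler_addgt0Pr => e e0; have [b b0 hb] := phi_Y_laplace t0 e0.
  apply: le_trans hb; apply: phi_Y_ge_uniform => //.
  by rewrite -lee_fin (le_trans tc)//; apply: ereal_inf_lbound; exists b.
have e1 := expR_ge1Dx (t * a).
have e0 := expR_gt0 (t * a).
have H2 : a * expR (t * a) <= 2 * r3.
  have := H; rewrite expRN -invfM lef_pV2 ?posrE ?mulr_gt0//.
have H3 : a * (1 + t * a) <= 2 * r3.
  by apply: le_trans H2; rewrite ler_pM2l.
by nra.
Qed.

End section_bounds.

Theorem theorem1 (R : realType) (d : nat) (K : set 'rV[R]_d) (L_K : R)
    (dT : measure_display) (T : measurableType dT)
    (P : R -> probability T R) (Y : forall b : R, {RV (P b) >-> R}) :
  isotropic K L_K ->
  (forall b : R, 0 < b -> has_density (P b) (Y b) (f_Y b)) ->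
  let sigma_Y (b : R) := std_dev (P b) (Y b) in
  [/\ (forall (t0 : R) (H : set 'rV[R]_d),
         0 <= t0 <= Num.sqrt 3 -> hyperplane H -> dist0 H = t0 * L_K ->
         ((L_K^-1)%:E *
          ereal_inf [set (sigma_Y b * f_Y b (t0 * sigma_Y b))%:E
                    | b in [set b : R | (0 < b)%R]]
          <= hyperplane_vol H (K `&` H))%E),
      (forall (t0 : R) (H : set 'rV[R]_d),
         (Num.sqrt 2)^-1 <= t0 <= Num.sqrt 3 ->
         hyperplane H -> dist0 H = t0 * L_K ->
         ((L_K^-1 * ((Num.sqrt 2)^-1 * expR (- (t0 * Num.sqrt 2))))%:E
          <= hyperplane_vol H (K `&` H))%E) &
      (forall (t0 : R) (H : set 'rV[R]_d),
         0 <= t0 -> (t0%:E <= c0)%E -> hyperplane H -> dist0 H = t0 * L_K ->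
         ((L_K^-1 * (2 * Num.sqrt 3)^-1)%:E
          <= hyperplane_vol H (K `&` H))%E)].
Proof.
move=> isoK hY sigma_Y.
have sE b : 0 < b -> sigma_Y b = sigma b.
  by move=> b0; exact: std_dev_truncated_laplace b0 (hY b b0).
have L0 : 0 < L_K by case: isoK.
have s2 : 0 < (Num.sqrt 2)^-1 :> R by rewrite invr_gt0 sqrtr_gt0.
split.
- move=> t0 H t0r hH distH.
  set S := [set _ | b in _].
  have SE b : 0 < b -> (sigma_Y b * f_Y b (t0 * sigma_Y b))%:E = (phi_Y b t0)%:E.
    by move=> b0; rewrite sE// phi_YE.
  have S0 : (0%:E <= ereal_inf S)%E.
    apply: le_ereal_inf_tmp => _ [b /= b0 <-]; rewrite lee_fin mulr_ge0 ?sqrtr_ge0//.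
    exact: f_Y_ge0.
  have S1 b : 0 < b -> (ereal_inf S <= (phi_Y b t0)%:E)%E.
    by move=> b0; rewrite -SE//; apply: ereal_inf_lbound; exists b.
  (* Between 0 and its value at b = 1, the infimum is a real number and can serve as the constant of
     [hyperplane_vol_ge]. *)
  have : ereal_inf S \is a fin_num.
    by rewrite ge0_fin_numE// (le_lt_trans (S1 1 ltr01))// ltry.
  move=> /fineK SA; rewrite -SA -EFinM; apply: (hyperplane_vol_ge isoK hH distH) => // b b0.
  by rewrite -lee_fin SA; exact: S1.
- move=> t0 H /andP[t02 t03] hH distH; apply: (hyperplane_vol_ge isoK hH distH) => //.
    by rewrite t03 (le_trans (ltW s2)).
  by move=> b b0; exact: phi_Y_ge_laplace.
- move=> t0 H t00 tc hH distH; apply: (hyperplane_vol_ge isoK hH distH) => //.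
    by rewrite t00 c0_le_sqrt3.
  move=> b b0; apply: phi_Y_ge_uniform => //.
  by rewrite -lee_fin (le_trans tc)//; apply: ereal_inf_lbound; exists b.
Qed.
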